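(* Let $\Phi$ be an (LB)-space. Define $\widetilde{\mathcal I}:\mathcal S(\Phi)\to\mathfrak R(\Phi)$ by $\widetilde{\mathcal I}(A(\xi),B(\xi))=P$, where $P\in\mathfrak R(\Phi)$ has generating function $$\sum_{k=0}^\infty P^{(k)}(\omega,\xi^{\otimes k})=\frac{A(\xi)}{1-\langle\omega,B(\xi)\rangle}=A(\xi)\sum_{k=0}^\infty\langle\omega,B(\xi)\rangle^k .$$ Define $\widetilde{\mathcal R}:\mathcal W(\Phi)\to\mathfrak r(\Phi)$ by $\widetilde{\mathcal R}:=\log\circ\,\widetilde{\mathcal I}\circ\operatorname{EXP}$. Then, for $(\alpha(\xi),\beta(\xi))\in\mathcal W(\Phi)$, $$\widetilde{\mathcal R}(\alpha(\xi),\beta(\xi))=\alpha(\nabla_0)+NM(\beta(\nabla_0)).$$ Furthermore, for any $(\alpha^{(m)}(\xi),\beta^{(m)}(\xi))\in\mathcal W(\Phi)$ ($m=1,2$), $$\big[\alpha^{(1)}(\nabla_0)+NM(\beta^{(1)}(\nabla_0)),\ \alpha^{(2)}(\nabla_0)+NM(\beta^{(2)}(\nabla_0))\big]$$ $$=D_{\beta^{(2)}}\alpha^{(1)}(\nabla_0)-D_{\beta^{(1)}}\alpha^{(2)}(\nabla_0)+NM\big(D_{\beta^{(2)}}\beta^{(1)}(\nabla_0)-D_{\beta^{(1)}}\beta^{(2)}(\nabla_0)\big).$$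
   Context: **Spaces.** All vector spaces are complex; $\mathbb N=\{1,2,\dots\}$, $\mathbb N_0=\mathbb N\cup\{0\}$. An (LB)-space $\Phi=\bigcup_n\Phi_n$: each $\Phi_n$ is a Banach space, $\Phi_n$ is a subspace of $\Phi_{n+1}$ on which the two norms coincide, and $\Phi$ has the locally convex inductive limit topology; $\Phi'$ is its continuous dual. For a Banach space $B$, $B^{\hat\otimes k}$ is the $k$-fold completed injective tensor power, $\operatorname{Sym}_k$ the symmetrization projection on it, $B^{\hat\odot k}:=\operatorname{Sym}_k(B^{\hat\otimes k})$. Set $\Phi^{\hat\odot k}:=\operatorname{ind\,lim}_n\Phi_n^{\hat\odot k}$ (an (LB)-space), $\Phi^{\hat\odot 0}:=\mathbb C$. For (LB)-spaces $E=\operatorname{ind\,lim}E_n$, $F=\operatorname{ind\,lim}F_m$, the space $\mathcal L(E,F)$ of continuous linear operators has the topology $\operatorname{proj\,lim}_n\operatorname{ind\,lim}_m\mathcal L(E_n,F_m)$ (via restriction to $E_n$; operator norm on $\mathcal L(E_n,F_m)$); $(\Phi^{\hat\odot k})'=\mathcal L(\Phi^{\hat\odot k},\mathbb C)$. For $A_m\in\mathcal L(\Phi^{\hat\odot i_m},\Phi^{\hat\odot j_m})$ ($m=1,2$), $A_1\odot A_2\in\mathcal L(\Phi^{\hat\odot(i_1+i_2)},\Phi^{\hat\odot(j_1+j_2)})$ is $\operatorname{Sym}_{j_1+j_2}(A_1\otimes A_2)$ restricted to $\Phi^{\hat\odot(i_1+i_2)}$ (multiplication by scalars if a factor is a scalar).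 $\mathbf 1_k$ is the identity of $\Phi^{\hat\odot k}$. **Formal tensor power series.** A formal series $C(\xi)=\sum_{k\ge i}C_k\xi^{\otimes k}$ of $\xi\in\Phi$ with values in $\Phi^{\hat\odot i}$ is a sequence of coefficients $C_k\in\mathcal L(\Phi^{\hat\odot k},\Phi^{\hat\odot i})$. $\mathcal F_0(\Phi)$: scalar-valued series $1+\sum_{k\ge1}A_k\xi^{\otimes k}$. $\mathcal F_1(\Phi)$: $\Phi$-valued series $\xi+\sum_{k\ge2}B_k\xi^{\otimes k}$ (so $B_1=\mathbf 1_1$). $\mathcal W_0(\Phi)$: series $\sum_{k\ge1}\alpha_k\xi^{\otimes k}$, $\alpha_k\in(\Phi^{\hat\odot k})'$. $\mathcal W_1(\Phi)$: series $\sum_{k\ge2}\beta_k\xi^{\otimes k}$, $\beta_k\in\mathcal L(\Phi^{\hat\odot k},\Phi)$. $\mathcal W(\Phi)=\mathcal W_0(\Phi)\times\mathcal W_1(\Phi)$. Product of scalar series: coefficients $\sum_{l=0}^kA^{(1)}_l\odot A^{(2)}_{k-l}$. Composition $C(B(\xi))$ with $B(\xi)=\sum_{k\ge1}B_k\xi^{\otimes k}$ $\Phi$-valued: $k$th coefficient $\sum_{l=1}^kC_l\sum_{i_1+\dots+i_l=k,\,i_j\ge1}B_{i_1}\odot\cdots\odot B_{i_l}$ for $k\ge1$, and $0$th coefficient $C_0$ (if present). The derivative of $C(\xi)=\sum_{k\ge i}C_k\xi^{\otimes k}$ (values in $\Phi^{\hat\odot i}$) in direction $B(\xi)=\sum_{k\ge1}B_k\xi^{\otimes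 k}$ ($\Phi$-valued) is $D_BC(\xi)=\sum_{k\ge i}kC_k(\xi^{\otimes(k-1)}\odot B(\xi))$, i.e. the series with $k$th coefficient $\sum_{l=i}^{k}l\,C_l(\mathbf 1_{l-1}\odot B_{k-l+1})$. $\mathcal S(\Phi):=\mathcal F_0(\Phi)\times\mathcal F_1(\Phi)$ is a group for $(A^{(1)},B^{(1)})\ast(A^{(2)},B^{(2)})=(A^{(1)}(B^{(2)}(\xi))A^{(2)}(\xi),\,B^{(1)}(B^{(2)}(\xi)))$. $\operatorname{EXP}:\mathcal W(\Phi)\to\mathcal S(\Phi)$ is its exponential map: $\operatorname{EXP}(\alpha,\beta)=\gamma(1)$, where $\gamma:\mathbb R\to\mathcal S(\Phi)$ is the one-parameter subgroup (with coefficients smooth in $t$) such that coefficientwise $\gamma'(0)=(\alpha,\beta)$. **Operators.** A polynomial on $\Phi'$ is a function $p(\omega)=\sum_{k=0}^K\langle\omega^{\otimes k},f^{(k)}\rangle$, $f^{(k)}\in\Phi^{\hat\odot k}$ (dual pairing; $\langle\omega^{\otimes0},f^{(0)}\rangle=f^{(0)}$); the $f^{(k)}$ are determined by $p$, and $\mathcal P(\Phi')$, the space of polynomials, has the topology of the locally convex direct sum of the $\Phi^{\hat\odot k}$. $\mathbb M(\Phi)$ is the set of continuous linear operators $P$ on $\mathcal P(\Phi')$ with $(P\langle\cdot^{\otimes k},f^{(k)}\rangle)(\omega)=P^{(k)}(\omega,f^{(k)}):=\sum_{i=0}^k\langle\omega^{\otimes i},P_{ik}f^{(k)}\rangle$,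 where $P_{ik}\in\mathcal L(\Phi^{\hat\odot k},\Phi^{\hat\odot i})$ and $P_{kk}=\mathbf 1_k$; $P=[P_{ik}]_{i,k\in\mathbb N_0}$ with $P_{ik}=0$ for $i>k$. $\mathbb V(\Phi)$: operators of the same form with zero diagonal blocks. $\log(P)=\sum_{n\ge1}\frac{(-1)^{n+1}}n(P-\mathbf 1)^n$ maps $\mathbb M(\Phi)$ bijectively onto $\mathbb V(\Phi)$. $\mathbb S(\Phi)$ is the set of Sheffer operators: $P\in\mathbb M(\Phi)$ with $\sum_{k\ge0}\frac1{k!}P^{(k)}(\omega,\xi^{\otimes k})=\exp[\langle\omega,B(\xi)\rangle]A(\xi)$ for some $(A,B)\in\mathcal S(\Phi)$. The Riordan group on $\Phi'$ is $\mathfrak R(\Phi):=\{[(k!/i!)P_{ik}]_{i,k\in\mathbb N_0}: [P_{ik}]\in\mathbb S(\Phi)\}\subset\mathbb M(\Phi)$; equivalently, it is the set of $P\in\mathbb M(\Phi)$ with $\sum_{k\ge0}P^{(k)}(\omega,\xi^{\otimes k})=A(\xi)/(1-\langle\omega,B(\xi)\rangle)$ for some $(A,B)\in\mathcal S(\Phi)$. It is a Lie group with Lie algebra $\mathfrak r(\Phi):=\log(\mathfrak R(\Phi))$, a closed subspace of $\mathbb V(\Phi)$; the Lie bracket is the commutator of operators. **Notation $\nabla_0$, $N$, $M$.** For $\alpha_k\in(\Phi^{\hat\odot k})'$ and $\beta_k\in\mathcal L(\Phi^{\hat\odot k},\Phi)$, $\alpha_k\nabla_0^k$ and $M(\beta_k\nabla_0^k)$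 are the operators in $\mathbb V(\Phi)$ given by $(\alpha_k\nabla_0^k\langle\cdot^{\otimes n},f^{(n)}\rangle)(\omega)=\chi_{n\ge k}\langle\omega^{\otimes(n-k)},(\mathbf 1_{n-k}\odot\alpha_k)f^{(n)}\rangle$ and $(M(\beta_k\nabla_0^k)\langle\cdot^{\otimes n},f^{(n)}\rangle)(\omega)=\chi_{n\ge k}\langle\omega^{\otimes(n-k+1)},(\mathbf 1_{n-k}\odot\beta_k)f^{(n)}\rangle$, where $\chi_{n\ge k}=1$ if $n\ge k$ and $0$ otherwise. $\alpha(\nabla_0):=\sum_{k\ge1}\alpha_k\nabla_0^k$, $M(\beta(\nabla_0)):=\sum_{k\ge2}M(\beta_k\nabla_0^k)$ for $\alpha(\xi)=\sum_{k\ge1}\alpha_k\xi^{\otimes k}\in\mathcal W_0(\Phi)$, $\beta(\xi)=\sum_{k\ge2}\beta_k\xi^{\otimes k}\in\mathcal W_1(\Phi)$. $N$ is the number operator, $(N\langle\cdot^{\otimes n},f^{(n)}\rangle)(\omega)=n\langle\omega^{\otimes n},f^{(n)}\rangle$, and $NM(\cdot)$ is the composition of operators. $D_{\beta^{(2)}}\alpha^{(1)}(\nabla_0)$ means $\alpha(\nabla_0)$ for the series $\alpha=D_{\beta^{(2)}}\alpha^{(1)}$, and similarly for the other terms. *)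

(* Defs.v *)
From HB Require Import structures.
From mathcomp Require Import all_boot all_order all_fingroup all_algebra.
From mathcomp Require Import all_classical all_reals all_analysis.
From mathcomp Require Import complex.
Set Implicit Arguments.
Unset Strict Implicit.
Unset Printing Implicit Defensive.
Import Order.TTheory GRing.Theory Num.Theory.
Import numFieldNormedType.Exports.
Local Open Scope ring_scope.
Local Open Scope complex_scope.
Local Open Scope classical_set_scope.

(* Description operator: an element of P, or x0 if P is empty. It is only
   applied to sets that are meant to have exactly one element. *)
Definition the (T : Type) (x0 : T) (P : set T) : T :=
  if pselect (exists x, P x) is left h then projT1 (cid h) else x0.

Record subspace (K : pzRingType) (V : lmodType K) := Subspace {
  sub_set :> set V;
  sub_set0 : sub_set 0;
  sub_setP : forall (a : K) x y, sub_set x -> sub_set y -> sub_set (a *: x + y)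
}.

Section SubspaceType.
Variables (K : pzRingType) (V : lmodType K) (S : subspace V).

Definition subspace_pred : {pred V} := fun x => `[< sub_set S x >].

Lemma subspace_pred_closed : submod_closed subspace_pred.
Proof.
split; first by apply/asboolP; exact: sub_set0.
by move=> a x y /asboolP Sx /asboolP Sy; apply/asboolP; exact: sub_setP.
Qed.

HB.instance Definition _ :=
  GRing.isSubmodClosed.Build K V subspace_pred subspace_pred_closed.

Record subspace_of := SubspaceOf {
  subval :> V;
  subvalP : subval \in subspace_pred
}.

HB.instance Definition _ := [isSub for subval].
HB.instance Definition _ := [Choice of subspace_of by <:].
HB.instance Definition _ := [SubChoice_isSubLmodule of subspace_of by <:].

End SubspaceType.

Section LocallyConvex.
Variables (K : numDomainType) (V : lmodType K).

Definition abs_convex (W : set V) : Prop :=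
  forall (a b : K) x y, W x -> W y -> `|a| + `|b| <= 1 -> W (a *: x + b *: y).

(* The open sets of the locally convex topology whose basic neighbourhoods of
   the origin are the absolutely convex sets satisfying N. *)
Definition lc_open (N : set (set V)) (U : set V) : Prop :=
  forall x, U x -> exists W, [/\ abs_convex W, N W & forall w, W w -> U (x + w)].

Variable N : set (set V).
Hypothesis NT : N setT.
Hypothesis NI : forall A B, N A -> N B -> N (A `&` B).

Lemma lc_openT : lc_open N setT.
Proof. by move=> x _; exists setT; split. Qed.

Lemma lc_openI : setI_closed (lc_open N).
Proof.
move=> A B oA oB x [Ax Bx].
have [W1 [c1 N1 s1]] := oA _ Ax; have [W2 [c2 N2 s2]] := oB _ Bx.
exists (W1 `&` W2); split; [|exact: NI|by move=> w [/s1 ? /s2 ?]].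
by move=> a b y z [y1 y2] [z1 z2] ab; split; [exact: c1|exact: c2].
Qed.

Lemma lc_open_bigU (I : Type) (f : I -> set V) :
  (forall i, lc_open N (f i)) -> lc_open N (\bigcup_i f i).
Proof.
move=> of_ x [i _ fx]; have [W [c n s]] := of_ i _ fx.
by exists W; split=> // w /s ?; exists i.
Qed.

End LocallyConvex.

(* lb_car is the union of the Banach spaces lb_step n, and carries no norm. *)
Record LBspace (R : realType) := MkLBspace {
  lb_car : lmodType R[i];
  lb_step : nat -> completeNormedModType R[i];
  lb_incl : forall n, {linear lb_step n -> lb_car};
  lb_incl_inj : forall n, injective (lb_incl n);
  lb_incl_mono : forall n (x : lb_step n),
    exists y : lb_step n.+1, lb_incl n.+1 y = lb_incl n x /\ `|y| = `|x|;
  lb_cover : forall v : lb_car, exists n (x : lb_step n), lb_incl n x = v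
}.

Section LBTopology.
Variables (R : realType) (Phi : LBspace R).

Definition lb_type : Type := lb_car Phi.
HB.instance Definition _ := GRing.Lmodule.on lb_type.

Definition lb_nbhs0 : set (set lb_type) :=
  [set W | forall n, nbhs (0 : lb_step Phi n) (lb_incl Phi n @^-1` W)].

Lemma lb_nbhs0T : lb_nbhs0 setT.
Proof. by move=> n; exact: filterT. Qed.

Lemma lb_nbhs0I A B : lb_nbhs0 A -> lb_nbhs0 B -> lb_nbhs0 (A `&` B).
Proof. by move=> a b n; exact: filterI. Qed.

HB.instance Definition _ := isOpenTopological.Build lb_type
  (lc_openT lb_nbhs0T) (lc_openI lb_nbhs0I) (@lc_open_bigU _ _ lb_nbhs0).

Definition is_dual (phi : lb_type -> R[i]^o) : Prop :=
  linear phi /\ continuous phi.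

Definition dual : Type := {phi : lb_type -> R[i]^o | is_dual phi}.
Definition dual_fun (phi : dual) : lb_type -> R[i]^o := proj1_sig phi.

End LBTopology.
Coercion dual_fun : dual >-> Funclass.

(* Increasing sequences of (semi)normed subspaces of a common vector space;
   [norm_le n x c] says that the norm of the n-th subspace is <= c at x. *)
Record indsys (R : realType) := IndSys {
  amb : lmodType R[i];
  stp : nat -> subspace amb;
  stp_mono : forall n, stp n `<=` stp n.+1;
  norm_le : nat -> amb -> R[i] -> Prop;
  norm_le_mono : forall n x (c d : R[i]), c <= d -> norm_le n x c -> norm_le n x d
}.

Section IndLim.
Variables (R : realType) (E : indsys R).

Lemma stp_leq m n : (m <= n)%N -> stp E m `<=` stp E n.
Proof.
move/subnK <-; elim: (n - m)%N => [//|k IH] x /IH.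
by rewrite addSn; exact: stp_mono.
Qed.

Lemma union0 : (\bigcup_n stp E n) 0.
Proof. by exists 0%N => //; exact: sub_set0. Qed.

Lemma unionP (a : R[i]) x y : (\bigcup_n stp E n) x -> (\bigcup_n stp E n) y ->
  (\bigcup_n stp E n) (a *: x + y).
Proof.
move=> [m _ mx] [n _ ny]; exists (maxn m n) => //; apply: sub_setP.
  by apply: stp_leq mx; exact: leq_maxl.
by apply: stp_leq ny; exact: leq_maxr.
Qed.

Definition union_sub : subspace (amb E) := Subspace union0 unionP.

Definition stage (n : nat) : Type := subspace_of (stp E n).
HB.instance Definition _ n := GRing.Lmodule.on (stage n).

Definition indlim : Type := subspace_of union_sub.
HB.instance Definition _ := GRing.Lmodule.on indlim.

Lemma stage_union n (x : stage n) : subval x \in subspace_pred union_sub.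
Proof. by apply/asboolP; exists n => //; exact/asboolP/(subvalP x). Qed.

Definition stage_incl n (x : stage n) : indlim := SubspaceOf (stage_union x).

Definition indlim_nbhs0 : set (set indlim) :=
  [set W | forall n, exists2 e : R[i], 0 < e &
     forall x : stage n, norm_le n (subval x) e -> W (stage_incl x)].

Lemma indlim_nbhs0T : indlim_nbhs0 setT.
Proof. by move=> n; exists 1. Qed.

Lemma indlim_nbhs0I A B :
  indlim_nbhs0 A -> indlim_nbhs0 B -> indlim_nbhs0 (A `&` B).
Proof.
move=> nA nB n; have [a a0 hA] := nA n; have [b b0 hB] := nB n.
have ab : (a >=< b)%R by rewrite real_comparable ?gtr0_real.
have [le_ab|le_ba] := orP ab.
  exists a => // x xa; split; [exact: hA|apply: hB].
  by move: xa; exact: norm_le_mono.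
exists b => // x xb; split; [apply: hA|exact: hB].
by move: xb; exact: norm_le_mono.
Qed.

HB.instance Definition _ := isOpenTopological.Build indlim
  (lc_openT indlim_nbhs0T) (lc_openI indlim_nbhs0I)
  (@lc_open_bigU _ _ indlim_nbhs0).

End IndLim.


Definition contlin (K : numDomainType) (U V : preTopologicalLmodType K)
  (f : U -> V) : Prop := linear f /\ continuous f.

(* The topology proj lim_n ind lim_m L(E_n, F_m) of L(E, F). *)
Section OperatorTopology.
Variables (R : realType) (E F : indsys R).

Definition opnorm_le n m (A : stage E n -> indlim F) (c : R[i]) : Prop :=
  (forall x, sub_set (stp F m) (subval (A x))) /\
  (forall x, norm_le n (subval x) 1 -> norm_le m (subval (A x)) c).

Definition op_nbhs0 n : set (set (stage E n -> indlim F)) :=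
  [set W | abs_convex W /\
     forall m, exists2 e : R[i], 0 < e &
       forall A, linear A -> @opnorm_le n m A e -> W A].

Definition op_deriv_at (c : R -> indlim E -> indlim F) (t : R)
    (A : indlim E -> indlim F) : Prop :=
  forall n W, @op_nbhs0 n W -> \forall h \near (0 : R)^',
    W (fun x => (h%:C)^-1 *: (c (t + h) (stage_incl x) - c t (stage_incl x))
                - A (stage_incl x)).

Definition op_smooth (c : R -> indlim E -> indlim F) : Prop :=
  exists d : nat -> R -> indlim E -> indlim F, d 0%N = c /\
    forall j t, contlin (d j t) /\ op_deriv_at (d j) t (d j.+1 t).

End OperatorTopology.

Section Tensors.
Variables (R : realType) (Phi : LBspace R).
Local Notation C := R[i].
Local Notation dual := (dual Phi).

(* The completed injective tensor power of B is the closure, among the bounded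
   k-linear forms on B', of the span of the elementary tensors
   (phi_1, ..., phi_k) |-> phi_1 x_1 * ... * phi_k x_k. As every bounded
   functional on Phi_n extends to Phi (Hahn-Banach), the powers of all the
   Phi_n are realized on a common domain, as functions of k elements of Phi'. *)
Definition form (k : nat) : Type := ('I_k -> dual) -> C^o.
HB.instance Definition _ k := GRing.Lmodule.on (form k).

Definition elem k (x : 'I_k -> lb_type Phi) : form k :=
  fun phi => \prod_i (phi i (x i) : C).

(* The injective norm of Phi_n^{(x)k} is at most c at t; r i ranges over the
   upper bounds of the norm of the restriction of phi i to Phi_n. *)
Definition inj_norm_le k (n : nat) (t : form k) (c : C) : Prop :=
  forall (phi : 'I_k -> dual) (r : 'I_k -> C),
    (forall i, 0 <= r i) ->
    (forall i (x : lb_step Phi n), `|phi i (lb_incl Phi n x)| <= r i * `|x|) ->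
    `|t phi| <= c * \prod_i r i.

Definition elem_span k n : set (form k) :=
  [set s | exists l : seq (C * ('I_k -> lb_step Phi n)),
     s = \sum_(p <- l) p.1 *: elem (fun i => lb_incl Phi n (p.2 i))].

Definition tens_stp k n : set (form k) :=
  [set t | forall e : C, 0 < e ->
     exists2 s, @elem_span k n s & inj_norm_le n (t - s) e].

Definition symz k (t : form k) : form k :=
  fun phi => (k`!%:R)^-1 * \sum_(s : 'S_k) t (fun i => phi (s i)).

Definition sym_stp k n : set (form k) := @symz k @` @tens_stp k n.

Lemma inj_norm_le_mono k n (t : form k) (c d : C) :
  c <= d -> inj_norm_le n t c -> inj_norm_le n t d.
Proof.
move=> cd h phi r r0 hr; apply: le_trans (h _ _ r0 hr) _.
by apply: ler_wpM2r => //; apply: prodr_ge0.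
Qed.

Lemma inj_norm_leD k n (t u : form k) (c d : C) :
  inj_norm_le n t c -> inj_norm_le n u d -> inj_norm_le n (t + u) (c + d).
Proof.
move=> ht hu phi r r0 hr; rewrite mulrDl; apply: le_trans (ler_normD _ _) _.
by apply: lerD; [exact: ht|exact: hu].
Qed.

Lemma inj_norm_leZ k n (t : form k) (a c : C) :
  inj_norm_le n t c -> inj_norm_le n (a *: t) (`|a| * c).
Proof.
move=> ht phi r r0 hr; rewrite [X in `|X|]/(a * t phi) normrM -mulrA.
by apply: ler_wpM2l => //; exact: ht.
Qed.

Lemma elem_spanP k n a (s t : form k) :
  @elem_span k n s -> @elem_span k n t -> @elem_span k n (a *: s + t).
Proof.
move=> [ls ->] [lt ->].
exists ([seq (a * p.1, p.2) | p <- ls] ++ lt).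
rewrite big_cat big_map scaler_sumr; congr (_ + _).
by apply: eq_bigr => p _; rewrite scalerA.
Qed.

Lemma elem_span0 k n : @elem_span k n 0.
Proof. by exists [::]; rewrite big_nil. Qed.

Lemma elem_span_tens k n s : @elem_span k n s -> @tens_stp k n s.
Proof.
move=> hs e e0; exists s => // phi r r0 _; rewrite subrr normr0.
by apply: mulr_ge0; [exact: ltW|exact: prodr_ge0].
Qed.

Lemma tens_stp0 k n : @tens_stp k n 0.
Proof. exact/elem_span_tens/elem_span0. Qed.

Lemma tens_stpP k n (a : C) s t :
  @tens_stp k n s -> @tens_stp k n t -> @tens_stp k n (a *: s + t).
Proof.
move=> hs ht e e0.
have a1 : 0 < `|a| + 1 by rewrite ltr_wpDl.
have e2 : 0 < e / 2 by rewrite divr_gt0.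
have [s' ss' hs'] := hs (e / 2 / (`|a| + 1)) (divr_gt0 e2 a1).
have [t' tt' ht'] := ht (e / 2) e2.
exists (a *: s' + t'); first exact: elem_spanP.
have -> : a *: s + t - (a *: s' + t') = a *: (s - s') + (t - t').
  by rewrite scalerBr opprD addrACA.
have := inj_norm_leD (inj_norm_leZ a hs') ht'; apply: inj_norm_le_mono.
rewrite [leRHS](splitr e) lerD2r mulrCA ler_piMr ?(ltW e2)//.
by rewrite ler_pdivrMr// mul1r lerDl.
Qed.

Lemma elem_span_mono k n : @elem_span k n `<=` @elem_span k n.+1.
Proof.
move=> _ [l ->].
have [g hg] : exists g : lb_step Phi n -> lb_step Phi n.+1,
    forall x, lb_incl Phi n.+1 (g x) = lb_incl Phi n x.
  have /choice[g hg] := fun x => lb_incl_mono (l := Phi) (n := n) x.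
  by exists g => x; case: (hg x).
exists [seq (p.1, fun i => g (p.2 i)) | p <- l]; rewrite big_map.
apply: eq_bigr => p _; congr (_ *: elem _).
by apply/funext => i; rewrite hg.
Qed.

Lemma tens_stp_mono k n : @tens_stp k n `<=` @tens_stp k n.+1.
Proof.
move=> t ht e e0; have [s ss hs] := ht e e0.
exists s; first exact: elem_span_mono.
move=> phi r r0 hr; apply: hs => // i x.
by have [y [<- <-]] := lb_incl_mono x.
Qed.

Lemma symzP k (a : C) (s t : form k) :
  symz (a *: s + t) = a *: symz s + symz t.
Proof.
apply/funext => phi; rewrite [RHS]/(a * symz s phi + symz t phi) /symz.
by rewrite big_split/= -mulr_sumr mulrDr mulrCA.
Qed.

Lemma symz0 k : symz (0 : form k) = 0.
Proof. by apply/funext => phi; rewrite /symz big1 ?mulr0. Qed.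

Lemma sym_stp0 k n : @sym_stp k n 0.
Proof. by exists 0; [exact: tens_stp0|exact: symz0]. Qed.

Lemma sym_stpP k n (a : C) s t :
  @sym_stp k n s -> @sym_stp k n t -> @sym_stp k n (a *: s + t).
Proof.
by move=> [u hu <-] [v hv <-]; exists (a *: u + v);
  [exact: tens_stpP|exact: symzP].
Qed.

Lemma sym_stp_mono k n : @sym_stp k n `<=` @sym_stp k n.+1.
Proof. by move=> _ [t ht <-]; exists t => //; exact: tens_stp_mono. Qed.

Definition tens_sys k : indsys R := @IndSys R (form k)
  (fun n => Subspace (tens_stp0 k n) (@tens_stpP k n)) (@tens_stp_mono k)
  (@inj_norm_le k) (@inj_norm_le_mono k).

Definition sym_sys k : indsys R := @IndSys R (form k)
  (fun n => Subspace (sym_stp0 k n) (@sym_stpP k n)) (@sym_stp_mono k)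
  (@inj_norm_le k) (@inj_norm_le_mono k).

End Tensors.

Notation TensPow Phi k := (indlim (tens_sys Phi k)).
(* SymPow Phi 0 is C and SymPow Phi 1 is Phi, with v in Phi seen as the evaluation
   form phi |-> phi v. *)
Notation SymPow Phi k := (indlim (sym_sys Phi k)).

Section TensorAlgebra.
Variables (R : realType) (Phi : LBspace R).
Local Notation C := R[i].
Local Notation dual := (dual Phi).
Local Notation form := (form Phi).
Local Notation Tens k := (TensPow Phi k).
Local Notation Sym k := (SymPow Phi k).

Lemma elem_span_sum k n (I : Type) (r : seq I) (P : pred I) (F : I -> form k) :
  (forall i, P i -> @elem_span R Phi k n (F i)) ->
  elem_span n (\sum_(i <- r | P i) F i).
Proof.
move=> h; elim/big_rec: _ => [|i x Pi hx]; first exact: elem_span0.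
by rewrite -[F i]scale1r; apply: elem_spanP => //; exact: h.
Qed.

Lemma elem_span_elem k n (x : 'I_k -> lb_step Phi n) :
  elem_span n (elem (fun i => lb_incl Phi n (x i)) : form k).
Proof. by exists [:: (1, x)]; rewrite big_seq1 scale1r. Qed.

Lemma elem_spanZ k n (a : C) (s : form k) :
  elem_span n s -> elem_span n (a *: s).
Proof.
by move=> hs; rewrite -[_ *: _]addr0; apply: elem_spanP => //; exact: elem_span0.
Qed.

Lemma symz_linear_sum k (I : Type) (r : seq I) (F : I -> form k) :
  symz (\sum_(i <- r) F i) = \sum_(i <- r) symz (F i).
Proof.
elim: r => [|i r IH]; first by rewrite !big_nil symz0.
by rewrite !big_cons -IH -[F i in LHS]scale1r symzP scale1r.
Qed.

Lemma symzZ k (a : C) (t : form k) : symz (a *: t) = a *: symz t.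
Proof. by rewrite -[a *: t]addr0 symzP symz0 addr0. Qed.

Lemma elem_span_symz k n (s : form k) : elem_span n s -> elem_span n (symz s).
Proof.
move=> [l ->]; rewrite symz_linear_sum; apply: elem_span_sum => -[a x] _ /=.
rewrite symzZ; apply: elem_spanZ.
have -> : symz (elem (fun i => lb_incl Phi n (x i)) : form k) = (k`!%:R)^-1 *:
    \sum_(s : 'S_k) elem (fun i => lb_incl Phi n (x ((s^-1)%g i))).
  apply/funext => phi.
  rewrite [RHS]/((_ : C) * _) fct_sumE /symz; congr (_ * _).
  apply: eq_bigr => s' _; rewrite /elem.
  by rewrite [RHS](reindex_inj (@perm_inj _ s')); apply: eq_bigr => i _; rewrite permK.
by apply: elem_spanZ; apply: elem_span_sum => s' _; exact: elem_span_elem.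
Qed.

Lemma inj_norm_le_symz k n (t : form k) (c : C) :
  inj_norm_le n t c -> inj_norm_le n (symz t) c.
Proof.
move=> ht phi r r0 hr; rewrite /symz normrM normfV normr_nat.
have kf : 0 < k`!%:R :> C by rewrite ltr0n fact_gt0.
rewrite ler_pdivrMl//; apply: le_trans (ler_norm_sum _ _ _) _.
have -> : k`!%:R * (c * \prod_i r i) = \sum_(s : 'S_k) (c * \prod_i r i).
  by rewrite sumr_const card_Sn mulr_natl.
apply: ler_sum => s _.
rewrite [X in c * X](reindex_inj (@perm_inj _ s)) /=.
exact: ht.
Qed.

Lemma tens_stp_symz k n (t : form k) :
  @tens_stp R Phi k n t -> tens_stp n (symz t).
Proof.
move=> ht e e0; have [s hs hts] := ht e e0.
exists (symz s); first exact: elem_span_symz.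
have -> : symz t - symz s = symz (t - s).
  by rewrite addrC -scaleN1r -symzP scaleN1r addrC.
exact: inj_norm_le_symz.
Qed.

Lemma sym_tens k (f : Sym k) :
  subval f \in subspace_pred (union_sub (tens_sys Phi k)).
Proof.
have /asboolP[n _ [t ht <-]] := subvalP f; apply/asboolP.
by exists n => //; exact: tens_stp_symz.
Qed.

Lemma symz_sym k (t : Tens k) :
  symz (subval t) \in subspace_pred (union_sub (sym_sys Phi k)).
Proof.
have /asboolP[n _ ht] := subvalP t; apply/asboolP.
by exists n => //; exists (subval t).
Qed.

Definition sym_incl k (f : Sym k) : Tens k := SubspaceOf (sym_tens f).
Definition sym_proj k (t : Tens k) : Sym k := SubspaceOf (symz_sym t).

Definition form_prod m n (s : form m) (t : form n) : form (m + n) :=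
  fun phi => (s (fun i => phi (lshift n i)) : C) * t (fun j => phi (rshift m j)).

Lemma form_prod_elem_span m n q (s : form m) (t : form n) :
  elem_span q s -> elem_span q t -> elem_span q (form_prod s t).
Proof.
move=> [ls ->] [lt ->].
have -> : form_prod
    (\sum_(p <- ls) p.1 *: elem (fun i => lb_incl Phi q (p.2 i)))
    (\sum_(p <- lt) p.1 *: elem (fun i => lb_incl Phi q (p.2 i))) =
  \sum_(p <- ls) \sum_(p' <- lt) (p.1 * p'.1) *: elem (fun i =>
     lb_incl Phi q (match fintype.split i with inl j => p.2 j | inr j => p'.2 j end)).
  apply/funext => phi; rewrite /form_prod !fct_sumE mulr_suml.
  apply: eq_bigr => p _; rewrite fct_sumE mulr_sumr.
  apply: eq_bigr => p' _.
  apply: etrans; first exact: (@mulrACA C).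
  congr (_ * _); rewrite /elem big_split_ord /=.
  congr (_ * _); apply: eq_bigr => i _.
    by rewrite -[lshift _ i]/(unsplit (inl i)) unsplitK.
  by rewrite -[rshift _ i]/(unsplit (inr i)) unsplitK.
apply: elem_span_sum => p _; apply: elem_span_sum => p' _.
exact/elem_spanZ/elem_span_elem.
Qed.

Lemma inj_norm_le_prod m n q (s : form m) (t : form n) (c d : C) : 0 <= c ->
  inj_norm_le q s c -> inj_norm_le q t d ->
  inj_norm_le q (form_prod s t) (c * d).
Proof.
move=> c0 hs ht phi r r0 hr; rewrite /form_prod normrM big_split_ord mulrACA.
by apply: ler_pM => //; [exact: hs|exact: ht].
Qed.

Lemma tens_stp_bounded k q (t : form k) :
  tens_stp q t -> exists2 c : C, 0 <= c & inj_norm_le q t c.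
Proof.
have hspan s : elem_span q s -> exists2 c : C, 0 <= c & inj_norm_le (k := k) q s c.
  move=> [l ->]; elim: l => [|[a x] l [c c0 IH]].
    by exists 0 => // phi r _ _; rewrite big_nil normr0 mul0r.
  exists (`|a| * \prod_i `|x i| + c).
    by rewrite addr_ge0// mulr_ge0// prodr_ge0.
  rewrite big_cons; apply: inj_norm_leD => //; apply: inj_norm_leZ.
  move=> phi r r0 hr; rewrite /elem normr_prod -big_split.
  by apply: ler_prod => i _; rewrite normr_ge0 /= mulrC hr.
move=> /(_ 1 ltr01)[s /hspan[c c0 hc] hts]; exists (1 + c); first by rewrite addr_ge0.
by rewrite -[t](subrK s); exact: inj_norm_leD.
Qed.

Lemma tens_stp_prod m n q (s : form m) (t : form n) :
  tens_stp q s -> tens_stp q t -> tens_stp q (form_prod s t).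
Proof.
move=> hs ht e e0; have [c c0 hc] := tens_stp_bounded ht.
have c1 : 0 < c + 1 by rewrite ltr_wpDl.
have e2 : 0 < e / 2 by rewrite divr_gt0.
have [s' ss' hs'] := hs _ (divr_gt0 e2 c1).
have [d d0 hd] := tens_stp_bounded (elem_span_tens ss').
have d1 : 0 < d + 1 by rewrite ltr_wpDl.
have [t' tt' ht'] := ht _ (divr_gt0 e2 d1).
exists (form_prod s' t'); first exact: form_prod_elem_span.
have -> : form_prod s t - form_prod s' t' =
    form_prod (s - s') t + form_prod s' (t - t').
  have key (a b c' d' : C) : a * c' - b * d' = (a - b) * c' + b * (c' - d').
    by rewrite mulrBl mulrBr addrA subrK.
  by apply/funext => phi; exact: key.
have le0 : 0 <= e / 2 / (c + 1) by rewrite ltW// divr_gt0.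
have := inj_norm_leD (inj_norm_le_prod le0 hs' hc) (inj_norm_le_prod d0 hd ht').
apply: inj_norm_le_mono; rewrite [leRHS](splitr e); apply: lerD.
  by rewrite mulrAC ler_pdivrMr// ler_wpM2l ?(ltW e2)// lerDl.
by rewrite mulrC mulrAC ler_pdivrMr// ler_wpM2l ?(ltW e2)// lerDl.
Qed.

Lemma tens_prod_subproof m n (f : Tens m) (g : Tens n) :
  form_prod (subval f) (subval g) \in subspace_pred (union_sub (tens_sys Phi (m + n))).
Proof.
have /asboolP[p _ hf] := subvalP f; have /asboolP[q _ hg] := subvalP g.
apply/asboolP; exists (maxn p q) => //; apply: tens_stp_prod.
  by apply: (stp_leq (E := tens_sys Phi m)) hf; exact: leq_maxl.
by apply: (stp_leq (E := tens_sys Phi n)) hg; exact: leq_maxr.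
Qed.

Definition tens_prod m n (f : Tens m) (g : Tens n) : Tens (m + n) :=
  SubspaceOf (tens_prod_subproof f g).

Definition op_tens i1 j1 i2 j2 (A1 : Tens i1 -> Tens j1)
    (A2 : Tens i2 -> Tens j2) : Tens (i1 + i2) -> Tens (j1 + j2) :=
  the 0 [set S | contlin S /\
    forall f g, S (tens_prod f g) = tens_prod (A1 f) (A2 g)].

(* A1 and A2 are extended from the symmetric to the full tensor powers by means
   of the projections sym_proj; the result depends only on A1 and A2, as the
   elements of SymPow Phi (i1 + i2) are symmetric. *)
Definition odot i1 j1 i2 j2 (A1 : Sym i1 -> Sym j1) (A2 : Sym i2 -> Sym j2) :
    Sym (i1 + i2) -> Sym (j1 + j2) :=
  @sym_proj _ \o op_tens (@sym_incl _ \o A1 \o @sym_proj _)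
                         (@sym_incl _ \o A2 \o @sym_proj _) \o @sym_incl _.

(* Transport along m = n, and zero if m <> n. *)
Definition recast m n (f : Sym m) : Sym n :=
  if @eqP _ m n is ReflectT e then ecast k (Sym k) e f else 0.

Lemma recast_id k (f : Sym k) : recast k f = f.
Proof. by rewrite /recast; case: eqP => // e; rewrite eq_axiomK. Qed.

Lemma const_sym (c : C) :
  ((fun=> c) : form 0) \in subspace_pred (union_sub (sym_sys Phi 0)).
Proof.
apply/asboolP; exists 0%N => //; exists (fun=> c); last first.
  apply/funext => phi; rewrite /symz sumr_const card_Sn.
  by rewrite fact0 mulr1n invr1; exact: (@mul1r C).
apply: elem_span_tens; exists [:: (c, fun=> 0)]; rewrite big_seq1.
apply/funext => phi; apply: esym; rewrite /elem.
by apply: etrans (mulr1 c); congr (_ * _); exact: big_ord0.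
Qed.

(* The identification of C with SymPow Phi 0. *)
Definition scal (c : C) : Sym 0 := SubspaceOf (const_sym c).

(* <omega^{(x)k}, f>; for k = 0 this is the scalar f. *)
Definition pairing (omega : dual) k (f : Sym k) : C^o := subval f (fun=> omega).

End TensorAlgebra.

(* Formal series are their sequences of coefficients; a series that starts at
   a positive degree has zero coefficients below it. *)
Section FormalSeries.
Variables (R : realType) (Phi : LBspace R).
Local Notation C := R[i].
Local Notation dual := (dual Phi).
Local Notation Sym k := (SymPow Phi k).

Definition fseries (i : nat) : Type := forall k, Sym k -> Sym i.

Definition ser_sub i (A B : fseries i) : fseries i := fun k => A k - B k.

Definition ser_one : fseries 0 := fun k =>
  if k is 0 return Sym k -> Sym 0 then id else 0.

Definition ser_prod (A1 A2 : fseries 0) : fseries 0 := fun k f =>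
  \sum_(l < k.+1) odot (A1 l) (A2 (k - l)%N) (recast (l + (k - l)) f).

Definition ser_pow (A : fseries 0) (j : nat) : fseries 0 :=
  iter j (ser_prod A) ser_one.

Fixpoint odot_seq (B : fseries 1) (s : seq nat) : Sym (sumn s) -> Sym (size s) :=
  if s is i :: s' return Sym (sumn s) -> Sym (size s)
  then odot (B i) (@odot_seq B s') else id.

Definition is_composition k l (s : l.-tuple 'I_k.+1) : bool :=
  all (leq 1) (map val s) && (sumn (map val s) == k).

Definition ser_comp i (A : fseries i) (B : fseries 1) : fseries i := fun k =>
  if k is 0 return Sym k -> Sym i then A 0%N else fun f =>
    \sum_(1 <= l < k.+1) A l (\sum_(s : l.-tuple 'I_k.+1 | is_composition s)
      recast l (@odot_seq B (map val s) (recast (sumn (map val s)) f))).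

(* The derivative D_B A. *)
Definition ser_deriv i (B : fseries 1) (A : fseries i) : fseries i := fun k f =>
  \sum_(i <= l < k.+1) l%:R *:
    A l (recast l (odot (id : Sym l.-1 -> Sym l.-1) (B (k - l).+1)
                        (recast (l.-1 + (k - l).+1) f))).

Definition inS (s : fseries 0 * fseries 1) : Prop :=
  [/\ forall k, contlin (s.1 k), forall k, contlin (s.2 k),
      s.1 0%N = id, s.2 0%N = 0 & s.2 1%N = id].

Definition inW (w : fseries 0 * fseries 1) : Prop :=
  [/\ forall k, contlin (w.1 k), forall k, contlin (w.2 k),
      w.1 0%N = 0, w.2 0%N = 0 & w.2 1%N = 0].

Definition S_mul (s1 s2 : fseries 0 * fseries 1) : fseries 0 * fseries 1 :=
  (ser_prod (ser_comp s1.1 s2.2) s2.1, ser_comp s1.2 s2.2).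

Definition one_param (w : fseries 0 * fseries 1)
    (gamma : R -> fseries 0 * fseries 1) : Prop :=
  [/\ forall t, inS (gamma t),
      forall s t, gamma (s + t) = S_mul (gamma s) (gamma t),
      forall k, op_smooth (fun t => (gamma t).1 k) /\
                op_smooth (fun t => (gamma t).2 k) &
      forall k, op_deriv_at (fun t => (gamma t).1 k) 0 (w.1 k) /\
                op_deriv_at (fun t => (gamma t).2 k) 0 (w.2 k)].

Definition EXP (w : fseries 0 * fseries 1) : fseries 0 * fseries 1 :=
  the (fun=> 0, fun=> 0) [set s | exists2 gamma, one_param w gamma & gamma 1 = s].

(* The scalar series <omega, B(xi)>. *)
Definition ser_dual (omega : dual) (B : fseries 1) : fseries 0 :=
  fun k f => scal Phi (pairing omega (B k f)).

(* 1 / (1 - A(xi)) for A without constant term, so that the powers A^j with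
   j > k do not contribute to the k-th coefficient. *)
Definition ser_geom (A : fseries 0) : fseries 0 := fun k f =>
  \sum_(j < k.+1) ser_pow A j f.

End FormalSeries.

Section Polynomials.
Variables (R : realType) (Phi : LBspace R).
Local Notation C := R[i].
Local Notation dual := (dual Phi).
Local Notation Sym k := (SymPow Phi k).

Definition is_poly : set (dual -> C^o) :=
  [set p | exists (K : nat) (f : forall k, Sym k),
     p = fun omega => \sum_(k < K.+1) pairing omega (f k)].

Lemma pairingP omega k (a : C) (f g : Sym k) :
  pairing omega (a *: f + g) = a *: pairing omega f + pairing omega g.
Proof. by []. Qed.

Lemma is_poly0 : is_poly 0.
Proof. by exists 0%N, (fun=> 0); apply/funext => omega; rewrite big1. Qed.

Lemma is_poly_widen p : is_poly p -> exists K0 : nat, forall K, (K0 <= K)%N ->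
  exists f : forall k, Sym k,
    p = fun omega => \sum_(k < K.+1) pairing omega (f k).
Proof.
move=> [K0 [f ->]]; exists K0 => K le_K.
exists (fun k => if (k < K0.+1)%N then f k else 0); apply/funext => omega.
rewrite (big_ord_widen K.+1 (fun k => pairing omega (f k))) ?ltnS// big_mkcond.
by apply: eq_bigr => k _; case: ifP.
Qed.

Lemma is_polyP (a : C) p q : is_poly p -> is_poly q -> is_poly (a *: p + q).
Proof.
move=> /is_poly_widen[m hp] /is_poly_widen[n hq].
have [f ->] := hp _ (leq_maxl m n); have [g ->] := hq _ (leq_maxr m n).
exists (maxn m n), (fun k => a *: f k + g k); apply/funext => omega.
under [RHS]eq_bigr do rewrite pairingP.
by rewrite big_split/= -scaler_sumr.
Qed.

Definition poly_sub : subspace (dual -> C^o) := Subspace is_poly0 is_polyP.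

Definition polyfun : Type := subspace_of poly_sub.
HB.instance Definition _ := GRing.Lmodule.on polyfun.

Definition peval (p : polyfun) (omega : dual) : C^o := subval p omega.

Lemma mono_subproof k (f : Sym k) :
  (fun omega => pairing omega f) \in subspace_pred poly_sub.
Proof.
apply/asboolP; exists k, (fun j => if j == k then recast j f else 0).
apply/funext => omega; rewrite big_ord_recr/= eqxx recast_id big1 ?add0r//.
by move=> j _; rewrite (ltn_eqF (ltn_ord j)).
Qed.

(* The monomial <omega^{(x)k}, f>. *)
Definition mono k (f : Sym k) : polyfun := SubspaceOf (mono_subproof f).

(* 0-neighbourhoods of the locally convex direct sum of the SymPow Phi k. *)
Definition poly_nbhs0 : set (set polyfun) :=
  [set W | forall k, nbhs (0 : Sym k) (@mono k @^-1` W)].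

Lemma poly_nbhs0T : poly_nbhs0 setT.
Proof. by move=> k; exact: filterT. Qed.

Lemma poly_nbhs0I A B : poly_nbhs0 A -> poly_nbhs0 B -> poly_nbhs0 (A `&` B).
Proof. by move=> a b k; exact: filterI. Qed.

HB.instance Definition _ := isOpenTopological.Build polyfun
  (lc_openT poly_nbhs0T) (lc_openI poly_nbhs0I) (@lc_open_bigU _ _ poly_nbhs0).

(* P is the continuous operator with block matrix [P_ik] = b. *)
Definition has_blocks (P : polyfun -> polyfun) (b : forall i k, Sym k -> Sym i) : Prop :=
  [/\ contlin P, forall i k, contlin (b i k),
      forall i k, (k < i)%N -> b i k = 0 &
      forall k (f : Sym k), P (mono f) = \sum_(i < k.+1) mono (b i k f)].

Definition inM : set (polyfun -> polyfun) :=
  [set P | exists2 b, has_blocks P b & forall k, b k k = id].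

(* The sum of the series is a finite sum at each polynomial. *)
Definition op_log (P : polyfun -> polyfun) : polyfun -> polyfun := fun p =>
  \sum_(n \in [set n | (1 <= n)%N])
    ((-1) ^+ n.+1 / n%:R : C) *: iter n (P - id) p.

Definition op_comm (P Q : polyfun -> polyfun) : polyfun -> polyfun := (P \o Q) - (Q \o P).

(* The k-th coefficient of sum_k P^(k)(omega, xi^{(x)k}) is
   f |-> peval (P (mono f)) omega. *)
Definition riordan_genfun (P : polyfun -> polyfun)
    (s : fseries Phi 0 * fseries Phi 1) : Prop :=
  forall omega k (f : Sym k), peval (P (mono f)) omega =
    pairing omega (ser_prod s.1 (ser_geom (ser_dual omega s.2)) f).

(* Equivalently, the [(i!/k!) P_ik] for P = [P_ik] a Sheffer operator. *)
Definition riordan : set (polyfun -> polyfun) :=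
  [set P | inM P /\ exists2 s, inS s & riordan_genfun P s].

Definition riordan_alg : set (polyfun -> polyfun) := op_log @` riordan.

Definition Itilde (s : fseries Phi 0 * fseries Phi 1) : polyfun -> polyfun :=
  the 0 [set P | riordan P /\ riordan_genfun P s].

Definition Rtilde (w : fseries Phi 0 * fseries Phi 1) : polyfun -> polyfun :=
  op_log (Itilde (EXP w)).

(* The linear operator with given values at the monomials. *)
Definition mono_op (F : forall n, Sym n -> polyfun) : polyfun -> polyfun :=
  the 0 [set P | linear P /\ forall n (f : Sym n), P (mono f) = F n f].

Definition nabla_pow k (a : Sym k -> Sym 0) : polyfun -> polyfun :=
  mono_op (fun n f => if (k <= n)%N
    then mono (odot (id : Sym (n - k) -> Sym (n - k)) a (recast (n - k + k) f))
    else 0).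

Definition M_nabla_pow k (b : Sym k -> Sym 1) : polyfun -> polyfun :=
  mono_op (fun n f => if (k <= n)%N
    then mono (odot (id : Sym (n - k) -> Sym (n - k)) b (recast (n - k + k) f))
    else 0).

Definition nabla (a : fseries Phi 0) : polyfun -> polyfun :=
  fun p => \sum_(k \in [set k | (1 <= k)%N]) nabla_pow (a k) p.

Definition M_nabla (b : fseries Phi 1) : polyfun -> polyfun :=
  fun p => \sum_(k \in [set k | (2 <= k)%N]) M_nabla_pow (b k) p.

Definition number_op : polyfun -> polyfun := mono_op (fun n f => n%:R *: mono f).

Definition NM_nabla (b : fseries Phi 1) : polyfun -> polyfun :=
  number_op \o M_nabla b.

End Polynomials.

(* Main.v *)
From Pilot Require Import Defs.
From HB Require Import structures.
From mathcomp Require Import all_boot all_order all_fingroup all_algebra.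
From mathcomp Require Import all_classical all_reals all_analysis.
From mathcomp Require Import complex.
From mathcomp Require Import ring zify.
Import Pilot.Defs.
Set Implicit Arguments.
Unset Strict Implicit.
Unset Printing Implicit Defensive.
Import Order.TTheory GRing.Theory Num.Theory.
Import numFieldNormedType.Exports.
Local Open Scope ring_scope.
Local Open Scope complex_scope.

(** A vector xi has powers [pw k xi], and by polarization these span a weakly
    dense subspace of the k-th symmetric power (sym_dense); in the same way an
    element of that power is determined by its pairings with the powers of dual
    elements omega (pairing_sep).  Hence an operator on polynomials with bounded
    blocks is determined by the formal power series
    sum_k (T <., xi^{(x)k}>)(omega), the genfun of ev_at omega \o T at xi, for all
    omega and xi (triang_ext).  Each of the three claims thus becomes an identity
    in a commutative ring of power series.

    For this, continuity has to be traded for boundedness: a continuous linear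
    operator between symmetric powers maps every Banach step boundedly into one
    step (bdd_op_contlin).  That is Grothendieck's factorization theorem, a
    consequence of the Baire category theorem and of the fact that evaluations
    at dual elements are bounded and separate points.  Boundedness also gives the
    tensor product of two operators (op_tensP), hence the rule that odot is
    multiplicative on powers (pairing_odot_pw).

    Let h(xi) = <omega, xi>, so that evaluation at omega has the generating
    function 1 / (1 - h), and let T = alpha(nabla_0) + N M(beta(nabla_0)).
    Composing a functional with T acts on its generating function as
    c |-> alpha c + D_beta c, where D_beta is a derivation (genfun_first_order,
    deriv_along_mul); in particular 1 / (1 - h) becomes
    alpha / (1 - h) + h(beta) / (1 - h)^2.  The commutator formula is then a
    computation with derivations (first_order_comm).

    The operator with generating function A / (1 - <omega, B>) is explicit: its
    block (i, k) is the coefficient of degree k in A B^{(x)i} (riordan_op).  It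
    has bounded blocks, whence the first claim (Itilde_riordan).

    For the second claim, T lowers degrees, so exp(tT) is a finite sum on every
    polynomial and log(exp T) = T is an identity between polynomials in a
    nilpotent operator (op_log_exp_op).  As D = N M(beta(nabla_0)) acts as a
    derivation, exp(tT)(c e) = exp(tT)(c) exp(tD)(e) for generating functions
    (genfun_exp_op_mul).  With c e = 1 * 1 / (1 - h) this says that exp(tT) is the
    Riordan operator of the pair (A_t, B_t) formed by the part of degree 0 in
    omega of exp(tT) and the part of degree 1 of exp(tD) (riordan_op_gamma).
    Since exp((s + t)T) = exp(sT) exp(tT), these pairs form a one-parameter group,
    with initial velocity (alpha, beta) (flow_one_param).  It is the only one:
    by the group law the derivative of the k-th coefficients at time t is a
    function of the coefficients of lower degree at time t, so induction on k
    applies (one_param_unique).  Hence EXP(alpha, beta) = (A_1, B_1), and the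
    logarithm of its Riordan operator exp(T) is T. *)

(** * Finite sums, linear forms and formal power series *)

Section Combinatorics.
Variable K : comNzRingType.

(** When the right-hand side is expanded over all maps g, the signed sum over
    the sets J that contain the image of g vanishes unless g is onto. *)
Lemma ryser k (a : 'I_k -> 'I_k -> K) :
  \sum_(s : 'S_k) \prod_i a i (s i) =
  \sum_(J : {set 'I_k}) (-1) ^+ #|~: J| * \prod_i \sum_(j in J) a i j.
Proof.
under [RHS]eq_bigr => J _.
  under eq_bigr do rewrite big_mkcond /=.
  rewrite bigA_distr_bigA mulr_sumr.
  over.
rewrite exchange_big /=.
rewrite [RHS](bigID (fun g : {ffun 'I_k -> 'I_k} => injectiveb g)) /= [X in _ + X]big1 ?addr0.
  rewrite [RHS](reindex (@pval _)) /=; last first.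
    pose in_Sn := insubd (1%g : 'S_k).
    by exists in_Sn => /= f Uf; first apply: val_inj; apply: insubdK.
  apply: eq_big => /= [s | s _]; rewrite ?(valP s) //.
  rewrite (bigD1 [set: 'I_k]) //= [X in _ + X]big1 ?addr0.
    rewrite finset.setCT cards0 expr0 mul1r; apply: eq_bigr => i _.
    by rewrite inE pvalE.
  move=> J /negPf nJ; have /existsP[j jJ] : [exists j, j \notin J].
    rewrite -negb_forall; apply/negP => /forallP h; move/negP: nJ; apply.
    by apply/eqP/setP => j; rewrite h inE.
  rewrite (bigD1 ((s^-1)%g j)) //= pvalE permKV (negPf jJ).
  by rewrite mul0r mulr0.
move=> g ng.
have -> : \sum_(J : {set 'I_k}) (-1) ^+ #|~: J| *
      \prod_i (if g i \in J then a i (g i) else 0) =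
    (\prod_i a i (g i)) * \sum_(J : {set 'I_k})
      \prod_j (if j \in J then 1 else - (j \notin codom g)%:R).
  rewrite mulr_sumr; apply: eq_bigr => J _.
  have [gJ|] := boolP [forall i, g i \in J].
    rewrite mulrC; congr (_ * _).
      by apply: eq_bigr => i _; rewrite (forallP gJ).
    rewrite -prodr_const big_mkcond /=; apply: eq_bigr => j _; rewrite inE.
    case: (boolP (j \in J)) => //= jJ.
    suff -> : j \notin codom g by [].
    by apply/negP => /codomP[i ji]; move: jJ; rewrite ji (forallP gJ i).
  rewrite negb_forall => /existsP[i giJ].
  rewrite (bigD1 i) //= (negPf giJ) mul0r mulr0.
  rewrite [X in _ = _ * X](bigD1 (g i)) //= (negPf giJ) codom_f /= oppr0 mul0r.
  by rewrite mulr0.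
rewrite -(bigA_distr 1 _ (fun=> 1) (fun j => - (j \notin codom g)%:R)) /=.
have [j jg] : exists j, j \notin codom g.
  apply/existsP; rewrite -negb_forall; apply: contra ng => /forallP h.
  have /image_injP gi : #|codom g| == #|'I_k|.
    by apply/eqP; apply: eq_card => j; rewrite h.
  by apply/injectiveP => x y; apply: gi.
by rewrite [X in _ * X](bigD1 j) //= jg subrr mul0r mulr0.
Qed.

Lemma big_ord_cut (V : nmodType) (n N : nat) (F : nat -> V) : (n <= N)%N ->
  (forall k, (n <= k)%N -> F k = 0) -> \sum_(k < N) F k = \sum_(k < n) F k.
Proof.
move=> nN F0; rewrite [RHS](big_ord_widen N F) // [RHS]big_mkcond.
by apply: eq_bigr => k _; case: ltnP => // /F0.
Qed.

Lemma sum_antidiag (V : nmodType) N (f : nat -> nat -> V) :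
  (forall i j, (N < i + j)%N -> f i j = 0) ->
  \sum_(i < N.+1) \sum_(j < N.+1) f i j =
  \sum_(n < N.+1) \sum_(i < n.+1) f i (n - i)%N.
Proof.
move=> f0; have inner n : (n < N.+1)%N -> \sum_(i < n.+1) f i (n - i)%N =
    \sum_(i < N.+1) \sum_(j < N.+1) if (i + j == n)%N then f i j else 0.
  move=> nN; rewrite (big_ord_widen N.+1 (fun i => f i (n - i)%N)) // big_mkcond.
  apply: eq_bigr => i _; case: ifP => iN.
    have jN : (n - i < N.+1)%N by lia.
    rewrite (bigD1 (Ordinal jN)) //= ifT ?big1 ?addr0 //; last by apply/eqP; lia.
    move=> j /eqP ji; rewrite ifF //; apply/eqP => e; apply: ji.
    by apply: val_inj => /=; lia.
  by rewrite big1 // => j _; rewrite ifF //; apply/eqP; lia.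
under [RHS]eq_bigr => n _ do rewrite inner //.
rewrite [RHS]exchange_big; apply: eq_bigr => i _; rewrite [RHS]exchange_big.
apply: eq_bigr => j _; have [ij|ij] := ltnP N (i + j).
  by rewrite f0 // big1 // => n _; case: ifP.
rewrite (bigD1 (Ordinal (ij : (i + j < N.+1)%N))) //= eqxx. rewrite big1 ?addr0 //.
move=> n /eqP ni; rewrite ifF //; apply/eqP => e; apply: ni.
by apply: val_inj => /=; lia.
Qed.
End Combinatorics.

Section LinearMaps.
Variables (K : pzRingType) (U V : lmodType K) (f : U -> V).
Hypothesis lf : linear f.
Lemma lin0 : f 0 = 0.
Proof. by have := lf (-1) 0 0; rewrite !scaleN1r !addNr. Qed.
Lemma linD x y : f (x + y) = f x + f y.
Proof. by rewrite -[x]scale1r lf !scale1r. Qed.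
Lemma linZ a x : f (a *: x) = a *: f x.
Proof. by rewrite -[a *: x]addr0 lf lin0 addr0. Qed.
Lemma lin_sum (I : Type) (r : seq I) (P : pred I) (F : I -> U) :
  f (\sum_(i <- r | P i) F i) = \sum_(i <- r | P i) f (F i).
Proof. by elim/big_rec2: _ => [|i y1 y2 _ <-]; [exact: lin0|exact: linD]. Qed.
End LinearMaps.

Section LinearForms.
Variables (K : pzRingType) (V : lmodType K).

(** A predicate on plain functions, since the forms of interest are obtained by
    composing operators that are only known to satisfy linear. *)
Definition linf (L : V -> K) : Prop :=
  forall (a : K) p q, L (a *: p + q) = a * L p + L q.

Variable L : V -> K.
Hypothesis l : linf L.

Lemma linf0 : L 0 = 0.
Proof. by have := l (-1) 0 0; rewrite scaleN1r addNr mulN1r addNr. Qed.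
Lemma linfD p q : L (p + q) = L p + L q.
Proof. by rewrite -[p]scale1r l mul1r scale1r. Qed.
Lemma linfZ (a : K) p : L (a *: p) = a * L p.
Proof. by rewrite -[a *: p]addr0 l linf0 addr0. Qed.
Lemma linf_sum (I : Type) (r : seq I) (P : pred I) (F : I -> V) :
  L (\sum_(i <- r | P i) F i) = \sum_(i <- r | P i) L (F i).
Proof. by elim/big_rec2: _ => [|i y1 y2 _ <-]; [exact: linf0|exact: linfD]. Qed.
End LinearForms.

Section FPS.
Variable K : comNzRingType.

Definition fps : Type := nat -> K.

HB.instance Definition _ := Choice.on fps.
HB.instance Definition _ := GRing.Zmodule.on fps.

Definition fps_mul (a b : fps) : fps := fun n => \sum_(i < n.+1) a i * b (n - i)%N.
Definition fps_one : fps := fun n => (n == 0)%:R.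

Definition fps_trunc N (a : fps) : {poly K} := \poly_(i < N) a i.

(** Up to degree n a product of series is a product of polynomials, so the
    ring laws are inherited from polynomials. *)
Lemma fps_mul_trunc N (a b : fps) n : (n < N)%N ->
  fps_mul a b n = (fps_trunc N a * fps_trunc N b)`_n.
Proof.
move=> nN; rewrite coefM; apply: eq_bigr => i _; rewrite !coef_poly !ifT //.
  by lia.
by have := ltn_ord i; lia.
Qed.

Lemma coefM_congr (p q r : {poly K}) n :
  (forall m, (m <= n)%N -> p`_m = q`_m) -> (p * r)`_n = (q * r)`_n.
Proof. by move=> pq; rewrite !coefM; apply: eq_bigr => i _; rewrite pq // -ltnS. Qed.

Lemma fps_mulC : commutative fps_mul.
Proof.
by move=> a b; apply/funext => n; rewrite !(@fps_mul_trunc n.+1) // mulrC.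
Qed.

Lemma fps_mulA : associative fps_mul.
Proof.
move=> a b c; apply/funext => n; rewrite !(@fps_mul_trunc n.+1) //.
have tr d e m : (m <= n)%N ->
    (fps_trunc n.+1 (fps_mul d e))`_m = (fps_trunc n.+1 d * fps_trunc n.+1 e)`_m.
  by move=> mn; rewrite coef_poly ltnS mn (@fps_mul_trunc n.+1).
rewrite [LHS](_ : _ = (fps_trunc n.+1 b * fps_trunc n.+1 c * fps_trunc n.+1 a)`_n).
  by rewrite mulrC mulrA; apply/esym/coefM_congr => m; exact: tr.
by rewrite mulrC; apply: coefM_congr => m; exact: tr.
Qed.

Lemma fps_mul1 : left_id fps_one fps_mul.
Proof.
move=> a; apply/funext => n; rewrite /fps_mul big_ord_recl /= /fps_one eqxx mul1r.
by rewrite subn0 big1 ?addr0 // => i _; rewrite mul0r.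
Qed.

Lemma fps_mulD : left_distributive fps_mul +%R.
Proof.
move=> a b c; apply/funext => n; transitivity (\sum_(i < n.+1) (a i * c (n - i)%N + b i * c (n - i)%N)).
  by apply: eq_bigr => i _; exact: mulrDl.
by rewrite big_split.
Qed.

Lemma fps_one_neq0 : fps_one != 0.
Proof. by apply/eqP => /(congr1 (fun a : fps => a 0%N)) /eqP; rewrite oner_eq0. Qed.

HB.instance Definition _ := GRing.Zmodule_isComNzRing.Build fps
  fps_mulA fps_mulC fps_mul1 fps_mulD fps_one_neq0.

Lemma fpsD (a b : fps) n : (a + b) n = a n + b n. Proof. by []. Qed.
Lemma fpsN (a : fps) n : (- a) n = - a n. Proof. by []. Qed.
Lemma fpsM (a b : fps) n : (a * b) n = \sum_(i < n.+1) a i * b (n - i)%N.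
Proof. by []. Qed.
Lemma fps1 n : (1 : fps) n = (n == 0)%:R. Proof. by []. Qed.
Lemma fps_sum (I : Type) (r : seq I) (P : pred I) (F : I -> fps) n :
  (\sum_(i <- r | P i) F i) n = \sum_(i <- r | P i) F i n.
Proof. by elim/big_rec2: _ => // i y1 y2 _ <-. Qed.

End FPS.

Section FPSPowers.
Variable K : comNzRingType.
Implicit Types c d : fps K.

Definition fps_X k : fps K := fun n => (n == k)%:R.
Definition fps_shift c : fps K := fun n => c n.+1.

Lemma fps_XM k c n : (fps_X k * c) n = if (k <= n)%N then c (n - k)%N else 0.
Proof.
rewrite fpsM; case: ifP => kn.
  rewrite (bigD1 (Ordinal (kn : (k < n.+1)%N))) //= /fps_X eqxx mul1r big1 ?addr0 //.
  move=> i ik; rewrite (_ : (i == k :> nat) = false) ?mul0r //.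
  by apply/eqP => e; move/eqP: ik; apply; apply: val_inj.
rewrite big1 // => i _; rewrite /fps_X (_ : (i == k :> nat) = false) ?mul0r //.
by apply/eqP => e; have := ltn_ord i; lia.
Qed.

Lemma fps_shiftM c d : c 0%N = 0 -> fps_shift (c * d) = fps_shift c * d.
Proof.
move=> c0; apply/funext => n; rewrite /fps_shift !fpsM big_ord_recl c0 mul0r add0r.
by apply: eq_bigr => i _; rewrite lift0 subSS.
Qed.

Lemma fps_shiftD c d : fps_shift (c + d) = fps_shift c + fps_shift d.
Proof. by []. Qed.

Lemma fpsM_congr c c' d n : (forall m, (m <= n)%N -> c m = c' m) -> (c * d) n = (c' * d) n.
Proof. by move=> h; rewrite !fpsM; apply: eq_bigr => i _; rewrite h // -ltnS. Qed.

Lemma fps_exp_trunc c l k : (c ^+ l) k = ((fps_trunc k.+1 c) ^+ l)`_k.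
Proof.
suff h m : (m <= k)%N -> (c ^+ l) m = ((fps_trunc k.+1 c) ^+ l)`_m by exact: h.
elim: l m => [|l IH] m mk; first by rewrite !expr0 coef1.
rewrite !exprS coefM fpsM; apply: eq_bigr => i _; rewrite IH ?coef_poly ?ifT //.
  by have := ltn_ord i; lia.
by lia.
Qed.

Lemma fps_exp_low c j n : c 0%N = 0 -> (n < j)%N -> (c ^+ j) n = 0.
Proof.
move=> c0; elim: j n => [//|j IH] n nj.
rewrite exprS fpsM big_ord_recl c0 mul0r add0r big1 // => i _.
by rewrite IH ?mulr0 // lift0; have := ltn_ord i; lia.
Qed.

Lemma fps_exp_diag c j : c 0%N = 0 -> (c ^+ j) j = (c 1%N) ^+ j.
Proof.
move=> c0; elim: j => [|j IH]; first by rewrite !expr0.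
rewrite exprS fpsM big_ord_recl c0 mul0r add0r big_ord_recl lift0 subSS subn0 IH.
rewrite big1 ?addr0 ?exprS // => i _.
by rewrite fps_exp_low ?mulr0 // !lift0; have := ltn_ord i; lia.
Qed.

(** The multinomial expansion, indexed as in ser_comp. The constant term has to
    vanish, since the parts of a composition are positive. *)
Lemma fps_exp_compositions c l k : c 0%N = 0 ->
  (c ^+ l) k = \sum_(s : l.-tuple 'I_k.+1 | is_composition s) \prod_(j <- map val s) c j.
Proof.
move=> c0; rewrite fps_exp_trunc /fps_trunc poly_def.
rewrite -[l in LHS]card_ord -prodr_const bigA_distr_bigA coef_sum /=.
rewrite (reindex (fun s : l.-tuple 'I_k.+1 => [ffun j => tnth s j])) /=; last first.
  exists (fun f : {ffun 'I_l -> 'I_k.+1} => [tuple f j | j < l]) => [s _|f _].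
    by apply: eq_from_tnth => j; rewrite tnth_mktuple ffunE.
  by apply/ffunP => j; rewrite ffunE tnth_mktuple.
rewrite [RHS]big_mkcond; apply: eq_bigr => s _.
under eq_bigr do rewrite ffunE -mul_polyC.
rewrite big_split /= -rmorph_prod prodrXr mul_polyC coefZ coefXn.
have sE : sumn (map val s) = (\sum_(i < l) (tnth s i : nat))%N.
  by rewrite sumnE big_map big_tuple.
have pE : \prod_(j <- map val s) c j = \prod_(i < l) c (tnth s i).
  by rewrite big_map big_tuple.
rewrite -sE pE /is_composition [k == _]eq_sym; case: (sumn _ == k); last first.
  by rewrite andbF mulr0.
rewrite andbT mulr1; case: ifP => // /negbT /allPn[j /mapP[i /tnthP[m ->]] ->].
rewrite -leqNgt leqn0 => /eqP j0.
by rewrite (bigD1 m) //= j0 c0 mul0r.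
Qed.

(** In c ^+ l with l >= 2 the coefficient of degree k only involves the
    coefficients of c of degree less than k. *)
Lemma fps_exp_congr c c' k l n : c 0%N = 0 -> c' 0%N = 0 ->
  (forall j, (j < k)%N -> c j = c' j) -> (n.+1 < k + l)%N -> (c ^+ l) n = (c' ^+ l) n.
Proof.
move=> c0 c'0 cc; elim: l n => [|l IH] n nkl; first by rewrite !expr0.
rewrite !exprS !fpsM; apply: eq_bigr => -[[|i] /= il] _; first by rewrite c0 c'0 !mul0r.
have [ik|ki] := ltnP i.+1 k; first by rewrite cc // IH //; lia.
by rewrite !fps_exp_low ?mulr0 //; lia.
Qed.

End FPSPowers.

Local Open Scope classical_set_scope.

(** * Factorization of operators through a step of an inductive limit *)

Section ComplexScalars.
Variable R : realType.
Local Notation C := R[i].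

Lemma gt0_real_complex (e : C) : 0 < e -> exists2 r : R, 0 < r & e = r%:C.
Proof.
case: e => a b; rewrite ltcE /= => /andP[/eqP -> a0].
by exists a.
Qed.

Lemma nat_bound (c : C) : 0 <= c -> exists j : nat, c <= j%:R.
Proof.
case: c => a b; rewrite lecE /= => /andP[/eqP -> a0].
exists (Num.bound a).
have -> : (Num.bound a)%:R = (((Num.bound a)%:R : R))%:C by rewrite rmorph_nat.
by rewrite lecE /= eqxx ltW // archi_boundP.
Qed.

Definition half (n : nat) : C := 2^-1 ^+ n.

Lemma half_gt0 n : 0 < half n.
Proof. by rewrite exprn_gt0 // invr_gt0. Qed.
Lemma half_ge0 n : 0 <= half n. Proof. exact: ltW (half_gt0 n). Qed.
Lemma halfS n : 2 * half n.+1 = half n.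
Proof. by rewrite /half exprS mulrA divff ?mul1r // pnatr_eq0. Qed.
Lemma halfD m n : half (m + n) = half m * half n.
Proof. exact: exprD. Qed.
Lemma half_le m n : (m <= n)%N -> half n <= half m.
Proof.
move=> mn; by rewrite /half ler_wiXn2l ?invr_ge0 ?invf_le1 ?ler1n.
Qed.

Lemma half_small (e : C) : 0 < e -> exists n, half n <= e.
Proof.
move=> e0; have [j ej] : exists j : nat, e^-1 <= j%:R.
  by apply: nat_bound; rewrite invr_ge0 ltW.
exists j; rewrite /half exprVn -[leRHS]invrK lef_pV2 ?posrE ?invr_gt0 ?exprn_gt0 //.
apply: le_trans ej _.
by rewrite -natrX ler_nat ltnW // ltn_expl.
Qed.

End ComplexScalars.
Arguments half {R} n.

Section Factorization.
Variable R : realType.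
Local Notation C := R[i].

Section SubspaceTheory.
Variables (V : lmodType C) (E : subspace V).
Lemma subspaceD x y : sub_set E x -> sub_set E y -> sub_set E (x + y).
Proof. by move=> Ex Ey; rewrite -[x]scale1r; apply: sub_setP. Qed.
Lemma subspaceZ (a : C) x : sub_set E x -> sub_set E (a *: x).
Proof. by move=> ?; rewrite -[_ *: _]addr0; apply: sub_setP => //; exact: sub_set0. Qed.
Lemma subspaceB x y : sub_set E x -> sub_set E y -> sub_set E (x - y).
Proof. by move=> ? ?; rewrite -scaleN1r; apply: subspaceD => //; exact: subspaceZ. Qed.
Lemma subspace_sum (I : Type) (r : seq I) (P : pred I) (F : I -> V) :
  (forall i, P i -> sub_set E (F i)) -> sub_set E (\sum_(i <- r | P i) F i).
Proof.
by move=> h; elim/big_rec: _ => [|i x Pi]; [exact: sub_set0|apply: subspaceD; exact: h].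
Qed.
End SubspaceTheory.

(** N x c reads: the norm of x is at most c. The injective norm is a supremum,
    known only through its upper bounds. Completeness is asked of series
    dominated by c half j; the bound 2 c on their remainders is the sum of the
    dominating series. *)
Record banach_norm (V : lmodType C) (E : subspace V) (N : V -> C -> Prop) : Prop :=
 BanachNorm {
  bn_mono : forall x c d, c <= d -> N x c -> N x d;
  bn_add : forall x y c d, N x c -> N y d -> N (x + y) (c + d);
  bn_scale : forall a x c, N x c -> N (a *: x) (`|a| * c);
  bn_fin : forall x, sub_set E x -> exists j : nat, N x j%:R;
  bn_complete : forall t : nat -> V, (forall j, sub_set E (t j)) ->
    (exists2 c, 0 <= c & forall j, N (t j) (c * half j)) ->
    exists2 s, sub_set E s & forall j0 c, 0 <= c ->
      (forall j, N (t (j0 + j)%N) (c * half j)) ->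
      N (s - \sum_(i < j0) t i) (2 * c) }.

Section BanachNormTheory.
Variables (V : lmodType C) (E : subspace V) (N : V -> C -> Prop).
Hypothesis bE : banach_norm E N.

Lemma bn_opp x c : N x c -> N (- x) c.
Proof. by move=> /(bn_scale bE (-1)); rewrite scaleN1r normrN1 mul1r. Qed.

Lemma bn_sub x y c d : N x c -> N y d -> N (x - y) (c + d).
Proof. by move=> Nx /bn_opp; exact: (bn_add bE). Qed.

Lemma bn_subC x y c : N (x - y) c -> N (y - x) c.
Proof. by move=> /bn_opp; rewrite opprB. Qed.

(** The Baire category theorem: if no S i were dense in a ball, one could
    choose nested balls, the i-th one avoiding S i, and their common point would
    lie in no S i. *)
Lemma baire_union (S : nat -> set V) :
  (forall x, sub_set E x -> exists i, S i x) ->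
  exists i x0 n0, sub_set E x0 /\ forall y, sub_set E y -> N (y - x0) (half n0) ->
    forall e, 0 < e -> exists2 s, S i s & N (y - s) e.
Proof.
move=> ES; apply: contrapT => H.
have /choice[f fP] : forall q : nat * V * nat, exists p : V * nat, sub_set E q.1.2 ->
    [/\ sub_set E p.1, N (p.1 - q.1.2) (half q.2) &
        forall s, S q.1.1 s -> ~ N (p.1 - s) (half p.2)].
  move=> [[i x] n] /=; apply: contrapT => /forallNP H'; apply: H.
  exists i, x, n; split.
    by apply: contrapT => Ex; apply: (H' (0, 0%N)) => /Ex.
  move=> y Ey yx e e0; have [m me] := half_small e0.
  apply: contrapT => H''; apply: (H' (y, m)) => Ex; split => // s Ss /= ys.
  by apply: H''; exists s => //; apply: (bn_mono bE) ys.
(* No point of S i is within half q.2 of x i.+1. The index grows by 2 more, so that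
   the limit of x is within half (n i) of x i for every i. *)
pose step i (p : V * nat) := let q := f (i, p.1, p.2.+1) in
  (q.1, (maxn q.2 p.2).+2).
pose st := fix st i := if i is i'.+1 then step i' (st i') else (0, 0%N).
pose x i := (st i).1; pose n i := (st i).2.
have Ex i : sub_set E (x i).
  elim: i => [|i Exi]; first exact: sub_set0.
  by have [] := fP (i, x i, (n i).+1) Exi.
have dx i : N (x i.+1 - x i) (half (n i).+1).
  by have [] := fP (i, x i, (n i).+1) (Ex i).
have gap i s : S i s -> ~ N (x i.+1 - s) (half (n i.+1)).
  move=> Ss Ns; have [_ _ /(_ _ Ss)] := fP (i, x i, (n i).+1) (Ex i).
  apply; apply: (bn_mono bE) Ns; apply: half_le.
  by rewrite /n /= -/(n i) -/(x i); lia.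
have ngrow i j : (n i + j <= n (i + j))%N.
  elim: j => [|j IH]; first by rewrite !addn0.
  rewrite !addnS; apply: leq_trans (_ : (n (i + j)).+1 <= _)%N; first by rewrite ltnS.
  by rewrite /n /=; lia.
have bound j0 j : N (x (j0 + j).+1 - x (j0 + j)%N) (half (n j0).+1 * half j).
  by apply: (bn_mono bE) (dx _); rewrite -halfD; apply: half_le; rewrite addSn ltnS.
have [|s Es sP] := bn_complete bE (t := fun j => x j.+1 - x j)
    (fun j => subspaceB (Ex _) (Ex _)).
  exists (half (n 0%N).+1); first exact: half_ge0.
  by move=> j; exact: (bound 0%N j).
have near j0 : N (x j0 - s) (half (n j0)).
  apply: bn_subC; have := sP j0 (half (n j0).+1) (half_ge0 _ _) (bound j0).
  by rewrite halfS -(big_mkord xpredT (fun j => x j.+1 - x j)) telescope_sumr // subr0.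
have [i Si] := ES s Es.
exact: (gap i s Si (near i.+1)).
Qed.

End BanachNormTheory.

Variables (V V' : lmodType C) (E : subspace V) (N : V -> C -> Prop).
Variables (F : nat -> subspace V') (N' : nat -> V' -> C -> Prop) (A : V -> V').
Variables (I : Type) (ev : I -> V' -> C).
Hypothesis bE : banach_norm E N.
Hypothesis bF : forall m, banach_norm (F m) (N' m).
Hypothesis Alin : forall (a : C) x y, sub_set E x -> sub_set E y -> A (a *: x + y) = a *: A x + A y.
Hypothesis Aland : forall x, sub_set E x -> exists m, sub_set (F m) (A x).
Hypothesis evB : forall p x y, ev p (x - y) = ev p x - ev p y.
Hypothesis ev_sep : forall y, (forall p, ev p y = 0) -> y = 0.
Hypothesis evF : forall p m, exists2 c, 0 <= c &
  forall y r, 0 <= r -> N' m y r -> `|ev p y| <= c * r.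
Hypothesis evA : forall p, exists2 c, 0 <= c &
  forall x r, sub_set E x -> 0 < r -> N x r -> `|ev p (A x)| <= c * r.

Let AB x y : sub_set E x -> sub_set E y -> A (x - y) = A x - A y.
Proof. by move=> Ex Ey; rewrite addrC -scaleN1r Alin // scaleN1r addrC. Qed.
Let A0 : A 0 = 0.
Proof.
have E0 : sub_set E 0 by exact: sub_set0.
by rewrite -(subrr 0) AB // subrr.
Qed.
Let AZ a x : sub_set E x -> A (a *: x) = a *: A x.
Proof.
by move=> Ex; rewrite -[a *: x]addr0 Alin //; [rewrite A0 addr0|exact: sub_set0].
Qed.

(** The preimages of the balls of the steps F m are countably many and cover E,
    so one of them is dense in a ball (baire_union). As in the open mapping
    theorem, successive approximation removes the word dense: y is a series of
    elements whose images form a convergent series in F m. Its sum is A y, as the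
    forms ev p are continuous on both sides and separate points. *)
Theorem grothendieck_factorization : exists m c, 0 < c /\
  forall x r, sub_set E x -> 0 < r -> N x r -> sub_set (F m) (A x) /\ N' m (A x) (c * r).
Proof.
pose dec i : nat * nat := odflt (0%N, 0%N) (unpickle i).
pose S i : set V := [set x | sub_set E x /\ sub_set (F (dec i).1) (A x) /\ N' (dec i).1 (A x) (dec i).2%:R].
have [|i [x0 [n0 [Ex0 x0P]]]] := @baire_union _ _ _ bE S.
  move=> x Ex; have [m Fx] := Aland Ex; have [j Nj] := bn_fin (bF m) Fx.
  by exists (pickle (m, j)); rewrite /S /= /dec pickleK.
set m := (dec i).1 in x0P *; set k : C := (dec i).2%:R in x0P *.
have k0 : 0 <= k by rewrite ler0n.
have bFm := bF m.
(* The approximations of x0 + y and of x0 differ by one of y. *)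
have near0 y : sub_set E y -> N y (half n0) -> forall e, 0 < e ->
    exists2 s, [/\ sub_set E s, sub_set (F m) (A s) & N' m (A s) (2 * k)] & N (y - s) e.
  move=> Ey Ny e e0; have e2 : 0 < e / 2 by rewrite divr_gt0.
  have [||s [Es [Fs Ns]] Nys] := x0P (x0 + y) _ _ _ e2.
  - exact: subspaceD.
  - by rewrite addrC addKr.
  have [|s' [Es' [Fs' Ns']] Nys'] := x0P x0 Ex0 _ _ e2.
    by rewrite subrr -(scale0r 0); have [j Nj] := bn_fin bE (sub_set0 E);
       apply: (bn_mono bE) (bn_scale bE 0 Nj); rewrite normr0 mul0r half_ge0.
  exists (s - s'); first split.
  - exact: subspaceB.
  - by rewrite AB //; apply: subspaceB.
  - by rewrite AB // mulr_natl mulr2n; apply: (bn_sub bFm).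
  have -> : y - (s - s') = (x0 + y - s) - (x0 - s').
    rewrite [y - (s - s')]addrC opprB [RHS]addrC opprB -[x0 + y - s]addrA addrA subrK.
    by rewrite -addrA [- s + y]addrC.
  by rewrite [e](splitr e); apply: (bn_sub bE).
(* near0 rescaled by half q, with the error halved once more *)
have near1 q y : sub_set E y /\ N y (half (n0 + q)) ->
    exists s, [/\ sub_set E s, sub_set (F m) (A s), N' m (A s) (2 * k * half q) &
      N (y - s) (half (n0 + q.+1))].
  move=> [Ey Ny].
  have q0 : half q != 0 :> C by rewrite gt_eqF // half_gt0.
  have [||s [Es Fs Ns] Nys] := near0 ((half q)^-1 *: y) _ _ _ (half_gt0 _ n0.+1).
  - exact: subspaceZ.
  - apply: (bn_mono bE) (bn_scale bE (half q)^-1 Ny).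
    by rewrite halfD ger0_norm ?invr_ge0 ?half_ge0 // mulrCA mulVf // mulr1.
  exists (half q *: s); split.
  - exact: subspaceZ.
  - by rewrite AZ //; exact: subspaceZ.
  - rewrite AZ // [_ * half q]mulrC -[X in X * (2 * k)]ger0_norm ?half_ge0 //.
    exact: (bn_scale bFm).
  have -> : y - half q *: s = half q *: ((half q)^-1 *: y - s).
    by rewrite scalerBr scalerA mulfV // scale1r.
  have := bn_scale bE (half q) Nys; apply: (bn_mono bE).
  by rewrite ger0_norm ?half_ge0 // addnS -addSn halfD mulrC.
have /choice[g gP] : forall p : nat * V, exists s, sub_set E p.2 /\ N p.2 (half (n0 + p.1)) ->
    [/\ sub_set E s, sub_set (F m) (A s), N' m (A s) (2 * k * half p.1) &
      N (p.2 - s) (half (n0 + p.1.+1))].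
  move=> [q y]; have [h|h] := pselect (sub_set E y /\ N y (half (n0 + q))).
    by have [s] := near1 q y h; exists s.
  by exists 0.
have small y : sub_set E y -> N y (half n0) -> sub_set (F m) (A y) /\ N' m (A y) (2 * (2 * k)).
  move=> Ey Ny.
  (* the part of y that is left after j approximations *)
  pose r := fix r j := if j is j'.+1 then r j' - g (j', r j') else y.
  have rP j : sub_set E (r j) /\ N (r j) (half (n0 + j)).
    elim: j => [|j IH]; first by rewrite addn0.
    have [Eg _ _ ?] := gP (j, r j) IH; split => //=.
    by apply: subspaceB => //; case: IH.
  have gj j := gP (j, r j) (rP j).
  have rE j : y - \sum_(i < j) g (val i, r (val i)) = r j.
    elim: j => [|j IH]; first by rewrite big_ord0 subr0.
    by rewrite big_ord_recr /= opprD addrA IH.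
  have Es j : sub_set E (\sum_(i < j) g (val i, r (val i))).
    by apply: subspace_sum => i1 _; case: (gj (val i1)).
  have As j : A (\sum_(i < j) g (val i, r (val i))) = \sum_(i < j) A (g (val i, r (val i))).
    elim: j => [|j IH]; first by rewrite !big_ord0.
    have [Eg _ _ _] := gj j.
    by rewrite !big_ord_recr /= -IH -[X in A (X + _)]scale1r Alin ?scale1r //; exact: Es.
  have [||z Fz zP] := bn_complete bFm (t := fun j => A (g (j, r j))).
  - by move=> j; case: (gj j).
  - exists (2 * k); first by rewrite mulr_ge0.
    by move=> j; case: (gj j).
  suff -> : A y = z.
    split => //; have := zP 0%N (2 * k) (mulr_ge0 _ k0).
    rewrite big_ord0 subr0; apply => // j; by case: (gj j).
  apply/eqP; rewrite -subr_eq0; apply/eqP/ev_sep => p.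
  have [c c0 cP] := evA p; have [d d0 dP] := evF p m.
  have K0 : 0 <= c * half n0 + d * (2 * (2 * k)).
    by rewrite addr_ge0 ?mulr_ge0 ?half_ge0.
  have bound j : `|ev p (A y - z)| <= (c * half n0 + d * (2 * (2 * k))) * half j.
    have [Er Nr] := rP j.
    have -> : A y - z = A (r j) - (z - \sum_(i < j) A (g (val i, r (val i)))).
      by rewrite -rE AB // As opprB addrA subrK.
    rewrite evB mulrDl; apply: le_trans (ler_normB _ _) _; apply: lerD.
      rewrite -mulrA -halfD; apply: cP => //; exact: half_gt0.
    rewrite -mulrA; apply: dP; first by rewrite !mulr_ge0 ?half_ge0.
    rewrite -mulrA -mulrA.
    apply: zP; first by rewrite !mulr_ge0 ?half_ge0.
    move=> j'; have [_ _ + _] := gj (j + j')%N.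
    by rewrite halfD !mulrA.
  apply/eqP; rewrite -normr_le0; apply/ler_addgt0Pl => e e0; rewrite addr0.
  have K1 : 0 < (c * half n0 + d * (2 * (2 * k))) + 1 by rewrite ltr_wpDl.
  have [n nP] := half_small (divr_gt0 e0 K1).
  apply: le_trans (bound n) _; apply: le_trans (ler_wpM2l K0 nP) _.
  rewrite mulrCA ler_piMr ?(ltW e0) // ler_pdivrMr // mul1r.
  by rewrite lerDl.
exists m, (2 * (2 * k) / half n0 + 1); split.
  by rewrite ltr_wpDl // divr_ge0 ?half_ge0 // !mulr_ge0.
move=> x r Ex r0 Nx.
have rn0 : r != 0 by rewrite gt_eqF.
have hn0 : half n0 != 0 :> C by rewrite gt_eqF // half_gt0.
have a0 : 0 <= half n0 / r by rewrite divr_ge0 ?half_ge0 // ltW.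
have [||Fy Ny] := small ((half n0 / r) *: x).
- exact: subspaceZ.
- by apply: (bn_mono bE) (bn_scale bE (half n0 / r) Nx);
     rewrite ger0_norm // divfK.
have -> : A x = (r / half n0) *: A ((half n0 / r) *: x).
  rewrite AZ // scalerA mulrA divfK // mulfV // scale1r //.
split; first exact: subspaceZ.
have := bn_scale bFm (r / half n0) Ny; apply: (bn_mono bFm).
rewrite ger0_norm ?divr_ge0 ?half_ge0 ?(ltW r0) //.
rewrite (_ : r / half n0 * _ = 2 * (2 * k) / half n0 * r); last by ring.
by rewrite [leRHS]mulrDl mul1r lerDl ltW.
Qed.

End Factorization.

(** * Series of complex numbers and the dual of an (LB)-space *)

Section ComplexSeries.
Variable R : realType.
Local Notation C := R[i].

Lemma le_normc_ReIm (z : C) : `|z| <= (`|complex.Re z| + `|complex.Im z|)%:C.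
Proof.
have {1}-> : z = (complex.Re z)%:C + 'i%C * (complex.Im z)%:C by exact: complexE.
apply: le_trans (ler_normD _ _) _.
have hn (x : R) : `|x%:C| = `|x|%:C :> C.
  by rewrite normc_def /= expr0n addr0 sqrtr_sqr.
have hi : `|'i%C| = 1 :> C.
  by rewrite normc_def /= expr0n add0r expr1n sqrtr1.
by rewrite normrM hi mul1r !hn rmorphD.
Qed.

Lemma ReP (a b : C) : complex.Re (a + b) = complex.Re a + complex.Re b.
Proof. by case: a b => [? ?] [? ?]. Qed.
Lemma ImP (a b : C) : complex.Im (a + b) = complex.Im a + complex.Im b.
Proof. by case: a b => [? ?] [? ?]. Qed.
Lemma ReN (a : C) : complex.Re (- a) = - complex.Re a. Proof. by case: a. Qed.
Lemma ImN (a : C) : complex.Im (- a) = - complex.Im a. Proof. by case: a. Qed.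

Lemma normc_ge_Im (x : C) : `|complex.Im x|%:C <= `|x|.
Proof.
have := normc_ge_Re (x * 'i%C); rewrite ReiNIm normrN normrM.
have -> : `|'i%C| = 1 :> C by rewrite normc_def /= expr0n add0r expr1n sqrtr1.
by rewrite mulr1.
Qed.

Lemma real_geo_cvg (u : nat -> R) (c : R) : 0 <= c ->
  (forall j, `|u j| <= c * 2^-1 ^+ j) -> cvgn (series u).
Proof.
move=> c0 uc; apply: (@normed_cvg R R^o).
apply: (@series_le_cvg R _ (fun j => c * 2^-1 ^+ j)) => //.
- by move=> n /=.
- by move=> n; rewrite mulr_ge0 // exprn_ge0 // invr_ge0.
apply: is_cvg_geometric_series.
by rewrite ger0_norm ?invr_ge0 // invf_lt1 // ltr1n.
Qed.

(** Completeness of the scalars in the form that banach_norm asks for. *)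
Lemma geo_series (u : nat -> C) (c : C) : 0 <= c ->
  (forall j, `|u j| <= c * half j) ->
  exists l, forall j0 c', 0 <= c' ->
    (forall j, `|u (j0 + j)%N| <= c' * half j) -> `|l - \sum_(i < j0) u i| <= 2 * c'.
Proof.
move=> c0 uc.
have halfR j : half j = (2^-1 ^+ j : R)%:C by rewrite rmorphXn fmorphV rmorph_nat.
have cR : c = (complex.Re c)%:C by rewrite RRe_real // ger0_real.
have cr0 : 0 <= complex.Re c by move: c0; rewrite cR ler0c.
have cvgRe : cvgn (series (fun j => complex.Re (u j))).
  apply: (real_geo_cvg cr0) => j; rewrite -lecR rmorphM /= -halfR -cR.
  exact: le_trans (normc_ge_Re _) (uc j).
have cvgIm : cvgn (series (fun j => complex.Im (u j))).
  apply: (real_geo_cvg cr0) => j; rewrite -lecR rmorphM /= -halfR -cR.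
  exact: le_trans (normc_ge_Im _) (uc j).
set lR := limn _ in cvgRe; set lI := limn _ in cvgIm.
exists (lR +i* lI)%C => j0 c' c'0 uc'.
have tail M : `|\sum_(i < j0 + M) u i - \sum_(i < j0) u i| <= 2 * c'.
  rewrite big_split_ord /= [X in `|X|]addrC addKr.
  apply: le_trans (ler_norm_sum _ _ _) _.
  apply: le_trans (_ : \sum_(i < M) c' * half i <= _).
    by apply: ler_sum => i _; exact: uc'.
  suff -> : \sum_(i < M) c' * half i = 2 * c' - 2 * c' * half M.
    by rewrite gerBl mulr_ge0 ?half_ge0 // mulr_ge0.
  elim: M => [|M IH]; first by rewrite big_ord0 /half expr0 mulr1 subrr.
  by rewrite big_ord_recr /= IH -[half M]halfS; ring.
have partR n : complex.Re (\sum_(i < n) u i) = series (fun j => complex.Re (u j)) n.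
  rewrite /series /= big_mkord.
  by elim: n => [|n IH]; rewrite ?big_ord0 // !big_ord_recr /= ReP IH.
have partI n : complex.Im (\sum_(i < n) u i) = series (fun j => complex.Im (u j)) n.
  rewrite /series /= big_mkord.
  by elim: n => [|n IH]; rewrite ?big_ord0 // !big_ord_recr /= ImP IH.
apply/ler_addgt0Pl => e e0; have [r r0 er] := gt0_real_complex e0.
have r2 : 0 < r / 2 by rewrite divr_gt0.
have /cvgrPdist_le /(_ _ r2) [N1 _ N1P] := cvgRe.
have /cvgrPdist_le /(_ _ r2) [N2 _ N2P] := cvgIm.
pose M := (N1 + N2)%N; pose n := (j0 + M)%N.
have -> : (lR +i* lI)%C - \sum_(i < j0) u i =
   ((lR +i* lI)%C - \sum_(i < n) u i) + (\sum_(i < n) u i - \sum_(i < j0) u i).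
  by rewrite addrA subrK.
apply: le_trans (ler_normD _ _) _; apply: lerD; last exact: tail.
apply: le_trans (le_normc_ReIm _) _; rewrite er lecR ReP ImP ReN ImN partR partI /=.
rewrite [leRHS]splitr; apply: lerD.
  by apply: N1P => /=; rewrite /n /M; lia.
by apply: N2P => /=; rewrite /n /M; lia.
Qed.

End ComplexSeries.

Section Duals.
Variables (R : realType) (Phi : LBspace R).
Local Notation C := R[i].
Local Notation dual := (dual Phi).
Local Notation form := (form Phi).

Lemma is_dual_comb (a : C) (p q : lb_type Phi -> C^o) :
  is_dual p -> is_dual q -> is_dual (fun v => a * p v + q v).
Proof.
move=> [lp cp] [lq cq]; split.
  move=> b x y; rewrite lp lq.
  have scE (u v : C) : u *: (v : C^o) = u * v by [].
  by rewrite !scE; ring.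
move=> v; have FF := nbhs_filter v.
exact: (@cvgD C C^o _ (nbhs v) FF _ _ _ _ (@cvgZl_tmp C C^o _ _ FF a p (p v) (cp v)) (cq v)).
Qed.

Lemma is_dual0 : is_dual (fun _ : lb_type Phi => 0 : C^o).
Proof.
split; last by move=> v; exact: cst_continuous.
by move=> a x y; rewrite scaler0 addr0.
Qed.

Lemma is_dual_sum (I : Type) (r : seq I) (P : pred I) (z : I -> C) (phi : I -> dual) :
  is_dual (fun v => \sum_(i <- r | P i) z i * (phi i v : C) : C).
Proof.
elim: r => [|i r IH].
  suff -> : (fun v => \sum_(i <- [::] | P i) z i * (phi i v : C) : C) = fun=> 0 by exact: is_dual0.
  by apply/funext => v; rewrite big_nil.
have [Pi|Pi] := boolP (P i).
  suff -> : (fun v => \sum_(j <- i :: r | P j) z j * (phi j v : C) : C) =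
      fun v => z i * (phi i v : C) + (\sum_(j <- r | P j) z j * (phi j v : C) : C).
    exact: (is_dual_comb (z i) (proj2_sig (phi i)) IH).
  by apply/funext => v; rewrite big_cons Pi.
suff -> : (fun v => \sum_(j <- i :: r | P j) z j * (phi j v : C) : C) =
    fun v => \sum_(j <- r | P j) z j * (phi j v : C) : C by exact: IH.
by apply/funext => v; rewrite big_cons (negPf Pi).
Qed.

Definition dual_sum (I : Type) (r : seq I) (P : pred I) (z : I -> C) (phi : I -> dual) : dual :=
  exist _ _ (is_dual_sum r P z phi).

Lemma dual_bounded (phi : dual) n : exists2 r : C, 0 <= r &
  forall x : lb_step Phi n, `|phi (lb_incl Phi n x)| <= r * `|x|.
Proof.
have [lphi cphi] : is_dual phi := proj2_sig phi.
have phi0 : phi 0 = 0.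
  by have := lphi (-1) 0 0; rewrite !scaleN1r !addNr.
have c0 := cphi 0.
have c1 := c0 (ball (phi 0) 1) (nbhsx_ballx _ _ ltr01).
rewrite phi0 in c1.
move: c1; rewrite nbhs_simpl.
rewrite nbhsE => -[U [oU U0] UB].
have [W [_ NW WU]] := oU 0 U0.
have /nbhs_ballP [e /= e0 eW] := NW n.
have phiZ (a : C) v : phi (a *: v) = a * phi v.
  by have := lphi a v 0; rewrite phi0 !addr0.
exists (2 / e) => [|x]; first by rewrite divr_ge0 // ltW.
have [->|x0] := eqVneq x 0; first by rewrite linear0 phi0 !normr0 mulr0.
have xn : 0 < `|x| by rewrite normr_gt0.
have a0 : 0 < e / (2 * `|x|) by rewrite divr_gt0 // mulr_gt0.
have : ball (0 : C^o) 1 (phi (lb_incl Phi n ((e / (2 * `|x|)) *: x))).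
  apply: UB; rewrite -[lb_incl _ _ _]add0r; apply: WU; apply: eW.
  rewrite -ball_normE /= sub0r normrN normrZ (gtr0_norm a0).
  have -> : e / (2 * `|x|) * `|x| = e / 2 by field; rewrite gt_eqF.
  by rewrite ltr_pdivrMr // ltr_pMr // ltr1n.
rewrite -ball_normE /= sub0r normrN linearZ phiZ normrM (gtr0_norm a0) => /ltW.
rewrite mulrC -ler_pdivlMr // mul1r => h; apply: le_trans h _.
by rewrite invf_div mulrAC.
Qed.

Lemma dual_bounds k (phi : 'I_k -> dual) n : exists r : 'I_k -> C,
  (forall i, 0 <= r i) /\
  (forall i (x : lb_step Phi n), `|phi i (lb_incl Phi n x)| <= r i * `|x|).
Proof.
have /choice[r rP] : forall i : 'I_k, exists r : C, 0 <= r /\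
    forall x : lb_step Phi n, `|phi i (lb_incl Phi n x)| <= r * `|x|.
  by move=> i; have [r r0 h] := dual_bounded (phi i) n; exists r.
by exists r; split=> i; case: (rP i).
Qed.

Lemma inj_norm_le_ev k n (phi : 'I_k -> dual) : exists2 c : C, 0 <= c &
  forall (t : form k) e, inj_norm_le n t e -> `|t phi| <= c * e.
Proof.
have [r [r0 rP]] := dual_bounds phi n.
exists (\prod_i r i); first by apply: prodr_ge0 => i _; exact: r0.
by move=> t e te; rewrite mulrC; apply: te.
Qed.

End Duals.

(** * Bounded operators between inductive limits *)

Section LocallyConvexTheory.
Variable K : numFieldType.

Lemma abs_convex_sum (V : lmodType K) (W : set V) (I : Type) (r : seq I)
    (a : I -> K) (w : I -> V) :
  abs_convex W -> W 0 -> (forall i, W (w i)) -> \sum_(i <- r) `|a i| <= 1 ->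
  W (\sum_(i <- r) a i *: w i).
Proof.
move=> cW W0 Ww; have [v Wv ->] : exists2 v, W v &
    \sum_(i <- r) a i *: w i = (\sum_(i <- r) `|a i|) *: v.
  elim: r => [|i r [v Wv IH]]; first by exists 0; rewrite // !big_nil scale0r.
  rewrite !big_cons IH; set s := \sum_(j <- r) _.
  have s0 : 0 <= s by apply: sumr_ge0.
  have [z|nz] := eqVneq (`|a i| + s) 0.
    exists 0 => //; have /eqP := z; rewrite paddr_eq0 // normr_eq0.
    by move=> /andP[/eqP -> /eqP ->]; rewrite !scale0r normr0 addr0 scaler0.
  exists ((a i / (`|a i| + s)) *: w i + (s / (`|a i| + s)) *: v); last first.
    by rewrite scalerDr !scalerA ![(_ + _) * _]mulrC !divfK.
  apply: cW => //; rewrite !normrM !normfV (ger0_norm s0).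
  by rewrite (ger0_norm (addr_ge0 (normr_ge0 _) s0)) -mulrDl divff.
move=> s1; have := cW (\sum_(i <- r) `|a i|) 0 v v Wv Wv; rewrite scale0r addr0.
by apply; rewrite normr0 addr0 ger0_norm // sumr_ge0.
Qed.

Lemma abs_convex_preim (U V : lmodType K) (f : U -> V) (W : set V) :
  linear f -> abs_convex W -> abs_convex (f @^-1` W).
Proof.
move=> lf cW a b x y Wx Wy ab; rewrite /preimage /=.
by rewrite lf (linZ lf); exact: cW.
Qed.

Variables (V : lmodType K) (NV : set (set V)).

Definition lc_scalable := forall W, abs_convex W -> NV W -> NV [set w | W (2 *: w)].

Definition lc_pointed := forall W, NV W -> W 0.

(** The points around which W contains a translate of a basic neighbourhood
    form an open set, as these neighbourhoods may be halved. *)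
Lemma lc_interior (W : set V) : lc_scalable -> lc_pointed -> abs_convex W -> NV W ->
  exists O, [/\ lc_open NV O, O 0 & O `<=` W].
Proof.
move=> sc z cW NW.
exists [set x | exists W', [/\ abs_convex W', NV W' & forall w, W' w -> W (x + w)]].
split; last 2 first.
- by exists W; split => // w; rewrite add0r.
- by move=> x [W' [cW' NW' W'W]]; rewrite -[x]addr0; exact: (W'W _ (z _ NW')).
move=> x [W' [cW' NW' W'W]]; exists [set w | W' (2 *: w)]; split.
- by move=> a b y y' Wy Wz ab /=; rewrite scalerDr !scalerA ![2 * _]mulrC -!scalerA; exact: cW'.
- exact: sc.
move=> w Ww /=; exists [set w | W' (2 *: w)]; split.
- by move=> a b y y' Wy Wz ab /=; rewrite scalerDr !scalerA ![2 * _]mulrC -!scalerA; exact: cW'.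
- exact: sc.
move=> w' Ww'; rewrite -addrA; apply: W'W.
have -> : w + w' = 2^-1 *: (2 *: w) + 2^-1 *: (2 *: w').
  by rewrite !scalerA mulVf ?pnatr_eq0 // !scale1r.
apply: cW' => //; rewrite ger0_norm ?invr_ge0 // -[2^-1]mul1r -splitr //.
Qed.

End LocallyConvexTheory.

Section SubspaceValues.
Variables (K : pzRingType) (V : lmodType K) (S : subspace V).
Lemma subvalZ (a : K) (x : subspace_of S) : subval (a *: x) = a *: subval x.
Proof. by []. Qed.
Lemma subvalD (x y : subspace_of S) : subval (x + y) = subval x + subval y.
Proof. by []. Qed.
Lemma subval_inj (x y : subspace_of S) : subval x = subval y -> x = y.
Proof. exact: val_inj. Qed.
Lemma subval_sum (I : Type) (r : seq I) (P : pred I) (F : I -> subspace_of S) :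
  subval (\sum_(i <- r | P i) F i) = \sum_(i <- r | P i) subval (F i).
Proof. by elim/big_rec2: _ => // i y1 y2 _ <-. Qed.
End SubspaceValues.

Section InductiveLimits.
Variables (R : realType).
Local Notation C := R[i].
Implicit Types E F : indsys R.

Lemma indlim_nbhs0P E (W : set (indlim E)) : indlim_nbhs0 W <->
  forall n, exists2 e : C, 0 < e & forall x : indlim E,
    sub_set (stp E n) (subval x) -> norm_le n (subval x) e -> W x.
Proof.
split => h n; have [e e0 eW] := h n; exists e => // x.
  move=> Ex Nx; have Ex' : subval x \in subspace_pred (stp E n) by apply/asboolP.
  have -> : x = stage_incl (SubspaceOf Ex') by exact: val_inj.
  exact: eW.
by move=> Nx; apply: eW => //; exact/asboolP/(subvalP x).
Qed.

Lemma indlim_nbhs0_up E (A B : set (indlim E)) :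
  A `<=` B -> indlim_nbhs0 A -> indlim_nbhs0 B.
Proof. by move=> AB hA n; have [e e0 h] := hA n; exists e => // x /h /AB. Qed.

Lemma open_indlim E (U : set (indlim E)) : open U = lc_open (@indlim_nbhs0 _ E) U.
Proof. by []. Qed.

(** Continuity of a linear map between locally convex inductive limits follows
    from boundedness of its restrictions, each landing in a single step. *)
Definition bdd_op E F (A : indlim E -> indlim F) : Prop := linear A /\
  forall n, exists m c, 0 < c /\ forall x, sub_set (stp E n) (subval x) ->
    sub_set (stp F m) (subval (A x)) /\
    forall e, 0 <= e -> norm_le n (subval x) e -> norm_le m (subval (A x)) (c * e).

Definition bdd_form E (L : indlim E -> C) : Prop :=
  linf L /\
  forall n, exists2 c, 0 <= c & forall x e, sub_set (stp E n) (subval x) ->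
    0 <= e -> norm_le n (subval x) e -> `|L x| <= c * e.

Lemma bdd_op_nbhs0 E F (A : indlim E -> indlim F) (W : set (indlim F)) :
  bdd_op A -> indlim_nbhs0 W -> indlim_nbhs0 (A @^-1` W).
Proof.
move=> [_ hA] /indlim_nbhs0P NW; apply/indlim_nbhs0P => n.
have [m [c [c0 h]]] := hA n; have [e e0 eW] := NW m.
have ec0 : 0 < e / c by rewrite divr_gt0.
exists (e / c) => // x Ex Nx; have [Fx /(_ _ (ltW ec0) Nx)] := h x Ex.
by rewrite mulrC divfK ?gt_eqF // => ?; exact: eW.
Qed.

Lemma contlin_of_bdd_op E F (A : indlim E -> indlim F) : bdd_op A -> contlin A.
Proof.
move=> bA; have [lA _] := bA; split => //; apply/continuousP => U; rewrite !open_indlim => oU x Ux.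
have [W [cW NW WU]] := oU _ Ux.
exists (A @^-1` W); split.
- exact: abs_convex_preim.
- exact: bdd_op_nbhs0.
move=> w Ww; rewrite /preimage /= -[x]scale1r lA scale1r.
exact: WU.
Qed.

Definition homogeneous E := forall n (x : amb E) (a c : C),
  norm_le n x c -> norm_le n (a *: x) (`|a| * c).

Lemma indlim_scalable E : homogeneous E -> lc_scalable (@indlim_nbhs0 _ E).
Proof.
move=> hE W cW /indlim_nbhs0P NW; apply/indlim_nbhs0P => n.
have [e e0 eW] := NW n; exists (e / 2); first by rewrite divr_gt0.
move=> x Ex Nx; apply: eW; first exact: subspaceZ.
have := hE _ _ 2 _ Nx; rewrite ger0_norm // mulrC divfK //.
Qed.

Definition pointed E := forall n e, 0 <= e -> norm_le n (0 : amb E) e.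

Lemma indlim_pointed E : pointed E -> lc_pointed (@indlim_nbhs0 _ E).
Proof.
move=> pE W /indlim_nbhs0P /(_ 0%N) [e e0]; apply; first exact: sub_set0.
exact/pE/ltW.
Qed.

Lemma nbhs_indlim0 E (W : set (indlim E)) : nbhs 0 W -> indlim_nbhs0 W.
Proof.
rewrite nbhsE => -[U []]; rewrite open_indlim => oU U0 UW.
have [W' [_ NW' W'U]] := oU _ U0.
by apply: indlim_nbhs0_up NW' => w /W'U; rewrite add0r; exact: UW.
Qed.

Lemma contlin_nbhs0 E F (A : indlim E -> indlim F) (W : set (indlim F)) :
  homogeneous F -> pointed F -> contlin A -> abs_convex W -> indlim_nbhs0 W ->
  indlim_nbhs0 (A @^-1` W).
Proof.
move=> hF pF [lA /continuousP cA] cW NW.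
have [U [oU U0 UW]] := lc_interior (indlim_scalable hF) (indlim_pointed pF) cW NW.
have oU' : open U by rewrite open_indlim.
apply: nbhs_indlim0; rewrite nbhsE; exists (A @^-1` U); first split.
- exact: cA.
- by rewrite /preimage /= (lin0 lA).
- by move=> x /UW.
Qed.

Lemma bdd_op_comp E F G (A : indlim E -> indlim F) (B : indlim F -> indlim G) :
  bdd_op A -> bdd_op B -> bdd_op (B \o A).
Proof.
move=> [lA hA] [lB hB]; split; first by move=> a x y /=; rewrite lA lB.
move=> n; have [m [c [c0 h]]] := hA n; have [p [d [d0 k]]] := hB m.
exists p, (d * c); split; first exact: mulr_gt0.
move=> x /h [Fx hx]; have [Gx kx] := k _ Fx; split => // e e0 Nx.
by rewrite -mulrA; apply: kx; [rewrite mulr_ge0 // ltW|exact: hx].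
Qed.

Lemma bdd_form_comp E F (A : indlim E -> indlim F) (L : indlim F -> C) :
  bdd_op A -> bdd_form L -> bdd_form (L \o A).
Proof.
move=> [lA hA] [lL hL]; split; first by move=> a x y /=; rewrite lA lL.
move=> n; have [m [c [c0 h]]] := hA n; have [d d0 k] := hL m.
exists (d * c); first by rewrite mulr_ge0 // ltW.
move=> x e /h [Fx hx] e0 Nx; rewrite -mulrA; apply: k => //; last exact: hx.
by rewrite mulr_ge0 // ltW.
Qed.

Lemma bdd_formD E (L M : indlim E -> C) (a : C) : bdd_form L -> bdd_form M ->
  bdd_form (fun x => a * L x + M x).
Proof.
move=> [lL hL] [lM hM]; split; first by move=> b x y; rewrite lL lM; ring.
move=> n; have [c c0 h] := hL n; have [d d0 k] := hM n.
exists (`|a| * c + d); first by rewrite addr_ge0 // mulr_ge0.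
move=> x e Ex e0 Nx; apply: le_trans (ler_normD _ _) _; rewrite mulrDl.
by apply: lerD; [rewrite normrM -mulrA ler_wpM2l //; exact: h|exact: k].
Qed.

Lemma bdd_form0 E : bdd_form (fun _ : indlim E => 0).
Proof.
split; first by move=> a x y; rewrite mulr0 addr0.
by move=> n; exists 0 => // x e _ _ _; rewrite normr0 mul0r.
Qed.

Lemma bdd_form_sum E (I : Type) (r : seq I) (P : pred I) (L : I -> indlim E -> C) :
  (forall i, P i -> bdd_form (L i)) -> bdd_form (fun x => \sum_(i <- r | P i) L i x).
Proof.
move=> bL; elim: r => [|i r IH].
  by rewrite (_ : (fun _ => _) = fun=> 0); [exact: bdd_form0|apply/funext => x; rewrite big_nil].
have [Pi|Pi] := boolP (P i).
  rewrite (_ : (fun _ => _) = fun x => 1 * L i x + \sum_(j <- r | P j) L j x).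
    by apply: bdd_formD => //; exact: bL.
  by apply/funext => x; rewrite big_cons Pi mul1r.
rewrite (_ : (fun _ => _) = fun x => \sum_(j <- r | P j) L j x) //.
by apply/funext => x; rewrite big_cons (negPf Pi).
Qed.

Lemma bdd_op_id E : bdd_op (id : indlim E -> indlim E).
Proof.
split => // n; exists n, 1; split => // x Ex; split => // e _.
by rewrite mul1r.
Qed.

(** Steps of an inductive system whose norms only shrink along the system can
    be enlarged at will, so finitely many operators land in a common step. *)
Definition shrinking E := forall n (x : amb E) c, norm_le n x c -> norm_le n.+1 x c.

Lemma shrink_leq E m n (x : amb E) c : shrinking E -> (m <= n)%N ->
  norm_le m x c -> norm_le n x c.
Proof.
move=> sE /subnK <-; elim: (n - m)%N => [//|k IH] h.
by rewrite addSn; apply: sE; exact: IH.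
Qed.

Definition subadditive E := forall n (x y : amb E) (c d : C),
  norm_le n x c -> norm_le n y d -> norm_le n (x + y) (c + d).

Lemma bdd_opD E F (A B : indlim E -> indlim F) (a : C) :
  shrinking F -> subadditive F -> homogeneous F ->
  bdd_op A -> bdd_op B -> bdd_op (fun x => a *: A x + B x).
Proof.
move=> sF aF hF [lA hA] [lB hB]; split.
  move=> b x y; rewrite lA lB !scalerDr !scalerA addrACA.
  by rewrite [b * a]mulrC.
move=> n; have [m [c [c0 h]]] := hA n; have [p [d [d0 k]]] := hB n.
exists (maxn m p), ((`|a| + 1) * c + d); split.
  by rewrite addr_gt0 // mulr_gt0 // ltr_wpDl.
move=> x Ex; have [Ax hx] := h _ Ex; have [Bx kx] := k _ Ex.
split.
  apply: sub_setP.
    by apply: (stp_leq (leq_maxl m p)) Ax.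
  by apply: (stp_leq (leq_maxr m p)) Bx.
move=> e e0 Nx; rewrite subvalD subvalZ mulrDl; apply: aF; last first.
  by apply: (shrink_leq sF (leq_maxr m p)); exact: kx.
apply: (@norm_le_mono _ _ _ _ (`|a| * (c * e))).
  by rewrite -mulrA ler_wpM2r ?mulr_ge0 ?(ltW c0) // lerDl.
by apply: hF; apply: (shrink_leq sF (leq_maxl m p)); exact: hx.
Qed.

Lemma bdd_op0 E F : pointed F -> bdd_op (fun _ : indlim E => 0 : indlim F).
Proof.
move=> pF; split; first by move=> a x y; rewrite scaler0 addr0.
move=> n; exists 0%N, 1; split => // x _; split; first exact: sub_set0.
by move=> e e0 _; apply: pF; rewrite mul1r.
Qed.

End InductiveLimits.

(** * Continuous operators between tensor powers are bounded *)

Section TensorSpaces.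
Variables (R : realType) (Phi : LBspace R).
Local Notation C := R[i].
Local Notation dual := (dual Phi).
Local Notation form := (form Phi).
Local Notation Tens k := (TensPow Phi k).
Local Notation Sym k := (SymPow Phi k).

Lemma form_sumE k (I : Type) (r : seq I) (P : pred I) (F : I -> form k) phi :
  (\sum_(i <- r | P i) F i) phi = \sum_(i <- r | P i) (F i phi : C) :> C.
Proof. by elim/big_rec2: _ => // i y1 y2 _ <-. Qed.

Lemma inj_norm_le0 k n (e : C) : 0 <= e -> inj_norm_le n (0 : form k) e.
Proof.
move=> e0 phi r r0 _; rewrite normr0 mulr_ge0 //.
by apply: prodr_ge0.
Qed.

Lemma inj_norm_leS k n (t : form k) (c : C) : inj_norm_le n t c -> inj_norm_le n.+1 t c.
Proof.
move=> tc phi r r0 hr; apply: tc => // i x.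
by have [y [<- <-]] := lb_incl_mono x.
Qed.

Lemma inj_norm_le_closed k n (t : form k) (c : C) :
  (forall e, 0 < e -> inj_norm_le n t (c + e)) -> inj_norm_le n t c.
Proof.
move=> h phi r r0 hr; set P := \prod_i r i.
have P0 : 0 <= P by apply: prodr_ge0.
apply/ler_addgt0Pl => e e0.
have P1 : 0 < P + 1 by rewrite ltr_wpDl.
apply: le_trans (h _ (divr_gt0 e0 P1) phi r r0 hr) _.
rewrite mulrDl [leRHS]addrC lerD2l -/P.
by rewrite mulrAC ler_pdivrMr // ler_wpM2l ?(ltW e0) // lerDl.
Qed.

Lemma tens_stp_closed k n (t : form k) :
  (forall e : C, 0 < e -> exists2 s, tens_stp n s & inj_norm_le n (t - s) e) ->
  tens_stp n t.
Proof.
move=> h e e0; have e2 : 0 < e / 2 by rewrite divr_gt0.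
have [s hs ts] := h _ e2; have [u hu su] := hs _ e2.
exists u => //; have -> : t - u = (t - s) + (s - u) by rewrite addrA subrK.
by rewrite [e]splitr; exact: inj_norm_leD.
Qed.

Lemma tens_stp_leq k m n (t : form k) : (m <= n)%N -> tens_stp m t -> tens_stp n t.
Proof. by move=> mn; exact: (@stp_leq _ (tens_sys Phi k) m n mn). Qed.

(** A dominated series of forms is summed pointwise. The injective norm is a
    supremum over tuples of dual elements, so the pointwise estimate of the
    remainders is a norm estimate, and the sum is a limit of tensors. *)
Lemma tens_banach k n : banach_norm (stp (tens_sys Phi k) n) (@inj_norm_le R Phi k n).
Proof.
split.
- exact: inj_norm_le_mono.
- exact: inj_norm_leD.
- by move=> a x c; exact: inj_norm_leZ.
- move=> t /tens_stp_bounded [c c0 tc]; have [j cj] := nat_bound c0.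
  by exists j; apply: inj_norm_le_mono tc.
move=> t tn [c c0 tc].
have /choice[s sP] : forall phi : 'I_k -> dual, exists l : C, forall j0 c', 0 <= c' ->
    (forall j, `|t (j0 + j)%N phi : C| <= c' * half j) ->
    `|l - \sum_(i < j0) (t i phi : C)| <= 2 * c'.
  move=> phi; have [r [r0 rP]] := dual_bounds phi n.
  apply: (@geo_series _ (fun j => t j phi) (c * \prod_i r i)).
    by rewrite mulr_ge0 // prodr_ge0.
  by move=> j; rewrite mulrAC; exact: tc.
have sN j0 c' : 0 <= c' -> (forall j, inj_norm_le n (t (j0 + j)%N) (c' * half j)) ->
    inj_norm_le n ((s : form k) - \sum_(i < j0) t i) (2 * c').
  move=> c'0 tc' phi r r0 rP.
  have -> : ((s : form k) - \sum_(i < j0) t i) phi = s phi - \sum_(i < j0) (t i phi : C).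
    by congr (_ - _); exact: form_sumE.
  rewrite -mulrA; apply: sP; first by rewrite mulr_ge0 // prodr_ge0.
  by move=> j; rewrite mulrAC; exact: tc'.
exists (s : form k) => //; apply: tens_stp_closed => e e0.
have e1 : 0 < e / (2 * c + 1) by rewrite divr_gt0 // ltr_wpDl // mulr_ge0.
have [j0 hj] := half_small e1.
exists (\sum_(i < j0) t i).
  by apply: (@subspace_sum _ _ (stp (tens_sys Phi k) n)) => i _; exact: tn.
apply: inj_norm_le_mono (sN j0 (c * half j0) _ _); last 2 first.
- by rewrite mulr_ge0 // half_ge0.
- by move=> j; rewrite -mulrA -halfD; exact: tc.
rewrite mulrA; apply: le_trans (ler_wpM2l _ hj) _; first by rewrite mulr_ge0.
rewrite mulrCA ler_piMr ?(ltW e0) // ler_pdivrMr ?mul1r ?lerDl //.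
by rewrite ltr_wpDl // mulr_ge0.
Qed.

Lemma tens_homog k : homogeneous (tens_sys Phi k).
Proof. by move=> n x a c; exact: inj_norm_leZ. Qed.
Lemma sym_homog k : homogeneous (sym_sys Phi k).
Proof. by move=> n x a c; exact: inj_norm_leZ. Qed.
Lemma tens_pointed k : pointed (tens_sys Phi k).
Proof. by move=> n e; exact: inj_norm_le0. Qed.
Lemma sym_pointed k : pointed (sym_sys Phi k).
Proof. by move=> n e; exact: inj_norm_le0. Qed.
Lemma sym_shrink k : shrinking (sym_sys Phi k).
Proof. by move=> n x c; exact: inj_norm_leS. Qed.
Lemma sym_subadd k : subadditive (sym_sys Phi k).
Proof. by move=> n x y c d; exact: inj_norm_leD. Qed.

Lemma tens_ev_bdd_form k (phi : 'I_k -> dual) : bdd_form (fun t : Tens k => subval t phi : C).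
Proof.
split => // n; have [c c0 h] := inj_norm_le_ev n phi.
by exists c => // x e _ _; exact: h.
Qed.

Lemma sym_ev_bdd_form k (phi : 'I_k -> dual) : bdd_form (fun t : Sym k => subval t phi : C).
Proof.
split => // n; have [c c0 h] := inj_norm_le_ev n phi.
by exists c => // x e _ _; exact: h.
Qed.

(** Total, so that a map between tensor powers becomes a map between spaces of
    forms. *)
Definition tens_of k (t : form k) : Tens k := insubd 0 t.

Lemma tens_ofE k n (t : form k) : tens_stp n t -> subval (tens_of t) = t.
Proof.
by move=> h; rewrite [LHS]insubdK //; apply/asboolP; exists n.
Qed.

Lemma tens_of_subval k (t : Tens k) : tens_of (subval t) = t.
Proof. exact: valKd. Qed.

Lemma tens_step k (t : Tens k) : exists n, tens_stp n (subval t).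
Proof. by have /asboolP[n _ h] := subvalP t; exists n. Qed.

Lemma sym_step k (t : Sym k) : exists n, sym_stp n (subval t).
Proof. by have /asboolP[n _ h] := subvalP t; exists n. Qed.

(** The forms ev p of the factorization theorem are the evaluations at tuples
    of dual elements. Composed with A they are bounded because A is continuous. *)
Lemma contlin_tens_bdd_op i j (A : Tens i -> Tens j) : contlin A -> bdd_op A.
Proof.
move=> cA; have [lA _] := cA; split => // n.
pose A' (t : form i) : form j := subval (A (tens_of t)).
have tens_ofP (a : C) x y : tens_stp n x -> tens_stp n y ->
    tens_of (a *: x + y) = a *: tens_of x + tens_of y.
  move=> hx hy; apply: subval_inj; rewrite subvalD subvalZ.
  by rewrite !(@tens_ofE _ n) //; exact: tens_stpP.
have [|t tn|t u v|t h|phi m|phi|m [c [c0 h]]] :=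
  @grothendieck_factorization R (form i) (form j) (stp (tens_sys Phi i) n)
    (@inj_norm_le R Phi i n) (fun m => stp (tens_sys Phi j) m)
    (fun m => @inj_norm_le R Phi j m) A' ('I_j -> dual) (fun phi t => t phi)
    (tens_banach i n) (tens_banach j).
- by move=> a x y hx hy; rewrite /A' tens_ofP // lA.
- exact: tens_step.
- by [].
- by apply/funext => phi; exact: h.
- by have [c c0 h] := inj_norm_le_ev m phi; exists c => // y r _; exact: h.
- pose W : set (Tens j) := [set y | `|subval y phi : C| <= 1].
  have cW : abs_convex W.
    move=> a b x y Wx Wy ab; rewrite /W /=.
    apply: le_trans (ler_normD _ _) _; apply: le_trans ab.
    by apply: lerD; rewrite [X in `|X|]/((_ : C) * (_ : C)) normrM ler_piMr.
  have NW : indlim_nbhs0 W.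
    apply/indlim_nbhs0P => m; have [c c0 h] := inj_norm_le_ev m phi.
    have c1 : 0 < c + 1 by rewrite ltr_wpDl.
    exists (c + 1)^-1 => [|y _ Ny]; first by rewrite invr_gt0.
    apply: le_trans (h _ _ Ny) _.
    by rewrite ler_pdivrMr // mul1r lerDl.
  have /indlim_nbhs0P/(_ n) [e e0 eP] :=
    contlin_nbhs0 (@tens_homog j) (@tens_pointed j) cA cW NW.
  exists e^-1 => [|x r xn r0 Nx]; first by rewrite invr_ge0 ltW.
  have hh : `|subval (A ((e / r) *: tens_of x)) phi : C| <= 1.
    apply: eP; first by rewrite subvalZ (@tens_ofE _ n) //; exact: subspaceZ.
    rewrite subvalZ (@tens_ofE _ n) //; have := inj_norm_leZ (e / r) Nx.
    by rewrite gtr0_norm ?divr_gt0 // divfK // gt_eqF.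
  move: hh; rewrite (linZ lA) subvalZ.
  rewrite [X in `|X|]/((_ : C) * (_ : C)) normrM gtr0_norm ?divr_gt0 //.
  rewrite mulrC -ler_pdivlMr ?divr_gt0 // mul1r invf_div => hh.
  by rewrite mulrC.
exists m, c; split => // x xn.
have xE : A' (subval x) = subval (A x) by rewrite /A' tens_of_subval.
split=> [|e].
  have [d d0 xd] := tens_stp_bounded xn.
  have d1 : 0 < d + 1 by rewrite ltr_wpDl.
  have xd1 : inj_norm_le n (subval x) (d + 1).
    by apply: inj_norm_le_mono xd; rewrite lerDl.
  by rewrite -xE; have [] := h _ _ xn d1 xd1.
rewrite le_eqVlt => /orP[/eqP <- Nx|e0 Nx]; last first.
  by rewrite -xE; have [] := h _ _ xn e0 Nx.
rewrite mulr0; apply: inj_norm_le_closed => d d0; rewrite add0r.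
have ec0 : 0 < d / c by rewrite divr_gt0.
have [|_] := h _ _ xn ec0.
  by apply: inj_norm_le_mono Nx; exact: ltW.
by rewrite mulrC divfK ?gt_eqF // xE.
Qed.

End TensorSpaces.

(** * Dense subspaces and symmetrization *)

Section Odot.
Variables (R : realType) (Phi : LBspace R).
Local Notation C := R[i].
Local Notation dual := (dual Phi).
Local Notation form := (form Phi).
Local Notation Tens k := (TensPow Phi k).
Local Notation Sym k := (SymPow Phi k).

Definition elemn k n (x : 'I_k -> lb_step Phi n) : form k :=
  elem (fun i => lb_incl Phi n (x i)).

Lemma elemn_stp k n (x : 'I_k -> lb_step Phi n) : tens_stp n (elemn x).
Proof. exact/elem_span_tens/elem_span_elem. Qed.

Lemma tens_dense k (L : Tens k -> C) : bdd_form L ->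
  (forall n (x : 'I_k -> lb_step Phi n), L (tens_of (elemn x)) = 0) ->
  forall t, L t = 0.
Proof.
move=> [lL hL] L0 t; have [n tn] := tens_step t; have [c c0 h] := hL n.
have l0 := linf0 lL.
have span s : elem_span n s -> L (tens_of s) = 0.
  move=> [l ->].
  suff -> : tens_of (\sum_(p <- l) p.1 *: elem (fun i => lb_incl Phi n (p.2 i)) : form k) =
      \sum_(p <- l) p.1 *: tens_of (elemn p.2).
    elim: l => [|p l IH]; first by rewrite big_nil.
    by rewrite big_cons lL IH addr0 L0 mulr0.
  apply: subval_inj; rewrite (@tens_ofE _ _ _ n); last by apply: elem_span_tens; exists l.
  rewrite subval_sum; apply: eq_bigr => p _.
  by rewrite subvalZ (tens_ofE (elemn_stp p.2)).
apply/eqP; rewrite -normr_le0; apply/ler_addgt0Pl => e e0; rewrite addr0.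
have c1 : 0 < c + 1 by rewrite ltr_wpDl.
have e1 : 0 < e / (c + 1) by rewrite divr_gt0.
have [s hs ts] := tn _ e1.
have sE : subval (tens_of s) = s by apply: (@tens_ofE _ _ _ n); exact: elem_span_tens.
have -> : L t = L (-1 *: tens_of s + t) by rewrite lL span // mulr0 add0r.
apply: le_trans (h _ (e / (c + 1)) _ _ _) _.
- rewrite subvalD subvalZ sE; apply: tens_stpP => //; exact: elem_span_tens.
- exact: ltW.
- by rewrite subvalD subvalZ sE scaleN1r addrC.
by rewrite mulrC mulrAC ler_pdivrMr // ler_wpM2l ?(ltW e0) // lerDl.
Qed.

Lemma symz_symz k (t : form k) : symz (symz t) = symz t.
Proof.
apply/funext => phi; rewrite /symz; set d := (k`!%:R)^-1 : C.
have d1 : d * k`!%:R = 1 by rewrite mulVf // pnatr_eq0 -lt0n fact_gt0.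
rewrite -[RHS]mul1r -d1 -mulrA; congr (_ * _).
rewrite -mulr_sumr mulrCA; congr (_ * _).
transitivity (\sum_(s : 'S_k) \sum_(u : 'S_k) (t (fun i => phi (u i)) : C)).
  apply: eq_bigr => s _; rewrite (reindex_inj (mulIg (s^-1)%g)).
  by apply: eq_bigr => u _; congr (t _); apply/funext => i; rewrite permM permKV.
by rewrite sumr_const card_Sn mulr_natl.
Qed.

Lemma symz_subval k (f : Sym k) : symz (subval f) = subval f.
Proof. by have [n [t _ <-]] := sym_step f; rewrite symz_symz. Qed.

Lemma sym_inclE k (f : Sym k) : subval (sym_incl f) = subval f.
Proof. by []. Qed.

Lemma sym_projE k (t : Tens k) : subval (sym_proj t) = symz (subval t).
Proof. by []. Qed.

Lemma sym_inclK k (f : Sym k) : sym_proj (sym_incl f) = f.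
Proof. by apply: subval_inj; exact: symz_subval. Qed.

Lemma sym_proj_bdd_op k : bdd_op (@sym_proj R Phi k).
Proof.
split.
  move=> a x y; apply: subval_inj.
  by rewrite sym_projE !subvalD !subvalZ !sym_projE symzP.
move=> n; exists n, 1; split => // x xn; split; first by exists (subval x).
by move=> e _ Nx; rewrite mul1r; exact: inj_norm_le_symz.
Qed.

Lemma sym_stp_tens k n (t : form k) : sym_stp n t -> tens_stp n t.
Proof. by move=> [u un <-]; exact: tens_stp_symz. Qed.

Lemma sym_incl_bdd_op k : bdd_op (@sym_incl R Phi k).
Proof.
split.
  move=> a x y; apply: subval_inj.
  by rewrite sym_inclE !subvalD !subvalZ !sym_inclE.
move=> n; exists n, 1; split => // x xn; split; first exact: sym_stp_tens.
by move=> e _ Nx; rewrite mul1r.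
Qed.

(** The symmetric power is a retract of the tensor power by bounded maps. *)
Lemma contlin_sym_bdd_op i j (A : Sym i -> Sym j) : contlin A -> bdd_op A.
Proof.
move=> [lA cA].
have [lI cI] := contlin_of_bdd_op (sym_incl_bdd_op j).
have [lP cP] := contlin_of_bdd_op (sym_proj_bdd_op i).
have /contlin_tens_bdd_op [_ h] : contlin (@sym_incl R Phi j \o A \o @sym_proj R Phi i).
  split; first by move=> a x y /=; rewrite lP lA lI.
  by move=> x; apply: continuous_comp; [exact: cP|apply: continuous_comp; [exact: cA|exact: cI]].
split => // n; have [m [c [c0 hm]]] := h n; exists m, c; split => // x xn.
have [+ Nx] := hm (sym_incl x) (sym_stp_tens xn).
rewrite /= sym_inclK => Ax; split; first by exists (subval (A x)); [|exact: symz_subval].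
by move=> e e0 Nxe; have := Nx _ e0 Nxe; rewrite /= sym_inclK.
Qed.

Lemma bdd_op_contlin i j (A : Sym i -> Sym j) : bdd_op A <-> contlin A.
Proof. by split; [exact: contlin_of_bdd_op|exact: contlin_sym_bdd_op]. Qed.

(** * Contractions of tensors *)

Section Contraction.
Variables i1 i2 : nat.

Definition djoin (phi : 'I_i1 -> dual) (psi : 'I_i2 -> dual) : 'I_(i1 + i2) -> dual :=
  fun i => match fintype.split i with inl j => phi j | inr j => psi j end.

Lemma djoinl phi psi i : djoin phi psi (lshift i2 i) = phi i.
Proof. by rewrite /djoin -[lshift _ i]/(unsplit (inl i)) unsplitK. Qed.
Lemma djoinr phi psi i : djoin phi psi (rshift i1 i) = psi i.
Proof. by rewrite /djoin -[rshift _ i]/(unsplit (inr i)) unsplitK. Qed.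

(** Filling the last i2 slots of a tensor with psi leaves a tensor of degree i1,
    to which a form u can be applied. *)
Definition slice (t : form (i1 + i2)) (psi : 'I_i2 -> dual) : form i1 :=
  fun phi => t (djoin phi psi).

Lemma slice_norm n t (c : C) (psi : 'I_i2 -> dual) (r : 'I_i2 -> C) : inj_norm_le n t c ->
  (forall i, 0 <= r i) ->
  (forall i (x : lb_step Phi n), `|psi i (lb_incl Phi n x)| <= r i * `|x|) ->
  inj_norm_le n (slice t psi) (c * \prod_i r i).
Proof.
move=> Nt r0 rP phi q q0 qP.
pose s (i : 'I_(i1 + i2)) := match fintype.split i with inl j => q j | inr j => r j end.
have sl j : s (lshift i2 j) = q j.
  by rewrite /s -[lshift _ _]/(unsplit (inl j)) unsplitK.
have sr j : s (rshift i1 j) = r j.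
  by rewrite /s -[rshift _ _]/(unsplit (inr j)) unsplitK.
have := Nt (djoin phi psi) s; rewrite big_split_ord /=.
under eq_bigr do rewrite sl; under [X in _ * (_ * X)]eq_bigr do rewrite sr.
rewrite -mulrA [_ * \prod_i q i]mulrC; apply.
  by move=> i; rewrite /s; case: fintype.split.
by move=> i x; rewrite /s /djoin; case: fintype.split.
Qed.

Lemma elemn_slice n (x : 'I_(i1 + i2) -> lb_step Phi n) psi :
  slice (elemn x) psi = (elemn (fun j => x (rshift i1 j)) psi : C) *:
    elemn (fun j => x (lshift i2 j)).
Proof.
apply/funext => phi.
transitivity ((\prod_i (phi i (lb_incl Phi n (x (lshift i2 i))) : C)) *
              (\prod_i (psi i (lb_incl Phi n (x (rshift i1 i))) : C))); last first.
  exact: (@mulrC C).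
rewrite /slice /elemn /elem big_split_ord /=; congr (_ * _); apply: eq_bigr => i _.
  by rewrite djoinl.
by rewrite djoinr.
Qed.

Lemma slice_stp n t psi : tens_stp n t -> tens_stp n (slice t psi).
Proof.
move=> tn e e0; have [r [r0 rP]] := dual_bounds psi n.
have P0 : 0 < \prod_i r i + 1 by rewrite ltr_wpDl // prodr_ge0.
have [s [l ->] ts] := tn _ (divr_gt0 e0 P0).
exists (slice (\sum_(p <- l) p.1 *: elem (fun i => lb_incl Phi n (p.2 i))) psi).
  rewrite (_ : slice _ _ = \sum_(p <- l) p.1 *: slice (elemn p.2) psi).
    apply: elem_span_sum => p _; rewrite elemn_slice.
    by apply: elem_spanZ; apply: elem_spanZ; exact: elem_span_elem.
  by apply/funext => phi; rewrite /slice !form_sumE.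
have := slice_norm ts r0 rP; apply: inj_norm_le_mono.
by rewrite mulrAC ler_pdivrMr // ler_wpM2l ?(ltW e0) // lerDl.
Qed.

Definition sliceT (t : Tens (i1 + i2)) psi : Tens i1 := tens_of (slice (subval t) psi).

Lemma sliceTE t psi : subval (sliceT t psi) = slice (subval t) psi.
Proof. by have [n tn] := tens_step t; apply: tens_ofE; exact: slice_stp tn. Qed.

Lemma sliceTP (a : C) s t psi : sliceT (a *: s + t) psi = a *: sliceT s psi + sliceT t psi.
Proof. by apply: subval_inj; rewrite subvalD subvalZ !sliceTE. Qed.

Variable u : Tens i1 -> C.
Hypothesis bu : bdd_form u.

(** The operator u (x) id. *)
Definition contr (t : Tens (i1 + i2)) : form i2 := fun psi => u (sliceT t psi).

Lemma contr_lin (a : C) s t : contr (a *: s + t) = a *: contr s + contr t.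
Proof. by apply/funext => psi; rewrite /contr sliceTP; case: bu => ->. Qed.

Lemma contr_norm n (c : C) :
  (forall x e, tens_stp n (subval x) -> 0 <= e -> inj_norm_le n (subval x) e -> `|u x| <= c * e) ->
  forall t e, 0 <= e -> tens_stp n (subval t) -> inj_norm_le n (subval t) e ->
  inj_norm_le n (contr t) (c * e).
Proof.
move=> uc t e e0 tn te psi r r0 rP; rewrite -mulrA; apply: uc.
- by rewrite sliceTE; exact: slice_stp.
- by rewrite mulr_ge0 // prodr_ge0.
- by rewrite sliceTE; exact: slice_norm.
Qed.

Lemma contr_stp n t : tens_stp n (subval t) -> tens_stp n (contr t).
Proof.
move=> tn e e0; have [lu hu] := bu; have [c c0 uc] := hu n.
have c1 : 0 < c + 1 by rewrite ltr_wpDl.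
have e1 := divr_gt0 e0 c1.
have [s [l sl] ts] := tn _ e1.
have sE : subval (tens_of s) = s.
  by apply: (@tens_ofE _ _ _ n); apply: elem_span_tens; exists l.
have u0 := linf0 lu.
exists (contr (tens_of s)).
  have -> : contr (tens_of s) = \sum_(p <- l)
     (p.1 * u (tens_of (elemn (fun j => p.2 (lshift i2 j))))) *: elemn (fun j => p.2 (rshift i1 j)).
    apply/funext => psi; rewrite form_sumE /contr.
    have -> : sliceT (tens_of s) psi = \sum_(p <- l) (p.1 * elemn (fun j => p.2 (rshift i1 j)) psi) *:
        tens_of (elemn (fun j => p.2 (lshift i2 j))).
      apply: subval_inj; rewrite sliceTE sE sl subval_sum.
      rewrite (_ : slice _ _ = \sum_(p <- l) p.1 *: slice (elemn p.2) psi); last first.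
        by apply/funext => phi; rewrite /slice !form_sumE.
      apply: eq_bigr => p _; rewrite elemn_slice scalerA subvalZ.
      by rewrite (tens_ofE (elemn_stp _)).
    elim: (l) => [|p l' IH]; first by rewrite !big_nil.
    rewrite !big_cons lu IH; congr (_ + _); rewrite mulrAC //.
  apply: elem_span_sum => p _; apply: elem_spanZ; exact: elem_span_elem.
have -> : contr t - contr (tens_of s) = contr (-1 *: tens_of s + t).
  by rewrite contr_lin scaleN1r addrC.
have := contr_norm uc (t := -1 *: tens_of s + t) (ltW e1).
rewrite subvalD subvalZ sE scaleN1r [- s + _]addrC => h.
have /h /(_ ts) : tens_stp n (subval t - s).
  rewrite addrC -scaleN1r; apply: tens_stpP => //; apply: elem_span_tens; by exists l.
apply: inj_norm_le_mono.
by rewrite mulrC mulrAC ler_pdivrMr // ler_wpM2l ?(ltW e0) // lerDl.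
Qed.

Definition contrT t : Tens i2 := tens_of (contr t).

Lemma contrTE t : subval (contrT t) = contr t.
Proof. by have [n tn] := tens_step t; apply: tens_ofE; exact: contr_stp tn. Qed.

End Contraction.
End Odot.

(** * Tensor products of operators *)

Lemma theP (T : Type) (x0 : T) (P : set T) x : P x -> P (the x0 P).
Proof.
by move=> Px; rewrite /the; case: pselect => [h|[]]; [exact: projT2 (cid h)|exists x].
Qed.

Section OpTens.
Variables (R : realType) (Phi : LBspace R).
Local Notation C := R[i].
Local Notation dual := (dual Phi).
Local Notation form := (form Phi).
Local Notation Tens k := (TensPow Phi k).
Local Notation Sym k := (SymPow Phi k).

Section Existence.
Variables (i1 j1 i2 j2 : nat) (A1 : Tens i1 -> Tens j1) (A2 : Tens i2 -> Tens j2).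
Hypotheses (b1 : bdd_op A1) (b2 : bdd_op A2).

Let u (phi : 'I_j1 -> dual) (x : Tens i1) : C := subval (A1 x) phi.

Let bu phi : bdd_form (u phi).
Proof. exact: (bdd_form_comp b1 (tens_ev_bdd_form phi)). Qed.

(** A1 (x) A2, slot by slot: the first slots are contracted with the form
    x |-> (A1 x)(phi), and A2 is applied to what remains. *)
Definition otform (t : Tens (i1 + i2)) : form (j1 + j2) := fun chi =>
  subval (A2 (contrT (u (fun i => chi (lshift j2 i))) t)) (fun i => chi (rshift j1 i)).

Lemma contrT_lin phi (a : C) (s t : Tens (i1 + i2)) :
  contrT (u phi) (a *: s + t) = a *: contrT (u phi) s + contrT (u phi) t.
Proof.
have bu' := bu phi.
by apply: subval_inj; rewrite subvalD subvalZ !contrTE // contr_lin.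
Qed.

Lemma otform_lin (a : C) (s t : Tens (i1 + i2)) : otform (a *: s + t) = a *: otform s + otform t.
Proof.
by apply/funext => chi; rewrite /otform contrT_lin b2.1 subvalD subvalZ.
Qed.

Lemma otform_prod (f : Tens i1) (g : Tens i2) : otform (tens_prod f g) = form_prod (subval (A1 f)) (subval (A2 g)).
Proof.
apply/funext => chi; rewrite /otform /form_prod.
set phi := fun i => chi (lshift j2 i); set psi := fun i => chi (rshift j1 i).
have sl q : sliceT (tens_prod f g) q = (subval g q : C) *: f.
  apply: subval_inj; rewrite sliceTE subvalZ; apply/funext => p.
  rewrite /slice /= /form_prod.
  have -> : (fun i => djoin p q (lshift i2 i)) = p.
    by apply/funext => i; rewrite djoinl.
  have -> : (fun i => djoin p q (rshift i1 i)) = q.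
    by apply/funext => i; rewrite djoinr.
  exact: (@mulrC C).
have -> : contrT (u phi) (tens_prod f g) = (subval (A1 f) phi : C) *: g.
  apply: subval_inj; rewrite (contrTE (bu phi)) subvalZ; apply/funext => q.
  rewrite /contr sl; have [lu _] := bu phi.
  rewrite (linfZ lu); exact: (@mulrC C).
by rewrite (linZ b2.1) subvalZ.
Qed.

(** The norm of otform t is estimated directly. That it is a completed tensor
    follows by approximating t by sums of elementary tensors, where otform_prod
    applies. *)
Lemma otform_step n : exists m c, 0 < c /\ forall t, tens_stp n (subval t) ->
  tens_stp m (otform t) /\
  forall e, 0 <= e -> inj_norm_le n (subval t) e -> inj_norm_le m (otform t) (c * e).
Proof.
have [l1 h1] := b1; have [l2 h2] := b2.
have [m1 [c1 [c10 k1]]] := h1 n; have [m2 [c2 [c20 k2]]] := h2 n.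
pose m := maxn m1 m2.
have down (k q : nat) (chi : dual) (r : C) : (k <= q)%N ->
    (forall x : lb_step Phi q, `|chi (lb_incl Phi q x)| <= r * `|x|) ->
    forall x : lb_step Phi k, `|chi (lb_incl Phi k x)| <= r * `|x|.
  move=> /subnK <-; elim: (q - k)%N => [//|d IH] hr; apply: IH => x.
  by have [y [<- <-]] := lb_incl_mono x; exact: hr.
have nrm t : tens_stp n (subval t) -> forall e, 0 <= e -> inj_norm_le n (subval t) e ->
    inj_norm_le m (otform t) (c1 * c2 * e).
  move=> tn e e0 te chi r r0 rP; rewrite /otform.
  set phi := fun i => chi (lshift j2 i); set psi := fun i => chi (rshift j1 i).
  pose r1 i := r (lshift j2 i); pose r2 i := r (rshift j1 i).
  have R1 : 0 <= \prod_i r1 i by apply: prodr_ge0 => i _; exact: r0.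
  have uc x d : tens_stp n (subval x) -> 0 <= d -> inj_norm_le n (subval x) d ->
      `|u phi x| <= (c1 * \prod_i r1 i) * d.
    move=> xn d0 xd; have [_ /(_ d d0 xd)] := k1 x xn.
    move=> /(_ phi r1 (fun=> r0 _)); rewrite mulrAC; apply => i x'.
    by apply: (down _ m); rewrite ?leq_maxl //; exact: rP.
  have d0 : 0 <= (c1 * \prod_i r1 i) * e by rewrite !mulr_ge0 // ltW.
  have cn := contr_norm uc e0 tn te.
  have cs : tens_stp n (subval (contrT (u phi) t)).
    by rewrite (contrTE (bu phi)); exact: (contr_stp (bu phi)).
  have [_ /(_ _ d0)] := k2 _ cs; rewrite (contrTE (bu phi)) => /(_ cn psi r2 (fun=> r0 _)) h.
  apply: le_trans (h _) _.
    by move=> i x; apply: (down _ m); rewrite ?leq_maxr //; exact: rP.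
  rewrite big_split_ord /= -/r1 -/r2.
  by rewrite le_eqVlt; apply/orP; left; apply/eqP; ring.
exists m, (c1 * c2); split; first exact: mulr_gt0.
move=> t tn; split; last exact: nrm.
apply: tens_stp_closed => e e0.
have c12 : 0 < c1 * c2 by exact: mulr_gt0.
have [s [l sl] ts] := tn _ (divr_gt0 e0 c12).
have sn : tens_stp n s by apply: elem_span_tens; exists l.
have sE : subval (tens_of s) = s by exact: (@tens_ofE _ _ _ n).
exists (otform (tens_of s)).
  have -> : otform (tens_of s) = \sum_(p <- l) p.1 *:
      otform (tens_prod (tens_of (elemn (fun j => p.2 (lshift i2 j))))
                        (tens_of (elemn (fun j => p.2 (rshift i1 j))))).
    have -> : tens_of s = \sum_(p <- l) p.1 *:
      (tens_prod (tens_of (elemn (fun j => p.2 (lshift i2 j))))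
                 (tens_of (elemn (fun j => p.2 (rshift i1 j))))).
      apply: subval_inj; rewrite sE sl subval_sum; apply: eq_bigr => p _.
      rewrite subvalZ; congr (_ *: _); apply/funext => chi.
      rewrite /= /form_prod !(tens_ofE (elemn_stp _)) /elemn /elem.
      by rewrite big_split_ord.
    elim: (l) => [|p l' IH].
      by rewrite !big_nil (lin0 otform_lin).
    by rewrite !big_cons otform_lin IH.
  apply: (@subspace_sum _ _ (stp (tens_sys Phi _) m)) => p _; apply: subspaceZ.
  rewrite otform_prod; apply: tens_stp_prod.
    apply: (tens_stp_leq (leq_maxl m1 m2)).
    by apply: (k1 _ _).1; rewrite (tens_ofE (elemn_stp _)); exact: elemn_stp.
  apply: (tens_stp_leq (leq_maxr m1 m2)).
  by apply: (k2 _ _).1; rewrite (tens_ofE (elemn_stp _)); exact: elemn_stp.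
have -> : otform t - otform (tens_of s) = otform (-1 *: tens_of s + t).
  by rewrite otform_lin scaleN1r addrC.
have dE : subval (-1 *: tens_of s + t) = subval t - s.
  by rewrite subvalD subvalZ sE scaleN1r addrC.
have := nrm (-1 *: tens_of s + t); rewrite dE => h.
have ds : tens_stp n (subval t - s).
  by rewrite addrC -scaleN1r; apply: tens_stpP.
have := h ds _ (ltW (divr_gt0 e0 c12)) ts; apply: inj_norm_le_mono.
by rewrite mulrC divfK // gt_eqF.
Qed.

Definition otmap (t : Tens (i1 + i2)) : Tens (j1 + j2) := tens_of (otform t).

Lemma otmapE t : subval (otmap t) = otform t.
Proof.
have [n tn] := tens_step t; have [m [c [_ h]]] := otform_step n.
by apply: (@tens_ofE _ _ _ m); case: (h t tn).
Qed.

Lemma otmap_bdd_op : bdd_op otmap.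
Proof.
split.
  move=> a x y; apply: subval_inj; transitivity (otform (a *: x + y)); first exact: otmapE.
  rewrite otform_lin (subvalD (a *: otmap x) (otmap y)) (subvalZ a (otmap x)).
  by congr (_ *: _ + _); apply/esym; exact: otmapE.
move=> n; have [m [c [c0 h]]] := otform_step n; exists m, c; split => // x xn.
by rewrite otmapE; exact: h.
Qed.

(** The tensor product of operators exists, so the choice that defines op_tens
    is not arbitrary. *)
Lemma op_tensP : bdd_op (op_tens A1 A2) /\
  forall f g, op_tens A1 A2 (tens_prod f g) = tens_prod (A1 f) (A2 g).
Proof.
have [cS hS] : contlin (op_tens A1 A2) /\
  forall f g, op_tens A1 A2 (tens_prod f g) = tens_prod (A1 f) (A2 g).
  apply: (@theP _ 0 [set S | contlin S /\
    forall f g, S (tens_prod f g) = tens_prod (A1 f) (A2 g)] otmap).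
  split; first exact: contlin_of_bdd_op otmap_bdd_op.
  by move=> f g; apply: subval_inj; rewrite otmapE otform_prod.
by split => //; exact: contlin_tens_bdd_op.
Qed.

End Existence.

Section SymmetricProduct.
Variables (i1 j1 i2 j2 : nat) (A1 : Sym i1 -> Sym j1) (A2 : Sym i2 -> Sym j2).
Hypotheses (b1 : bdd_op A1) (b2 : bdd_op A2).

Let b1' : bdd_op (@sym_incl R Phi j1 \o A1 \o @sym_proj R Phi i1).
Proof. exact: bdd_op_comp (sym_proj_bdd_op _ _) (bdd_op_comp b1 (sym_incl_bdd_op _ _)). Qed.
Let b2' : bdd_op (@sym_incl R Phi j2 \o A2 \o @sym_proj R Phi i2).
Proof. exact: bdd_op_comp (sym_proj_bdd_op _ _) (bdd_op_comp b2 (sym_incl_bdd_op _ _)). Qed.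

Lemma odot_bdd_op : bdd_op (odot A1 A2).
Proof.
have [bS _] := op_tensP b1' b2'.
exact: bdd_op_comp (sym_incl_bdd_op _ _) (bdd_op_comp bS (sym_proj_bdd_op _ _)).
Qed.

Lemma pairing_odot omega f f1 f2 : sym_incl f = tens_prod (sym_incl f1) (sym_incl f2) ->
  pairing omega (odot A1 A2 f) = (pairing omega (A1 f1) : C) * (pairing omega (A2 f2) : C).
Proof.
move=> fE; have [_ hS] := op_tensP b1' b2'.
have -> : odot A1 A2 f = sym_proj (tens_prod (sym_incl (A1 f1)) (sym_incl (A2 f2))).
  by rewrite /odot /comp fE hS /comp !sym_inclK.
rewrite /pairing sym_projE /symz.
rewrite (eq_bigr (fun=> (pairing omega (A1 f1) : C) * (pairing omega (A2 f2) : C))) //.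
rewrite sumr_const card_Sn -[X in _ * X = _]mulr_natl.
by rewrite mulKf // pnatr_eq0 -lt0n fact_gt0.
Qed.

End SymmetricProduct.
End OpTens.

(** * Powers of vectors and polarization *)

Section Powers.
Variables (R : realType) (Phi : LBspace R).
Local Notation C := R[i].
Local Notation dual := (dual Phi).
Local Notation form := (form Phi).
Local Notation Tens k := (TensPow Phi k).
Local Notation Sym k := (SymPow Phi k).

(** The base x is in SymPow Phi 1, where the values of vector-valued series lie,
    so that these values can be raised to powers. *)
Definition pwform k (x : Sym 1) : form k := fun phi => \prod_i (pairing (phi i) x : C).

Arguments pwform : clear implicits.

Lemma pwformD m n (x : Sym 1) : pwform (m + n) x = form_prod (pwform m x) (pwform n x).
Proof. by apply/funext => phi; rewrite /pwform /form_prod big_split_ord. Qed.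

Lemma pwform1 (x : Sym 1) : pwform 1 x = subval x.
Proof.
apply/funext => phi; rewrite /pwform big_ord1 /pairing; congr (subval x _).
by apply/funext => i; rewrite (ord1 i).
Qed.

Lemma pwform0 (x : Sym 1) : pwform 0 x = subval (scal Phi 1).
Proof. by apply/funext => phi; rewrite /pwform big_ord0. Qed.

Lemma pwform_stp k n (x : Sym 1) : sym_stp n (subval x) -> tens_stp n (pwform k x).
Proof.
move=> xn; elim: k => [|k IH].
  rewrite pwform0; apply: elem_span_tens; exists [:: (1, fun=> 0)]; rewrite big_seq1.
  rewrite scale1r; apply/funext => phi; rewrite /elem.
  by apply: esym; exact: big_ord0.
rewrite -[k.+1]/(1 + k)%N pwformD; apply: tens_stp_prod => //.
by rewrite pwform1; exact: sym_stp_tens.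
Qed.

Lemma symz_pwform k (x : Sym 1) : symz (pwform k x) = pwform k x.
Proof.
apply/funext => phi; rewrite /symz.
rewrite (eq_bigr (fun=> (pwform k x phi : C))); last first.
  move=> s _; rewrite /pwform; apply/esym.
  by rewrite (reindex_inj (@perm_inj _ s)).
rewrite sumr_const card_Sn -[X in _ * X = _]mulr_natl.
by rewrite mulKf // pnatr_eq0 -lt0n fact_gt0.
Qed.

Lemma pw_subproof k (x : Sym 1) : pwform k x \in subspace_pred (union_sub (sym_sys Phi k)).
Proof.
have [n xn] := sym_step x; apply/asboolP; exists n => //.
by exists (pwform k x); [exact: pwform_stp|exact: symz_pwform].
Qed.

Definition pw k (x : Sym 1) : Sym k := SubspaceOf (pw_subproof k x).

Lemma pairing_pw omega k x : pairing omega (pw k x) = (pairing omega x : C) ^+ k.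
Proof. by rewrite /pairing /= /pwform prodr_const card_ord. Qed.

Lemma pairingD omega k (f g : Sym k) :
  pairing omega (f + g) = pairing omega f + pairing omega g :> C.
Proof. by []. Qed.
Lemma pairingZ omega k (a : C) (f : Sym k) :
  pairing omega (a *: f) = a * (pairing omega f : C) :> C.
Proof. by []. Qed.
Lemma pairing0 omega k : pairing omega (0 : Sym k) = 0 :> C.
Proof. by []. Qed.
Lemma pairing_sum omega k (I : Type) (r : seq I) (P : pred I) (F : I -> Sym k) :
  pairing omega (\sum_(i <- r | P i) F i) = \sum_(i <- r | P i) (pairing omega (F i) : C).
Proof. by rewrite /pairing subval_sum form_sumE. Qed.

Lemma pairing_bdd_form omega k : bdd_form (fun f : Sym k => pairing omega f : C).
Proof. exact: sym_ev_bdd_form. Qed.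

Lemma pw_tens_prod m n x : sym_incl (pw (m + n) x) = tens_prod (sym_incl (pw m x)) (sym_incl (pw n x)).
Proof. by apply: subval_inj; rewrite /= pwformD. Qed.

Lemma pairing_odot_pw (i1 j1 i2 j2 : nat) (A1 : Sym i1 -> Sym j1) (A2 : Sym i2 -> Sym j2) omega x :
  bdd_op A1 -> bdd_op A2 ->
  pairing omega (odot A1 A2 (pw (i1 + i2) x)) =
  (pairing omega (A1 (pw i1 x)) : C) * (pairing omega (A2 (pw i2 x)) : C).
Proof. by move=> b1 b2; apply: pairing_odot => //; exact: pw_tens_prod. Qed.

Lemma vec1_subproof n (v : lb_step Phi n) :
  elemn (fun _ : 'I_1 => v) \in subspace_pred (union_sub (sym_sys Phi 1)).
Proof.
apply/asboolP; exists n => //; exists (elemn (fun _ : 'I_1 => v)); first exact: elemn_stp.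
apply/funext => phi; rewrite /symz (eq_bigr (fun=> elemn (fun _ : 'I_1 => v) phi : C)).
  by rewrite sumr_const card_Sn mulr1n invr1; exact: (@mul1r C).
move=> s _; congr (elemn _ _); apply/funext => i.
by rewrite (ord1 (s i)) (ord1 i).
Qed.

Definition vec1 n (v : lb_step Phi n) : Sym 1 := SubspaceOf (vec1_subproof v).

Lemma pairing_vec1 omega n (v : lb_step Phi n) : pairing omega (vec1 v) = omega (lb_incl Phi n v).
Proof. by rewrite /pairing /= /elemn /elem; exact: big_ord1. Qed.

(** Polarization: a symmetrized elementary tensor is a combination of powers of
    partial sums of its factors. *)
Lemma symz_elemn k n (x : 'I_k -> lb_step Phi n) :
  sym_proj (tens_of (elemn x)) = (k`!%:R : C)^-1 *:
    \sum_(J : {set 'I_k}) ((-1) ^+ #|~: J| : C) *: pw k (\sum_(j in J) vec1 (x j)).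
Proof.
apply: subval_inj; rewrite sym_projE (tens_ofE (elemn_stp x)) subvalZ subval_sum.
apply/funext => phi.
transitivity ((k`!%:R : C)^-1 * \sum_(J : {set 'I_k}) ((-1) ^+ #|~: J| : C) *
     \prod_i \sum_(j in J) (phi i (lb_incl Phi n (x j)) : C)); last first.
  rewrite -[RHS]/((k`!%:R : C)^-1 * _ : C); congr (_ * _); rewrite form_sumE.
  apply: eq_bigr => J _; rewrite subvalZ -[RHS]/((-1) ^+ #|~: J| * _ : C); congr (_ * _).
  rewrite /= /pwform; apply: eq_bigr => i _; rewrite pairing_sum.
  by apply: eq_bigr => j _; rewrite pairing_vec1.
rewrite -(ryser (fun i j => phi i (lb_incl Phi n (x j)) : C)) /symz; congr (_ * _).
rewrite (reindex_inj (@invg_inj _)); apply: eq_bigr => s _.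
rewrite /elemn /elem (reindex_inj (@perm_inj _ s)) /=.
by apply: eq_bigr => i _; rewrite permK.
Qed.

Lemma sym_dense k (L : Sym k -> C) : bdd_form L -> (forall x, L (pw k x) = 0) ->
  forall f, L f = 0.
Proof.
move=> bL L0 f; rewrite -[f]sym_inclK.
have bL' := bdd_form_comp (sym_proj_bdd_op Phi k) bL.
apply: (tens_dense bL') => n x; rewrite /= symz_elemn.
have [lL _] := bL.
rewrite (linfZ lL) (linf_sum lL) big1 ?mulr0 // => J _.
by rewrite (linfZ lL) L0 mulr0.
Qed.

(** Polarization on the dual side: a symmetric form is determined by its
    restriction to the diagonal. *)
Lemma sym_polarize k (f : Sym k) phi : (subval f phi : C) = (k`!%:R : C)^-1 *
  \sum_(J : {set 'I_k}) ((-1) ^+ #|~: J| : C) *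
    (pairing (dual_sum (index_enum 'I_k) (mem J) (fun=> 1) phi) f : C).
Proof.
rewrite -{1}(symz_subval f) {1}/symz; congr (_ * _).
pose om J := dual_sum (index_enum 'I_k) (mem (J : {set 'I_k})) (fun=> 1) phi.
(* k! times the difference of the two sides; it vanishes on elementary tensors *)
pose L (t : Tens k) : C := \sum_(s : 'S_k) (subval t (fun i => phi (s i)) : C) +
  \sum_(J : {set 'I_k}) (- (-1) ^+ #|~: J| : C) * (subval t (fun=> om J) : C).
have bL : bdd_form L.
  have h1 : bdd_form (fun t : Tens k => \sum_(s : 'S_k) (subval t (fun i => phi (s i)) : C)).
    by apply: bdd_form_sum => s _; exact: tens_ev_bdd_form.
  have h2 : bdd_form (fun t : Tens k =>
      \sum_(J : {set 'I_k}) (- (-1) ^+ #|~: J| : C) * (subval t (fun=> om J) : C)).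
    apply: bdd_form_sum => J _.
    have := bdd_formD (- (-1) ^+ #|~: J| : C) (tens_ev_bdd_form (fun _ : 'I_k => om J)) (bdd_form0 _).
    by under eq_fun do rewrite addr0.
  have := bdd_formD 1 h1 h2; by under eq_fun do rewrite mul1r.
have L0 t : L t = 0.
  apply: (tens_dense bL) => n x; rewrite /L (tens_ofE (elemn_stp x)).
  under [X in _ + X]eq_bigr do rewrite mulNr.
  rewrite sumrN; apply/eqP; rewrite subr_eq0; apply/eqP.
  rewrite (eq_bigr (fun s : 'S_k => \prod_i (phi (s i) (lb_incl Phi n (x i)) : C))) //.
  rewrite (ryser (fun i j => phi j (lb_incl Phi n (x i)) : C)).
  apply: eq_bigr => J _; congr (_ * _); rewrite /elemn /elem.
  by apply: eq_bigr => i _; rewrite /om /=; apply: eq_bigr => j _; rewrite mul1r.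
have := L0 (sym_incl f); rewrite /L; under [X in _ + X]eq_bigr do rewrite mulNr.
by rewrite sumrN => /eqP; rewrite subr_eq0 => /eqP.
Qed.

Lemma pairing_sep k (f g : Sym k) :
  (forall omega, pairing omega f = pairing omega g :> C) -> f = g.
Proof.
move=> h; apply: subval_inj; apply/funext => phi.
rewrite [LHS]sym_polarize [RHS]sym_polarize; congr (_ * _).
by apply: eq_bigr => J _; rewrite h.
Qed.

Lemma sym_dense_eq k (L M : Sym k -> C) : bdd_form L -> bdd_form M ->
  (forall x, L (pw k x) = M (pw k x)) -> forall f, L f = M f.
Proof.
move=> bL bM h f; have b := bdd_formD (-1) bM bL.
have := sym_dense b _ f => /= /(_ _)/eqP; rewrite mulN1r addrC subr_eq0 => e.
by apply/eqP/e => x; rewrite mulN1r h addNr.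
Qed.

Lemma bdd_op_eq i j (A B : Sym i -> Sym j) : bdd_op A -> bdd_op B ->
  (forall x, A (pw i x) = B (pw i x)) -> A = B.
Proof.
move=> bA bB h; apply/funext => f; apply: pairing_sep => omega.
apply: (sym_dense_eq (bdd_form_comp bA (pairing_bdd_form omega j)) (bdd_form_comp bB (pairing_bdd_form omega j))).
by move=> x /=; rewrite h.
Qed.

Definition dual_scale (z : C) (omega : dual) : dual :=
  dual_sum [:: tt] xpredT (fun=> z) (fun=> omega).

Lemma dual_scaleE z omega v : dual_scale z omega v = z * (omega v : C) :> C.
Proof. by rewrite /= big_seq1. Qed.

(** Homogeneity, which separates the degrees of a polynomial (coef_uniq). *)
Lemma pairing_scale z omega k (f : Sym k) :
  pairing (dual_scale z omega) f = z ^+ k * (pairing omega f : C) :> C.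
Proof.
pose L (t : Tens k) : C :=
  (- z ^+ k) * (subval t (fun=> omega) : C) + (subval t (fun=> dual_scale z omega) : C).
have bL : bdd_form L by apply: bdd_formD; exact: tens_ev_bdd_form.
suff /(_ (sym_incl f)) : forall t, L t = 0.
  by rewrite /L addrC mulNr => /eqP; rewrite subr_eq0 => /eqP.
apply: (tens_dense bL) => n x; rewrite /L (tens_ofE (elemn_stp x)) /elemn /elem.
rewrite [X in _ + X](eq_bigr (fun i => z * (omega (lb_incl Phi n (x i)) : C))).
  by rewrite big_split prodr_const card_ord mulNr addNr.
by move=> i _; rewrite dual_scaleE.
Qed.

End Powers.

(** * Coefficients of polynomials and triangular operators *)

Lemma poly_eq_ext (K : numFieldType) (p q : {poly K}) : (forall z, p.[z] = q.[z]) -> p = q.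
Proof.
move=> h; apply/eqP; rewrite -subr_eq0; apply/eqP.
apply: (@roots_geq_poly_eq0 _ _ [seq i%:R | i <- iota 0 (size (p - q))]).
- by apply/allP => x _; rewrite /root hornerD hornerN h subrr.
- rewrite map_inj_uniq ?iota_uniq // => i j /eqP; rewrite eqr_nat => /eqP //.
- by rewrite size_map size_iota.
Qed.

Section Polyfun.
Variables (R : realType) (Phi : LBspace R).
Local Notation C := R[i].
Local Notation Sym k := (SymPow Phi k).
Local Notation polyfun := (polyfun Phi).

Lemma peval_inj (p q : polyfun) : (forall omega, peval p omega = peval q omega :> C) -> p = q.
Proof. by move=> h; apply: subval_inj; apply/funext => omega; exact: h. Qed.

Lemma pevalD (p q : polyfun) omega : peval (p + q) omega = (peval p omega : C) + (peval q omega : C) :> C.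
Proof. by []. Qed.
Lemma pevalZ (a : C) (p : polyfun) omega : peval (a *: p) omega = a * (peval p omega : C) :> C.
Proof. by []. Qed.
Lemma peval_sum (I : Type) (r : seq I) (P : pred I) (F : I -> polyfun) omega :
  peval (\sum_(i <- r | P i) F i) omega = \sum_(i <- r | P i) (peval (F i) omega : C) :> C.
Proof. by elim/big_rec2: _ => // i y1 y2 _ <-. Qed.
Lemma peval_mono omega k (f : Sym k) : peval (mono f) omega = pairing omega f :> C.
Proof. by []. Qed.

Lemma mono_lin k : linear (@mono R Phi k).
Proof.
move=> a x y; apply: peval_inj => omega.
by rewrite pevalD pevalZ !peval_mono pairingD pairingZ.
Qed.

Lemma mono_recast m n (f : Sym m) : m = n -> mono (recast n f) = mono f.
Proof. by move=> e; subst n; rewrite recast_id. Qed.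

(** Along the line z omega the k-th summand is multiplied by z ^+ k, so the
    identity becomes one between polynomials in z. *)
Lemma coef_uniq N (f g : forall k, Sym k) :
  (forall omega, \sum_(k < N) (pairing omega (f k) : C) = \sum_(k < N) (pairing omega (g k) : C)) ->
  forall k, (k < N)%N -> f k = g k.
Proof.
move=> h k kN; apply: pairing_sep => omega.
pose p (f : forall k, Sym k) := \poly_(k < N) (pairing omega (f k) : C).
have e : p f = p g.
  apply: poly_eq_ext => z; rewrite !horner_poly.
  have := h (dual_scale z omega); under eq_bigr do rewrite pairing_scale mulrC.
  by under [in RHS]eq_bigr do rewrite pairing_scale mulrC.
by have := congr1 (fun p : {poly C} => p`_k) e; rewrite !coef_poly kN.
Qed.

Lemma pcoef_ex (p : polyfun) : exists f : forall k, Sym k, exists K : nat,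
  (forall k, (K < k)%N -> f k = 0) /\
  forall omega, peval p omega = \sum_(k < K.+1) (pairing omega (f k) : C) :> C.
Proof.
have /asboolP[K [f pE]] := subvalP p.
exists (fun k => if (k <= K)%N then f k else 0), K; split.
  by move=> k Kk; rewrite leqNgt Kk.
move=> omega; rewrite /peval pE; apply: eq_bigr => k _.
by rewrite -ltnS ltn_ord.
Qed.

Definition pcoef k (p : polyfun) : Sym k := projT1 (cid (pcoef_ex p)) k.

Lemma pcoef_deg (p : polyfun) : exists K : nat, forall k, (K < k)%N -> pcoef k p = 0.
Proof. by have [K [h _]] := projT2 (cid (pcoef_ex p)); exists K. Qed.

Lemma pcoef_deg2 (p q : polyfun) : exists2 K : nat,
  forall k, (K < k)%N -> pcoef k p = 0 & (forall k, (K < k)%N -> pcoef k q = 0).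
Proof.
have [K pK] := pcoef_deg p; have [L qL] := pcoef_deg q.
by exists (maxn K L) => k h; [apply: pK|apply: qL]; lia.
Qed.

Lemma pcoef_sum (p : polyfun) K : (forall k, (K < k)%N -> pcoef k p = 0) ->
  p = \sum_(k < K.+1) mono (pcoef k p).
Proof.
move=> pK; apply: peval_inj => omega; rewrite peval_sum.
have [K' [h ->]] := projT2 (cid (pcoef_ex p)); rewrite -/(pcoef _ p) in h *.
pose F k : C := pairing omega (pcoef k p).
have F0 N : (forall k, (N < k)%N -> pcoef k p = 0) -> forall k, (N < k)%N -> F k = 0.
  by move=> z k /z e; rewrite /F e pairing0.
rewrite -(big_ord_cut (F := F) (N := (maxn K K').+1) _ (F0 _ h)) ?ltnS ?leq_maxr //.
by rewrite (big_ord_cut (F := F) _ (F0 _ pK)) // ltnS leq_maxl.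
Qed.

Lemma pcoef_unique (p : polyfun) (f : forall k, Sym k) K :
  (forall k, (K < k)%N -> f k = 0) -> p = \sum_(k < K.+1) mono (f k) ->
  forall k, pcoef k p = f k.
Proof.
move=> fK pE k; have [K' pK'] := pcoef_deg p.
pose M := maxn k (maxn K K').
have pK k' : (M < k')%N -> pcoef k' p = 0.
  by move=> h; apply: pK'; rewrite /M in h; lia.
apply: (@coef_uniq M.+1) => [omega|]; last by rewrite ltnS leq_maxl.
transitivity (peval p omega : C).
  by rewrite [in RHS](pcoef_sum pK) peval_sum.
rewrite pE peval_sum; apply/esym/(big_ord_cut (F := fun k => pairing omega (f k) : C)).
  by rewrite ltnS /M; lia.
by move=> i /fK ->; rewrite pairing0.
Qed.

Lemma pcoef_lin k : linear (pcoef k).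
Proof.
move=> a p q; have [K pM qM] := pcoef_deg2 p q.
apply: (@pcoef_unique _ (fun k => a *: pcoef k p + pcoef k q) K).
  by move=> j h; rewrite pM // qM // scaler0 addr0.
rewrite {1}(pcoef_sum pM) {1}(pcoef_sum qM) scaler_sumr -big_split /=.
by apply: eq_bigr => j _; rewrite mono_lin.
Qed.

Lemma pcoef_mono k (f : Sym k) : pcoef k (mono f) = f.
Proof.
rewrite (@pcoef_unique _ (fun j => if j == k then recast j f else 0) k).
- by rewrite eqxx recast_id.
- by move=> j kj; rewrite gtn_eqF.
rewrite big_ord_recr /= eqxx recast_id big1 ?add0r // => j _.
by rewrite ltn_eqF ?(lin0 (@mono_lin _)).
Qed.

Lemma pcoef_mono_neq j k (f : Sym k) : j != k -> pcoef j (mono f) = 0.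
Proof.
move=> jk; rewrite (@pcoef_unique _ (fun j => if j == k then recast j f else 0) k).
- by rewrite (negPf jk).
- by move=> i ki; rewrite gtn_eqF.
rewrite big_ord_recr /= eqxx recast_id big1 ?add0r // => i _.
by rewrite ltn_eqF ?(lin0 (@mono_lin _)).
Qed.

Section Extension.
Variables (V : lmodType C) (F : forall n, Sym n -> V).
Hypothesis lF : forall n, linear (@F n).

Definition pext (p : polyfun) : V := \sum_(k < (projT1 (cid (pcoef_deg p))).+1) F (pcoef k p).

Lemma pextE p K : (forall k, (K < k)%N -> pcoef k p = 0) ->
  pext p = \sum_(k < K.+1) F (pcoef k p).
Proof.
pose G k := F (pcoef k p).
have G0 N : (forall k, (N < k)%N -> pcoef k p = 0) -> forall k, (N < k)%N -> G k = 0.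
  by move=> z k /z e; rewrite /G e (lin0 (@lF _)).
move=> pK; rewrite /pext; case: cid => K' /= pK'.
rewrite -(big_ord_cut (F := G) (N := (maxn K K').+1) _ (G0 _ pK')) ?ltnS ?leq_maxr //.
by rewrite (big_ord_cut (F := G) _ (G0 _ pK)) // ltnS leq_maxl.
Qed.

Lemma pext_lin : linear pext.
Proof.
move=> a p q; have [K pM qM] := pcoef_deg2 p q.
rewrite (pextE pM) (pextE qM) (@pextE _ K).
  by rewrite scaler_sumr -big_split; apply: eq_bigr => j _; rewrite pcoef_lin lF.
by move=> j h; rewrite pcoef_lin pM // qM // scaler0 addr0.
Qed.

Lemma pext_mono n (f : Sym n) : pext (mono f) = F f.
Proof.
rewrite (@pextE _ n); last by move=> k nk; rewrite pcoef_mono_neq // gtn_eqF.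
rewrite big_ord_recr /= pcoef_mono big1 ?add0r // => i _.
by rewrite pcoef_mono_neq ?ltn_eqF // (lin0 (@lF _)).
Qed.

End Extension.

Lemma poly_lin_ext (V : lmodType C) (S T : polyfun -> V) : linear S -> linear T ->
  (forall n (f : Sym n), S (mono f) = T (mono f)) -> S = T.
Proof.
move=> lS lT h; apply/funext => p; have [K pK] := pcoef_deg p.
rewrite (pcoef_sum pK) (lin_sum lS) (lin_sum lT).
by apply: eq_bigr => k _; exact: h.
Qed.

Lemma mono_opP (F : forall n, Sym n -> polyfun) : (forall n, linear (@F n)) ->
  linear (mono_op F) /\ forall n (f : Sym n), mono_op F (mono f) = F n f.
Proof.
move=> lF; apply: (@theP _ 0 [set P | linear P /\ forall n (f : Sym n), P (mono f) = F n f] (pext F)).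
by split; [exact: pext_lin|move=> n f; exact: pext_mono].
Qed.

Lemma sym_bdd_opD i j (A B : Sym i -> Sym j) (a : C) :
  bdd_op A -> bdd_op B -> bdd_op (fun x => a *: A x + B x).
Proof.
by apply: bdd_opD; [exact: sym_shrink|exact: sym_subadd|exact: sym_homog].
Qed.

Lemma sym_bdd_op0 i j : bdd_op (fun _ : Sym i => 0 : Sym j).
Proof. by apply: bdd_op0; exact: sym_pointed. Qed.

Lemma sym_bdd_opZ i j (A : Sym i -> Sym j) (a : C) : bdd_op A -> bdd_op (fun x => a *: A x).
Proof.
move=> bA; have := sym_bdd_opD a bA (sym_bdd_op0 i j).
by under eq_fun do rewrite addr0.
Qed.

Lemma sym_bdd_op_sum i j (I : Type) (r : seq I) (P : pred I) (A : I -> Sym i -> Sym j) :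
  (forall k, P k -> bdd_op (A k)) -> bdd_op (fun x => \sum_(k <- r | P k) A k x).
Proof.
move=> bA; elim: r => [|k r IH].
  rewrite (_ : (fun _ => _) = fun=> 0); first exact: sym_bdd_op0.
  by apply/funext => x; rewrite big_nil.
have [Pk|Pk] := boolP (P k).
  rewrite (_ : (fun _ => _) = fun x => 1 *: A k x + \sum_(l <- r | P l) A l x).
    by apply: sym_bdd_opD => //; exact: bA.
  by apply/funext => x; rewrite big_cons Pk scale1r.
rewrite (_ : (fun _ => _) = fun x => \sum_(l <- r | P l) A l x) //.
by apply/funext => x; rewrite big_cons (negPf Pk).
Qed.

Lemma recast_bdd_op i j k (A : Sym i -> Sym j) (e : j = k) : bdd_op A -> bdd_op (fun x => recast k (A x)).
Proof.
by move=> bA; subst k; rewrite (_ : (fun _ => _) = A) //; apply/funext => x; rewrite recast_id.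
Qed.

Lemma bdd_op_recast i j k (A : Sym i -> Sym j) (e : k = i) :
  bdd_op A -> bdd_op (fun x : Sym k => A (recast i x)).
Proof.
by move=> bA; subst k; rewrite (_ : (fun _ => _) = A) //; apply/funext => x; rewrite recast_id.
Qed.

Lemma recast_pw m n x : m = n -> recast n (pw m x) = pw n x :> Sym n.
Proof. by move=> e; subst n; rewrite recast_id. Qed.

(** All operators on polynomials considered here have this form. It is closed
    under sums and composition, and it implies continuity (triang_contlin). *)
Definition triang (T : polyfun -> polyfun) : Prop :=
  [/\ linear T, forall i k (f : Sym k), (k < i)%N -> pcoef i (T (mono f)) = 0 &
      forall i k, bdd_op (fun f : Sym k => pcoef i (T (mono f)))].

Lemma triang_mono T k (f : Sym k) : triang T ->
  T (mono f) = \sum_(i < k.+1) mono (pcoef i (T (mono f))).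
Proof. by move=> [_ h _]; apply: pcoef_sum => i; exact: h. Qed.

Lemma triang_comp S T : triang S -> triang T -> triang (S \o T).
Proof.
move=> tS tT; have [lS uS bS] := tS; have [lT uT bT] := tT.
have E i k (f : Sym k) : pcoef i ((S \o T) (mono f)) =
    \sum_(j < k.+1) pcoef i (S (mono (pcoef j (T (mono f))))).
  by rewrite /= [in LHS](triang_mono f tT) (lin_sum lS) (lin_sum (pcoef_lin i)).
split; first by move=> a x y /=; rewrite lT lS.
  by move=> i k f ki; rewrite E big1 // => j _; apply: uS; have := ltn_ord j; lia.
move=> i k; under eq_fun do rewrite E.
by apply: sym_bdd_op_sum => j _; exact: (bdd_op_comp (bT j k) (bS i j)).
Qed.

Lemma triang_id : triang id.
Proof.
split => //; first by move=> i k f ki; rewrite pcoef_mono_neq // gtn_eqF.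
move=> i k; have [<-|ik] := eqVneq i k.
  by under eq_fun do rewrite pcoef_mono; exact: bdd_op_id.
by under eq_fun do rewrite pcoef_mono_neq //; exact: sym_bdd_op0.
Qed.

Lemma triangD (a : C) S T : triang S -> triang T -> triang (fun p => a *: S p + T p).
Proof.
move=> [lS uS bS] [lT uT bT]; split.
- move=> b x y; rewrite lS lT !scalerDr !scalerA addrACA [b * a]mulrC //.
- by move=> i k f ki; rewrite pcoef_lin uS // uT // scaler0 addr0.
- by move=> i k; under eq_fun do rewrite pcoef_lin; exact: sym_bdd_opD.
Qed.

Lemma triang_iter n T : triang T -> triang (iter n T).
Proof.
move=> tT; elim: n => [|n IH]; first exact: triang_id.
exact: (triang_comp tT IH).
Qed.

Lemma open_poly (U : set polyfun) : open U = lc_open (@poly_nbhs0 R Phi) U.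
Proof. by []. Qed.

(** The value at a monomial of degree k is a sum of k + 1 blocks, each of them
    continuous. It is the mean of their multiples by k + 1, and means stay in an
    absolutely convex neighbourhood. *)
Lemma triang_contlin T : triang T -> contlin T.
Proof.
move=> tT; have [lT uT bT] := tT; split => //; apply/continuousP => U; rewrite !open_poly => oU x Ux.
have [W [cW NW WU]] := oU _ Ux.
exists (T @^-1` W); split.
- exact: abs_convex_preim.
- move=> k; rewrite nbhsE.
  pose W' : set (Sym k) := (fun f => T (mono f)) @^-1` W.
  have lTm : linear (fun f : Sym k => T (mono f)) by move=> a y z; rewrite mono_lin lT.
  have cW' : abs_convex W' by exact: abs_convex_preim.
  have NW' : indlim_nbhs0 W'.
    apply/indlim_nbhs0P => n.
    have h i : exists2 e : C, 0 < e & forall f : Sym k, sym_stp n (subval f) ->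
        inj_norm_le n (subval f) e -> W (mono (pcoef i (T (mono f)))).
      have : indlim_nbhs0 ((fun f : Sym k => pcoef i (T (mono f))) @^-1` (@mono R Phi i @^-1` W)).
        by apply: bdd_op_nbhs0; [exact: bT|exact/nbhs_indlim0/NW].
      by move=> /indlim_nbhs0P /(_ n).
    have [e e0 he] : exists2 e : C, 0 < e & forall i, (i < k.+1)%N -> forall f : Sym k,
        sym_stp n (subval f) -> inj_norm_le n (subval f) e -> W (mono (pcoef i (T (mono f)))).
      elim: k.+1 => [|m [e e0 IH]]; first by exists 1.
      have [d d0 hd] := h m.
      have ed : 0 < e * d / (e + d) by rewrite divr_gt0 ?mulr_gt0 ?addr_gt0.
      exists (e * d / (e + d)) => // i; rewrite ltnS leq_eqVlt => /orP[/eqP ->|im] f fn fe.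
        apply: hd => //; apply: inj_norm_le_mono fe.
        rewrite ler_pdivrMr ?addr_gt0 // mulrC ler_wpM2l ?(ltW d0) // lerDl ltW //.
      apply: IH => //; apply: inj_norm_le_mono fe.
      by rewrite ler_pdivrMr ?addr_gt0 // ler_wpM2l ?(ltW e0) // lerDr ltW.
    have k0 : 0 < k.+1%:R :> C by rewrite ltr0n.
    have W0 : W 0 by rewrite -(lin0 (@mono_lin 0)); exact: nbhs_singleton (NW 0%N).
    exists (e / k.+1%:R) => [|f fn fe]; first by rewrite divr_gt0.
    rewrite /W' /preimage /= (triang_mono f tT).
    have -> : \sum_(i < k.+1) mono (pcoef i (T (mono f))) =
        \sum_(i < k.+1) (k.+1%:R^-1 : C) *: mono (pcoef i (T (mono ((k.+1%:R : C) *: f)))).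
      apply: eq_bigr => i _; rewrite (linZ (@mono_lin _)) (linZ lT) (linZ (pcoef_lin _)).
      by rewrite (linZ (@mono_lin _)) scalerA mulVf ?scale1r // gt_eqF.
    apply: abs_convex_sum => //.
      move=> i; apply: he => //; first by rewrite subvalZ; exact: (@subspaceZ _ _ (stp (sym_sys Phi k) n)).
      rewrite subvalZ; have := inj_norm_leZ (k.+1%:R) fe; apply: inj_norm_le_mono.
      by rewrite gtr0_norm // mulrC divfK // gt_eqF.
    rewrite sumr_const card_ord gtr0_norm ?invr_gt0 // -[_ *+ _]mulr_natl mulfV // gt_eqF //.
  have [U' [oU' U0 U'W]] := lc_interior (indlim_scalable (@sym_homog R Phi k))
    (indlim_pointed (@sym_pointed R Phi k)) cW' NW'.
  by exists U'.
move=> w Ww; rewrite /preimage /= (linD lT); exact: WU.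
Qed.

End Polyfun.

(** * The operators nabla and NM *)

Lemma fsum_from (V : nmodType) d K (F : nat -> V) :
  (forall k, (K < k)%N -> F k = 0) ->
  \sum_(k \in [set k | (d <= k)%N]) F k = \sum_(k < K.+1 | (d <= k)%N) F k.
Proof.
move=> FK; rewrite -(big_mkord (leq d) F) /index_iota subn0.
rewrite (@bigfs _ _ _ _ _ (leq d)) ?iota_uniq // => k _.
by rewrite mem_iota add0n leq0n /= -leqNgt => /FK.
Qed.

Section Operators.
Variables (R : realType) (Phi : LBspace R).
Local Notation C := R[i].
Local Notation dual := (dual Phi).
Local Notation Sym k := (SymPow Phi k).
Local Notation polyfun := (polyfun Phi).
Local Notation fseries := (fseries Phi).

Definition dual0 : dual := exist _ _ (is_dual0 Phi).
(** The inverse of scal. A form without slots is constant, so any dual element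
    may serve to evaluate it. *)
Definition sc (f : Sym 0) : C := pairing dual0 f.

Lemma pairing_sc omega (f : Sym 0) : pairing omega f = sc f :> C.
Proof. by rewrite /sc /pairing; congr (subval f _); apply/funext => -[]. Qed.

Lemma pairing_scal omega c : pairing omega (scal Phi c) = c :> C.
Proof. by []. Qed.

Lemma scal_sc f : scal Phi (sc f) = f.
Proof. by apply: pairing_sep => omega; rewrite pairing_scal pairing_sc. Qed.

Lemma scal_lin (a x y : C) : scal Phi (a * x + y) = a *: scal Phi x + scal Phi y.
Proof. by apply: pairing_sep => omega; rewrite pairingD pairingZ !pairing_scal. Qed.

Lemma scP (a : C) (x y : Sym 0) : sc (a *: x + y) = a * sc x + sc y.
Proof. by []. Qed.

Lemma pairing_sym_proj omega k (t : TensPow Phi k) :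
  pairing omega (sym_proj t) = subval t (fun=> omega) :> C.
Proof.
rewrite /pairing sym_projE /symz sumr_const card_Sn -[X in _ * X = _]mulr_natl.
by rewrite mulKf // pnatr_eq0 -lt0n fact_gt0.
Qed.

(** The product of the symmetric algebra. *)
Definition sprod m n (f : Sym m) (g : Sym n) : Sym (m + n) :=
  sym_proj (tens_prod (sym_incl f) (sym_incl g)).

Lemma pairing_sprod omega m n (f : Sym m) (g : Sym n) :
  pairing omega (sprod f g) = (pairing omega f : C) * (pairing omega g : C) :> C.
Proof. by rewrite pairing_sym_proj. Qed.

Definition pwmul m (x y : Sym 1) : polyfun := mono (sprod (pw m x) y).

Lemma peval_pwmul m x y omega :
  peval (pwmul m x y) omega = (pairing omega x : C) ^+ m * (pairing omega y : C) :> C.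
Proof. by rewrite peval_mono pairing_sprod pairing_pw. Qed.

Lemma pwmul0 m x : pwmul m x 0 = 0.
Proof. by apply: peval_inj => omega; rewrite peval_pwmul pairing0 mulr0. Qed.

Lemma mono_odot_scalar m k n (a : Sym k -> Sym 0) x : bdd_op a -> n = (m + k)%N ->
  mono (odot (id : Sym m -> Sym m) a (recast (m + k) (pw n x))) =
  sc (a (pw k x)) *: mono (pw m x).
Proof.
move=> ba e; rewrite recast_pw //; apply: peval_inj => omega.
rewrite pevalZ !peval_mono pairing_odot_pw //; last exact: bdd_op_id.
by rewrite mulrC pairing_sc.
Qed.

Lemma mono_odot_vector m k n (b : Sym k -> Sym 1) x : bdd_op b -> n = (m + k)%N ->
  mono (odot (id : Sym m -> Sym m) b (recast (m + k) (pw n x))) =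
  pwmul m x (b (pw k x)).
Proof.
move=> bb e; rewrite recast_pw //; apply: peval_inj => omega.
by rewrite peval_pwmul !peval_mono pairing_odot_pw ?pairing_pw //; exact: bdd_op_id.
Qed.

Lemma odot_id_bdd_op m k j (c : Sym k -> Sym j) : bdd_op c ->
  bdd_op (odot (id : Sym m -> Sym m) c).
Proof. by move=> bc; apply: odot_bdd_op => //; exact: bdd_op_id. Qed.

Lemma mono_deg n (f : Sym n) k : (n < k)%N -> pcoef k (mono f) = 0.
Proof. by move=> nk; rewrite pcoef_mono_neq // gtn_eqF. Qed.

Definition striang (T : polyfun -> polyfun) : Prop :=
  triang T /\ forall i k (f : Sym k), (k <= i)%N -> pcoef i (T (mono f)) = 0.

Section Lower.
Unset Implicit Arguments.
Variables (j : nat) (c : fseries j).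
Set Implicit Arguments.
Hypothesis bc : forall k, bdd_op (c k).

(** The common form of nabla_pow (j = 0) and of M_nabla_pow (j = 1). The
    summand k changes degrees by j - k, and the sums nabla and M_nabla start
    where this is negative. *)
Definition lower_pow k : polyfun -> polyfun := mono_op (fun n f => if (k <= n)%N
  then mono (odot (id : Sym (n - k) -> Sym (n - k)) (c k) (recast (n - k + k) f)) else 0).

Definition lower : polyfun -> polyfun :=
  fun p => \sum_(k \in [set k | (j.+1 <= k)%N]) lower_pow k p.

Lemma lower_powP k : linear (lower_pow k) /\ forall n (f : Sym n),
  lower_pow k (mono f) = if (k <= n)%N
    then mono (odot (id : Sym (n - k) -> Sym (n - k)) (c k) (recast (n - k + k) f)) else 0.
Proof.
apply: mono_opP => n u x y; case: ifP => kn; last by rewrite scaler0 addr0.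
have [l _] := bdd_op_recast (esym (subnK kn)) (odot_id_bdd_op (n - k) (bc k)).
by rewrite l mono_lin.
Qed.

Lemma shiftE p K : (forall k, (K < k)%N -> pcoef k p = 0) ->
  lower p = \sum_(k < K.+1 | (j.+1 <= k)%N) lower_pow k p.
Proof.
move=> pK; apply: fsum_from => k Kk.
rewrite (pcoef_sum pK) (lin_sum (lower_powP k).1) big1 // => i _.
by rewrite (lower_powP k).2 ifF //; have := ltn_ord i; lia.
Qed.

Lemma lower_lin : linear lower.
Proof.
move=> u p q; have [K pK qK] := pcoef_deg2 p q.
rewrite (shiftE pK) (shiftE qK) (@shiftE _ K).
  by rewrite scaler_sumr -big_split; apply: eq_bigr => k _; rewrite (lower_powP k).1.
by move=> k h; rewrite pcoef_lin pK // qK // scaler0 addr0.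
Qed.

Lemma lower_mono n (f : Sym n) : lower (mono f) = \sum_(k < n.+1 | (j.+1 <= k)%N)
  mono (odot (id : Sym (n - k) -> Sym (n - k)) (c k) (recast (n - k + k) f)).
Proof.
rewrite (shiftE (@mono_deg n f)); apply: eq_bigr => k _.
by rewrite (lower_powP k).2 -ltnS ltn_ord.
Qed.

Lemma lower_striang : striang lower.
Proof.
have strict i k (f : Sym k) : (k <= i)%N -> pcoef i (lower (mono f)) = 0.
  move=> ki; rewrite lower_mono (lin_sum (@pcoef_lin _ _ i)) big1 // => l l1.
  by rewrite pcoef_mono_neq //; have := ltn_ord l; lia.
split=> //; split; first exact: lower_lin.
  by move=> i k f /ltnW; exact: strict.
move=> i k; under eq_fun do rewrite lower_mono (lin_sum (@pcoef_lin _ _ i)).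
apply: sym_bdd_op_sum => l _.
have bo : bdd_op (fun f : Sym k => odot (id : Sym (k - l) -> _) (c l) (recast (k - l + l) f)).
  apply: (@bdd_op_recast _ _ _ _ _ (odot (id : Sym (k - l) -> _) (c l))) (odot_id_bdd_op _ (bc l)).
  by have := ltn_ord l; lia.
have [->|kj] := eqVneq i (k - l + j)%N.
  by under eq_fun do rewrite pcoef_mono.
by under eq_fun do rewrite pcoef_mono_neq //; exact: sym_bdd_op0.
Qed.

End Lower.

Lemma number_opP : linear (@number_op R Phi) /\ forall n (f : Sym n),
  number_op (mono f) = (n%:R : C) *: mono f.
Proof.
apply: mono_opP => n u x y.
by rewrite mono_lin scalerDr !scalerA mulrC.
Qed.

Lemma pcoef_number i (p : polyfun) : pcoef i (number_op p) = (i%:R : C) *: pcoef i p.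
Proof.
suff E : pcoef i \o @number_op R Phi = fun p => (i%:R : C) *: pcoef i p by exact: (congr1 (fun S => S p) E).
have [lN NE] := number_opP.
apply: poly_lin_ext => [u x y|u x y|n f] /=.
- by rewrite lN pcoef_lin.
- by rewrite pcoef_lin scalerDr !scalerA mulrC.
rewrite NE (linZ (@pcoef_lin _ _ i)); have [->//|ni] := eqVneq i n.
by rewrite pcoef_mono_neq // !scaler0.
Qed.

Section Nabla.
Unset Implicit Arguments.
Variables (a : fseries 0) (b : fseries 1).
Set Implicit Arguments.
Hypotheses (ba : forall k, bdd_op (a k)) (bb : forall k, bdd_op (b k)).

Lemma nabla_striang : striang (nabla a).
Proof. exact: lower_striang ba. Qed.

Lemma NM_nabla_mono n (f : Sym n) : NM_nabla b (mono f) = \sum_(k < n.+1 | (2 <= k)%N)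
  (((n - k + 1)%N)%:R : C) *:
  mono (odot (id : Sym (n - k) -> Sym (n - k)) (b k) (recast (n - k + k) f)).
Proof.
rewrite -[NM_nabla b _]/(number_op (lower b (mono f))) (lower_mono bb).
by rewrite (lin_sum number_opP.1); apply: eq_bigr => k _; rewrite number_opP.2.
Qed.

Lemma NM_nabla_striang : striang (NM_nabla b).
Proof.
have [[lM uM bM] sM] := lower_striang bb.
have E i k (f : Sym k) : pcoef i (NM_nabla b (mono f)) = (i%:R : C) *: pcoef i (lower b (mono f)).
  exact: pcoef_number.
split; last by move=> i k f ki; rewrite E sM // scaler0.
split; first by move=> u x y; rewrite -[LHS]/(number_op (lower b _)) lM number_opP.1.
  by move=> i k f ki; rewrite E uM // scaler0.
by move=> i k; under eq_fun do rewrite E; exact: sym_bdd_opZ.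
Qed.

Lemma nabla_pw n x : a 0%N = 0 -> nabla a (mono (pw n x)) =
  \sum_(k < n.+1) sc (a k (pw k x)) *: mono (pw (n - k) x).
Proof.
move=> a0; rewrite [LHS](lower_mono ba) big_mkcond; apply: eq_bigr => k _; case: ifP => k1.
  by apply: mono_odot_scalar => //; have := ltn_ord k; lia.
have -> : (k : nat) = 0%N by lia.
by rewrite a0 /sc pairing0 scale0r.
Qed.

Lemma NM_nabla_pw n x : b 0%N = 0 -> b 1%N = 0 -> NM_nabla b (mono (pw n x)) =
  \sum_(k < n.+1) ((n - k).+1%:R : C) *: pwmul (n - k) x (b k (pw k x)).
Proof.
move=> b0 b1; rewrite NM_nabla_mono big_mkcond; apply: eq_bigr => k _; case: ifP => k1.
  rewrite mono_odot_vector //; last by have := ltn_ord k; lia.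
  by congr (_ *: _); rewrite addn1.
have b0' : b k = 0 by have [->|->] : (k : nat) = 0%N \/ (k : nat) = 1%N by lia.
by rewrite b0' pwmul0 scaler0.
Qed.

End Nabla.

Lemma fct_add (S T : polyfun -> polyfun) p : (S + T) p = S p + T p.
Proof. by []. Qed.
Lemma fct_sub (S T : polyfun -> polyfun) p : (S - T) p = S p - T p.
Proof. by []. Qed.

End Operators.

(** * Generating functions and the commutator formula *)

Section Derivations.
Variables (R : realType) (Phi : LBspace R).
Local Notation C := R[i].
Local Notation dual := (dual Phi).
Local Notation Sym k := (SymPow Phi k).
Local Notation polyfun := (polyfun Phi).
Local Notation fseries := (fseries Phi).
Local Notation X := (Sym 1).
Local Notation fpsC := (fps R[i]).

Lemma linf_comp L (T : polyfun -> polyfun) : linf L -> linear T -> linf (L \o T).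
Proof. by move=> l lT a p q /=; rewrite lT l. Qed.

(** The series sum_k L(<., x^{(x)k}>), graded by the degree in x. *)
Definition genfun (L : polyfun -> C) (x : X) : fpsC := fun n => L (mono (pw n x)).

(** In every degree c is polynomial along lines, with directional derivative d.
    Since c need not be a polynomial in any topological sense, the derivative is
    the coefficient of z in c (x + z *: y). The constant term of d vanishes, as
    differentiation lowers the degree in x by one. *)
Definition dir_diff (c : X -> fpsC) (d : X -> X -> fpsC) : Prop :=
  (forall x y, d x y 0%N = 0) /\
  forall x y n, exists2 p : {poly C}, forall z, c (x + z *: y) n = p.[z] & p`_1 = d x y n.

Lemma dir_diff_mul c1 d1 c2 d2 : dir_diff c1 d1 -> dir_diff c2 d2 ->
  dir_diff (fun x => c1 x * c2 x) (fun x y => d1 x y * c2 x + c1 x * d2 x y).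
Proof.
move=> [z1 h1] [z2 h2]; split=> [x y|x y n].
  by rewrite fpsD !fpsM !big_ord_recl !big_ord0 /= z1 subnn z2 mul0r mulr0 !addr0.
have /choice[p pP] : forall m, exists p : {poly C},
    (forall z, c1 (x + z *: y) m = p.[z]) /\ p`_1 = d1 x y m.
  by move=> m; have [p] := h1 x y m; exists p.
have /choice[q qP] : forall m, exists p : {poly C},
    (forall z, c2 (x + z *: y) m = p.[z]) /\ p`_1 = d2 x y m.
  by move=> m; have [p'] := h2 x y m; exists p'.
have p0 m : (p m)`_0 = c1 x m.
  by rewrite -horner_coef0 -(pP m).1 scale0r addr0.
have q0 m : (q m)`_0 = c2 x m.
  by rewrite -horner_coef0 -(qP m).1 scale0r addr0.
exists (\sum_(i < n.+1) p i * q (n - i)%N).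
  move=> z; rewrite horner_sum fpsM; apply: eq_bigr => i _.
  by rewrite hornerM (pP i).1 (qP (n - i)%N).1.
rewrite coef_sum fpsD !fpsM -big_split; apply: eq_bigr => i _.
by rewrite coefM !big_ord_recl big_ord0 /= addr0 p0 q0 (pP i).2 (qP _).2 addrC.
Qed.

Lemma dir_diff_add c1 d1 c2 d2 : dir_diff c1 d1 -> dir_diff c2 d2 ->
  dir_diff (fun x => c1 x + c2 x) (fun x y => d1 x y + d2 x y).
Proof.
move=> [z1 h1] [z2 h2]; split=> [x y|x y n]; first by rewrite fpsD z1 z2 addr0.
have [p pc pd] := h1 x y n; have [q qc qd] := h2 x y n; exists (p + q).
  by move=> z; rewrite fpsD hornerD pc qc.
by rewrite coefD pd qd.
Qed.

Lemma dir_diff_one : dir_diff (fun=> 1) (fun _ _ => 0).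
Proof.
split=> // x y n; exists ((1 : fpsC) n)%:P; first by move=> z; rewrite hornerC.
by rewrite coefC.
Qed.

Lemma dir_diff_unique c d d' : dir_diff c d -> dir_diff c d' -> d = d'.
Proof.
move=> [_ h] [_ h']; apply/funext => x; apply/funext => y; apply/funext => n.
have [p pc <-] := h x y n; have [q qc <-] := h' x y n.
by have -> : p = q by apply: poly_eq_ext => z; rewrite -pc qc.
Qed.

Lemma pw_expand n (x y : X) (z : C) : mono (pw n (x + z *: y)) =
  \sum_(j < n.+1) (z ^+ j * 'C(n, j)%:R) *: mono (sprod (pw (n - j) x) (pw j y)).
Proof.
apply: peval_inj => omega; rewrite peval_sum peval_mono pairing_pw pairingD pairingZ.
rewrite exprDn; apply: eq_bigr => j _.
rewrite pevalZ peval_mono pairing_sprod !pairing_pw exprMn -mulr_natr.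
by ring.
Qed.

Definition dgenfun (L : polyfun -> C) (x y : X) : fpsC := fun n => n%:R * L (pwmul n.-1 x y).

Lemma dir_diff_genfun L : linf L -> dir_diff (genfun L) (dgenfun L).
Proof.
move=> l; split=> [x y|x y n]; first by rewrite /dgenfun mul0r.
exists (\poly_(j < n.+1) ('C(n, j)%:R * L (mono (sprod (pw (n - j) x) (pw j y))))).
  move=> z; rewrite /genfun pw_expand (linf_sum l) horner_poly.
  by apply: eq_bigr => j _; rewrite linfZ //; ring.
rewrite coef_poly /dgenfun; case: n => [|n] /=; first by rewrite mul0r.
rewrite bin1 subn1 /=; congr (_ * L _); apply: peval_inj => omega.
by rewrite peval_pwmul peval_mono pairing_sprod !pairing_pw expr1.
Qed.

(** The derivative in direction b(x), by linearity the sum of the derivatives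
    in the directions b_k(x^{(x)k}). Replacing one factor x of a monomial by the
    latter raises the degree by k - 1. *)
Definition dir_sum (b : fseries 1) (d : X -> X -> fpsC) (x : X) : fpsC := fun n =>
  \sum_(k < n.+1) d x (b k (pw k x)) (n - k).+1.

Definition deriv_along (b : fseries 1) (c c' : X -> fpsC) : Prop :=
  exists2 d, dir_diff c d & c' = dir_sum b d.

Lemma dir_sum_trunc b d x n N : (n <= N)%N -> dir_sum b d x n =
  (\sum_(k < N.+1) fps_X _ k * fps_shift (d x (b k (pw k x)))) n.
Proof.
move=> nN; rewrite fps_sum /dir_sum (big_ord_widen N.+1 (fun k => d x (b k (pw k x)) (n - k).+1)) ?ltnS //.
by rewrite big_mkcond; apply: eq_bigr => k _; rewrite fps_XM ltnS.
Qed.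

Lemma deriv_along_mul b c1 c1' c2 c2' : deriv_along b c1 c1' -> deriv_along b c2 c2' ->
  deriv_along b (fun x => c1 x * c2 x) (fun x => c1' x * c2 x + c1 x * c2' x).
Proof.
move=> [d1 h1 ->] [d2 h2 ->]; exists (fun x y => d1 x y * c2 x + c1 x * d2 x y).
  exact: dir_diff_mul.
apply/funext => x; apply/funext => n; rewrite (@dir_sum_trunc _ _ _ n n) // fpsD.
rewrite (fpsM_congr _ (fun m mn => dir_sum_trunc b d1 x mn)).
rewrite [c1 x * _]mulrC (fpsM_congr _ (fun m mn => dir_sum_trunc b d2 x mn)).
rewrite -fpsD !mulr_suml -big_split /=; congr (_ n); apply: eq_bigr => k _.
by rewrite fps_shiftD [c1 x * _]mulrC !fps_shiftM ?h1.1 ?h2.1 // mulrDr !mulrA.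
Qed.

Lemma deriv_along_add b c1 c1' c2 c2' : deriv_along b c1 c1' -> deriv_along b c2 c2' ->
  deriv_along b (fun x => c1 x + c2 x) (fun x => c1' x + c2' x).
Proof.
move=> [d1 h1 ->] [d2 h2 ->]; exists (fun x y => d1 x y + d2 x y).
  exact: dir_diff_add.
apply/funext => x; apply/funext => n.
by rewrite fpsD /dir_sum -big_split.
Qed.

Lemma deriv_along_one b : deriv_along b (fun=> 1) (fun=> 0).
Proof.
exists (fun _ _ => 0); first exact: dir_diff_one.
by apply/funext => x; apply/funext => n; rewrite /dir_sum big1.
Qed.

Lemma deriv_along_unique b c c' c'' : deriv_along b c c' -> deriv_along b c c'' -> c' = c''.
Proof. by move=> [d h ->] [e k ->]; rewrite (dir_diff_unique h k). Qed.

Section OfSeries.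
Unset Implicit Arguments.
Variables (b : fseries 1).
Set Implicit Arguments.
Hypothesis bb : forall k, bdd_op (b k).
Hypotheses (b0 : b 0%N = 0) (b1 : b 1%N = 0).

(** Composition with N M(b) is differentiation along b: the factor n - k + 1 that
    N contributes is the number of factors x that can be replaced. *)
Lemma deriv_along_genfun L : linf L -> deriv_along b (genfun L) (genfun (L \o NM_nabla b)).
Proof.
move=> l; exists (dgenfun L); first exact: dir_diff_genfun.
apply/funext => x; apply/funext => n; rewrite /genfun /= NM_nabla_pw // (linf_sum l).
by apply: eq_bigr => k _; rewrite linfZ //.
Qed.

End OfSeries.

Definition sval (a : fseries 0) (p : polyfun) : C := sc (pext a p).
Definition vval (omega : dual) (b : fseries 1) (p : polyfun) : C := pairing omega (pext b p).

Definition all_bdd_op i (A : fseries i) := forall k, bdd_op (A k).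

Lemma all_bdd_op_lin i (A : fseries i) : all_bdd_op A -> forall n, linear (A n).
Proof. by move=> h n; case: (h n). Qed.

Lemma sval_linf a : all_bdd_op a -> linf (sval a).
Proof. by move=> /all_bdd_op_lin h u p q; rewrite /sval (pext_lin h) scP. Qed.

Lemma vval_linf omega b : all_bdd_op b -> linf (vval omega b).
Proof. by move=> /all_bdd_op_lin h u p q; rewrite /vval (pext_lin h) pairingD pairingZ. Qed.

Definition ev_at (omega : dual) (p : polyfun) : C := peval p omega.

Lemma ev_at_linf omega : linf (ev_at omega).
Proof. by []. Qed.

Definition ser_xi : fseries 1 := fun k => if k is 1 return Sym k -> Sym 1 then id else fun=> 0.

Lemma ser_xi_bdd_op : all_bdd_op ser_xi.
Proof. by move=> [|[|k]]; [exact: sym_bdd_op0|exact: bdd_op_id|exact: sym_bdd_op0]. Qed.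

Lemma genfun_nabla a L x : all_bdd_op a -> a 0%N = 0 -> linf L ->
  genfun (L \o nabla a) x = genfun (sval a) x * genfun L x.
Proof.
move=> ba a0 l; apply/funext => n; rewrite /genfun /= nabla_pw // (linf_sum l) fpsM.
apply: eq_bigr => k _; rewrite linfZ // /sval pext_mono //; exact: all_bdd_op_lin.
Qed.

Lemma genfun_ser_xi omega x n : genfun (vval omega ser_xi) x n =
  if n == 1%N then pairing omega x : C else 0.
Proof.
rewrite /genfun /vval pext_mono; last exact: all_bdd_op_lin ser_xi_bdd_op.
case: n => [|[|n]]; [exact: pairing0| |exact: pairing0].
by rewrite -[ser_xi _]/(pw 1 x) pairing_pw expr1.
Qed.

(** Evaluation at omega is the geometric series of xi |-> omega(xi). *)
Lemma genfun_ev_at omega x : genfun (ev_at omega) x * (1 - genfun (vval omega ser_xi) x) = 1.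
Proof.
have gE n : genfun (ev_at omega) x n = (pairing omega x : C) ^+ n.
  by rewrite /genfun /ev_at peval_mono pairing_pw.
apply/funext => n; rewrite mulrBr mulr1 fpsD fpsN fpsM fps1 gE.
case: n => [|n]; first by rewrite big_ord1 genfun_ser_xi mulr0 subr0.
rewrite !big_ord_recr /= !genfun_ser_xi subnn subSnn /= mulr0 addr0 gE -exprSr.
rewrite big1 ?add0r ?subrr // => i _; rewrite genfun_ser_xi ifF ?mulr0 //.
by apply/eqP; have := ltn_ord i; lia.
Qed.

Section Along.
Unset Implicit Arguments.
Variables (b : fseries 1).
Set Implicit Arguments.
Hypothesis bb : all_bdd_op b.
Hypotheses (b0 : b 0%N = 0) (b1 : b 1%N = 0).

(** D_b A is A composed with N M(b): in both, A_l is applied to l times the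
    product of x^{(x)(l-1)} and b_{k-l+1}(x^{(x)(k-l+1)}). *)
Lemma ser_deriv_pw i (A : fseries i) k x : (i <= 1)%N -> all_bdd_op A ->
  ser_deriv b A (pw k x) = pext A (NM_nabla b (mono (pw k x))).
Proof.
move=> i1 bA; have lA := all_bdd_op_lin bA.
rewrite NM_nabla_pw // (lin_sum (pext_lin lA)) /ser_deriv.
rewrite -(big_mkord xpredT (fun j => pext A ((k - j).+1%:R *: pwmul (k - j) x (b j (pw j x))))).
rewrite [RHS]big_ltn // b0 pwmul0 scaler0 (lin0 (pext_lin lA)) add0r [RHS]big_nat_rev.
have term l : (1 <= l < k.+1)%N -> l%:R *:
    A l (recast l (odot (id : Sym l.-1 -> Sym l.-1) (b (k - l).+1)
                        (recast (l.-1 + (k - l).+1) (pw k x)))) =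
    pext A ((k - (1 + k.+1 - l.+1)).+1%:R *:
      pwmul (k - (1 + k.+1 - l.+1)) x (b (1 + k.+1 - l.+1)%N (pw (1 + k.+1 - l.+1) x))).
  move=> /andP[l1 lk].
  have -> : (1 + k.+1 - l.+1)%N = (k - l).+1 by lia.
  have -> : (k - (k - l).+1)%N = l.-1 by lia.
  rewrite prednK // (linZ (pext_lin lA)); congr (_ *: _).
  rewrite -(pext_mono lA) mono_recast; last by lia.
  by rewrite mono_odot_vector //; lia.
case: i i1 A bA lA term => [|[|//]] _ A bA lA term; last first.
  by apply: eq_big_nat => l /term ->.
by rewrite [LHS]big_ltn // scale0r add0r; apply: eq_big_nat => l /term ->.
Qed.

Lemma ser_deriv_bdd_op i (A : fseries i) : all_bdd_op A -> all_bdd_op (ser_deriv b A).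
Proof.
move=> bA k; rewrite /ser_deriv.
have E : (fun f : Sym k => \sum_(i <= l < k.+1) l%:R *:
    A l (recast l (odot (id : Sym l.-1 -> Sym l.-1) (b (k - l).+1)
                        (recast (l.-1 + (k - l).+1) f)))) =
  (fun f : Sym k => \sum_(l <- index_iota i k.+1 | (i <= l < k.+1)%N) l%:R *:
    A l (recast l (odot (id : Sym l.-1 -> Sym l.-1) (b (k - l).+1)
                        (recast (l.-1 + (k - l).+1) f)))).
  by apply/funext => f; rewrite big_nat.
rewrite E; apply: sym_bdd_op_sum => l /andP[il lk]; apply: sym_bdd_opZ.
case: l il lk => [|l] il lk.
  have -> : (fun f : Sym k => A 0%N (recast 0 (odot (id : Sym 0.-1 -> Sym 0.-1) (b (k - 0).+1)
      (recast (0.-1 + (k - 0).+1) f)))) = fun f : Sym k => 0.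
    apply/funext => f; rewrite [X in A 0%N X](_ : _ = 0).
      by rewrite (lin0 (@all_bdd_op_lin _ _ bA 0)).
    by rewrite /recast; case: eqP => // e; exfalso; move: e; rewrite /= addn1.
  exact: sym_bdd_op0.
apply: (@bdd_op_comp _ _ _ _ (fun f : Sym k => recast l.+1 (odot (id : Sym l -> Sym l) (b (k - l.+1).+1)
   (recast (l + (k - l.+1).+1) f)))); last exact: bA.
apply: recast_bdd_op; first by rewrite addn1.
apply: bdd_op_recast; first by lia.
exact: odot_id_bdd_op.
Qed.

Lemma deriv_along_sval a : all_bdd_op a -> deriv_along b (genfun (sval a)) (genfun (sval (ser_deriv b a))).
Proof.
move=> ba; have -> : genfun (sval (ser_deriv b a)) = genfun (sval a \o NM_nabla b).
  apply/funext => x; apply/funext => n; rewrite /genfun /sval /= pext_mono; last first.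
    exact/all_bdd_op_lin/ser_deriv_bdd_op.
  by rewrite ser_deriv_pw.
by apply: deriv_along_genfun => //; exact: sval_linf.
Qed.

Lemma deriv_along_vval omega c : all_bdd_op c ->
  deriv_along b (genfun (vval omega c)) (genfun (vval omega (ser_deriv b c))).
Proof.
move=> ba; have -> : genfun (vval omega (ser_deriv b c)) = genfun (vval omega c \o NM_nabla b).
  apply/funext => x; apply/funext => n; rewrite /genfun /vval /= pext_mono; last first.
    exact/all_bdd_op_lin/ser_deriv_bdd_op.
  by rewrite ser_deriv_pw.
by apply: deriv_along_genfun => //; exact: vval_linf.
Qed.

Lemma deriv_along_ser_xi omega : deriv_along b (genfun (vval omega ser_xi)) (genfun (vval omega b)).
Proof.
have -> : genfun (vval omega b) = genfun (vval omega ser_xi \o NM_nabla b).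
  apply/funext => x; apply/funext => n; rewrite /genfun /vval /= pext_mono; last exact: all_bdd_op_lin.
  rewrite -ser_deriv_pw //; last exact: ser_xi_bdd_op.
  congr (pairing omega _ : C); apply: pairing_sep => om.
  rewrite /ser_deriv; have [n0|n0] := posnP n.
    by subst n; rewrite big_geq // b0.
  rewrite big_ltn ?ltnS // [X in _ + X]big_nat_cond [X in _ + X]big1 ?addr0; last first.
    by move=> [|[|l]] // _; rewrite scaler0.
  rewrite scale1r -[LHS]peval_mono -[RHS]/(peval (mono (recast 1 _)) om : C) mono_recast //.
  rewrite mono_odot_vector //; last by lia.
  by rewrite peval_pwmul expr0 mul1r (_ : (n - 1).+1 = n) //; lia.
apply: deriv_along_genfun => //; exact/vval_linf/ser_xi_bdd_op.
Qed.

(** Since genfun (ev_at omega) is the inverse of 1 - omega, its derivative is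
    determined by the Leibniz rule. *)
Lemma genfun_ev_at_NM omega x : genfun (ev_at omega \o NM_nabla b) x =
  genfun (ev_at omega) x * genfun (ev_at omega) x * genfun (vval omega b) x.
Proof.
set g := genfun (ev_at omega); set h := genfun (vval omega ser_xi).
have Dg : deriv_along b g (genfun (ev_at omega \o NM_nabla b)).
  by apply: deriv_along_genfun => //; exact: ev_at_linf.
have Dgh := deriv_along_mul Dg (deriv_along_ser_xi omega).
have e : deriv_along b g (fun x => genfun (ev_at omega \o NM_nabla b) x * h x + g x * genfun (vval omega b) x).
  have := deriv_along_add (deriv_along_one b) Dgh.
  set u := (fun _ => 1 + _); have -> : u = g.
    apply/funext => y; rewrite /u -(genfun_ev_at omega y) -/g -/h; ring.
  by under [X in deriv_along _ _ X]eq_fun do rewrite add0r.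
have /(congr1 (fun f => f x)) E := deriv_along_unique Dg e.
set g' := genfun (ev_at omega \o NM_nabla b) x in E *.
have E2 : g' * (1 - h x) = g x * genfun (vval omega b) x.
  rewrite mulrBr mulr1 {1}E addrC addKr //.
rewrite -[g']mulr1 -(genfun_ev_at omega x) -/g -/h mulrCA E2; ring.
Qed.
End Along.

Lemma triang_sub (S T : polyfun -> polyfun) : triang S -> triang T -> triang (S - T).
Proof.
move=> tS tT; have := triangD (-1) tT tS.
by rewrite (_ : (fun _ => _) = S - T) //; apply/funext => p; rewrite scaleN1r addrC.
Qed.

Lemma triang_add (S T : polyfun -> polyfun) : triang S -> triang T -> triang (S + T).
Proof.
move=> tS tT; have := triangD 1 tS tT.
by rewrite (_ : (fun _ => _) = S + T) //; apply/funext => p; rewrite scale1r.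
Qed.

Definition first_order (a : fseries 0) (b : fseries 1) : polyfun -> polyfun :=
  nabla a + NM_nabla b.

Definition lie_pair (a : fseries 0) (b : fseries 1) : Prop :=
  [/\ all_bdd_op a, all_bdd_op b, a 0%N = 0, b 0%N = 0 & b 1%N = 0].

Lemma lie_pairP w : inW w -> lie_pair w.1 w.2.
Proof. by move=> [c1 c2 ? ? ?]; split=> // k; apply/bdd_op_contlin. Qed.

Lemma first_order_striang a b : lie_pair a b -> striang (first_order a b : polyfun -> polyfun).
Proof.
move=> [ba bb _ _ _]; have [ta sa] := nabla_striang ba; have [tb sb] := NM_nabla_striang bb.
split; first exact: triang_add.
by move=> i k f ki; rewrite /first_order fct_add (linD (@pcoef_lin _ _ i)) sa // sb // addr0.
Qed.

Lemma genfun_first_order a b L x : lie_pair a b -> linf L ->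
  genfun (L \o first_order a b) x = genfun (sval a) x * genfun L x + genfun (L \o NM_nabla b) x.
Proof.
move=> [ba bb a0 b0 b1] l; rewrite -genfun_nabla //; apply/funext => n.
by rewrite fpsD /genfun /= /first_order fct_add linfD.
Qed.

(** On the kernel 1 / (1 - omega) the operator nabla a + NM_nabla b acts as the
    differential operator a + D_b in the variable xi. *)
Lemma genfun_ev_at_first_order a b omega x : lie_pair a b ->
  genfun (ev_at omega \o first_order a b) x = genfun (sval a) x * genfun (ev_at omega) x +
    genfun (ev_at omega) x * genfun (ev_at omega) x * genfun (vval omega b) x.
Proof.
move=> w; rewrite genfun_first_order //; case: w => ba bb a0 b0 b1.
by rewrite genfun_ev_at_NM.
Qed.

(** By genfun_first_order for the functional ev_at omega \o first_order a1 b1,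
    whose generating function is known, so that D_{b2} of it can be computed. *)
Lemma genfun_ev_at_comp a1 b1 a2 b2 omega x : lie_pair a1 b1 -> lie_pair a2 b2 ->
  let g := genfun (ev_at omega) x in
  genfun (ev_at omega \o first_order a1 b1 \o first_order a2 b2) x =
  genfun (sval a2) x * (genfun (sval a1) x * g + g * g * genfun (vval omega b1) x) +
  (genfun (sval (ser_deriv b2 a1)) x * g + genfun (sval a1) x * (g * g * genfun (vval omega b2) x) +
   ((g * g * genfun (vval omega b2) x * g + g * (g * g * genfun (vval omega b2) x)) *
      genfun (vval omega b1) x + g * g * genfun (vval omega (ser_deriv b2 b1)) x)).
Proof.
move=> w1 w2 g; have lT : linf (ev_at omega \o first_order a1 b1).
  by apply: linf_comp => //; case: (first_order_striang w1) => -[].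
rewrite genfun_first_order // genfun_ev_at_first_order //; congr (_ + _).
case: (w1) (w2) => ba1 bb1 a10 b10 b11 [ba2 bb2 a20 b20 b21].
have D1 := deriv_along_genfun bb2 b20 b21 lT.
have Dg : deriv_along b2 (genfun (ev_at omega)) (fun x => genfun (ev_at omega) x * genfun (ev_at omega) x * genfun (vval omega b2) x).
  have := deriv_along_genfun bb2 b20 b21 (@ev_at_linf omega).
  rewrite (_ : genfun (ev_at omega \o NM_nabla b2) = fun x =>
    genfun (ev_at omega) x * genfun (ev_at omega) x * genfun (vval omega b2) x) //.
  by apply/funext => y; rewrite genfun_ev_at_NM.
have D2 := deriv_along_add (deriv_along_mul (deriv_along_sval bb2 b20 b21 ba1) Dg)
  (deriv_along_mul (deriv_along_mul Dg Dg) (deriv_along_vval bb2 b20 b21 omega bb1)).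
rewrite -[X in deriv_along _ X _](_ : genfun (ev_at omega \o first_order a1 b1) = _) in D2; last first.
  by apply/funext => y; rewrite genfun_ev_at_first_order.
by rewrite (deriv_along_unique D1 D2).
Qed.

(** Evaluations separate polynomials, and powers are weakly dense. *)
Lemma triang_ext (S T : polyfun -> polyfun) : triang S -> triang T ->
  (forall omega x, genfun (ev_at omega \o S) x = genfun (ev_at omega \o T) x) -> S = T.
Proof.
move=> tS tT h; have [lS _ bS] := tS; have [lT _ bT] := tT.
apply: poly_lin_ext => // n f; rewrite (triang_mono f tS) (triang_mono f tT).
apply: eq_bigr => i _; congr mono.
have := bdd_op_eq (bS i n) (bT i n) => e.
apply: (congr1 (fun F => F f) (e _)) => x.
suff -> : S (mono (pw n x)) = T (mono (pw n x)) by [].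
by apply: peval_inj => omega; have := congr1 (fun f => f n) (h omega x).
Qed.

Lemma ser_deriv_low (b : fseries 1) i (A : fseries i) k : all_bdd_op b -> all_bdd_op A ->
  b 0%N = 0 -> b 1%N = 0 -> (i <= 1)%N -> (k <= 1)%N -> @ser_deriv R Phi i b A k = 0.
Proof.
move=> bb bA b0 b1 i1 k1; apply: bdd_op_eq; first exact: ser_deriv_bdd_op.
  exact: sym_bdd_op0.
move=> x; rewrite ser_deriv_pw // NM_nabla_mono // big1 ?(lin0 (pext_lin (all_bdd_op_lin bA))) //.
by move=> j j2; have := ltn_ord j; lia.
Qed.

(** In the two products the terms without derivatives of the series are
    symmetric in the two pairs, so only those with D_{b2} and D_{b1} survive. *)
Theorem first_order_comm a1 b1 a2 b2 : lie_pair a1 b1 -> lie_pair a2 b2 ->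
  op_comm (first_order a1 b1) (first_order a2 b2) =
  nabla (ser_deriv b2 a1) - nabla (ser_deriv b1 a2) +
    NM_nabla (ser_sub (ser_deriv b2 b1) (ser_deriv b1 b2)).
Proof.
move=> w1 w2; have [t1 _] := first_order_striang w1; have [t2 _] := first_order_striang w2.
case: (w1) (w2) => ba1 bb1 a10 b10 b11 [ba2 bb2 a20 b20 b21].
have bd21 := ser_deriv_bdd_op bb2 ba1; have bd12 := ser_deriv_bdd_op bb1 ba2.
have be21 := ser_deriv_bdd_op bb2 bb1; have be12 := ser_deriv_bdd_op bb1 bb2.
set c := ser_sub _ _.
have bc : all_bdd_op c.
  move=> k; have := sym_bdd_opD (-1) (be12 k) (be21 k).
  rewrite (_ : (fun _ => _) = c k) //; apply/funext => f.
  by rewrite scaleN1r addrC.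
have low b i (A : fseries i) := @ser_deriv_low b i A _.
have c_low k : (k <= 1)%N -> c k = 0.
  by move=> k1; rewrite /c /ser_sub !low // subrr.
apply: triang_ext.
- exact: triang_sub (triang_comp t1 t2) (triang_comp t2 t1).
- apply: triang_add (NM_nabla_striang bc).1.
  exact: triang_sub (nabla_striang bd21).1 (nabla_striang bd12).1.
move=> omega x.
have E : genfun (ev_at omega \o op_comm (first_order a1 b1) (first_order a2 b2)) x =
    genfun (ev_at omega \o first_order a1 b1 \o first_order a2 b2) x -
    genfun (ev_at omega \o first_order a2 b2 \o first_order a1 b1) x by [].
have F : genfun (ev_at omega \o (nabla (ser_deriv b2 a1) - nabla (ser_deriv b1 a2) + NM_nabla c)) x =
    genfun (ev_at omega \o nabla (ser_deriv b2 a1)) x - genfun (ev_at omega \o nabla (ser_deriv b1 a2)) x +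
    genfun (ev_at omega \o NM_nabla c) x by [].
have h21 : genfun (ev_at omega \o nabla (ser_deriv b2 a1)) x =
    genfun (sval (ser_deriv b2 a1)) x * genfun (ev_at omega) x.
  exact: (genfun_nabla x bd21 (@ser_deriv_low b2 0 a1 0 bb2 ba1 b20 b21 isT isT) (@ev_at_linf omega)).
have h12 : genfun (ev_at omega \o nabla (ser_deriv b1 a2)) x =
    genfun (sval (ser_deriv b1 a2)) x * genfun (ev_at omega) x.
  exact: (genfun_nabla x bd12 (@ser_deriv_low b1 0 a2 0 bb1 ba2 b10 b11 isT isT) (@ev_at_linf omega)).
have hc := genfun_ev_at_NM bc (c_low 0%N isT) (c_low 1%N isT) omega x.
rewrite E F h21 h12 hc (genfun_ev_at_comp omega x w1 w2) (genfun_ev_at_comp omega x w2 w1).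
have -> : genfun (vval omega c) x = genfun (vval omega (ser_deriv b2 b1)) x - genfun (vval omega (ser_deriv b1 b2)) x.
  apply/funext => n; rewrite fpsD fpsN /genfun /vval (pext_mono (all_bdd_op_lin bc)).
  by rewrite (pext_mono (all_bdd_op_lin be21)) (pext_mono (all_bdd_op_lin be12)).
ring.
Qed.

End Derivations.

(** * Products of series *)

Section Riordan.
Variables (R : realType) (Phi : LBspace R).
Local Notation C := R[i].
Local Notation Sym k := (SymPow Phi k).
Local Notation polyfun := (polyfun Phi).
Local Notation fseries := (fseries Phi).

Lemma bdd_form_scal_bdd_op k (L : Sym k -> C) : bdd_form L -> bdd_op (fun f => scal Phi (L f)).
Proof.
move=> [lL hL]; split; first by move=> a x y; rewrite lL scal_lin.
move=> n; have [c c0 h] := hL n; exists 0%N, (c + 1); split; first by rewrite ltr_wpDl.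
move=> x xn; have step0 : sym_stp 0 (subval (scal Phi (L x))).
  exists (subval (scal Phi (L x))); last exact: symz_subval.
  apply: elem_span_tens; exists [:: (L x, fun=> 0)]; rewrite big_seq1.
  apply/funext => phi; apply: esym; rewrite /elem.
  by apply: etrans (mulr1 (L x)); congr (_ * _); exact: big_ord0.
split=> // e e0 xe phi r r0 rP; rewrite big_ord0 mulr1 /=.
apply: le_trans (h x e xn e0 xe) _; rewrite mulrDl mul1r lerDl //.
Qed.

Lemma ser_dual_bdd_op omega (B : fseries 1) : all_bdd_op B -> all_bdd_op (ser_dual omega B).
Proof.
move=> bB k; apply: bdd_form_scal_bdd_op; exact: (bdd_form_comp (bB k) (pairing_bdd_form omega 1)).
Qed.

Lemma ser_one_bdd_op : all_bdd_op (@ser_one R Phi).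
Proof. by move=> [|k]; [exact: bdd_op_id|exact: sym_bdd_op0]. Qed.

Lemma ser_prod_bdd_op (A1 A2 : fseries 0) : all_bdd_op A1 -> all_bdd_op A2 -> all_bdd_op (ser_prod A1 A2).
Proof.
move=> b1 b2 k; apply: sym_bdd_op_sum => l _.
apply: (@bdd_op_recast _ _ _ _ _ (odot (A1 l) (A2 (k - l)%N))).
  by have := ltn_ord l; lia.
by apply: odot_bdd_op.
Qed.

Lemma ser_pow_bdd_op (A : fseries 0) j : all_bdd_op A -> all_bdd_op (ser_pow A j).
Proof.
by move=> bA; elim: j => [|j IH]; [exact: ser_one_bdd_op|exact: ser_prod_bdd_op].
Qed.

Lemma ser_geom_bdd_op (A : fseries 0) : all_bdd_op A -> all_bdd_op (ser_geom A).
Proof. by move=> bA k; apply: sym_bdd_op_sum => j _; exact: ser_pow_bdd_op. Qed.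

Lemma genfun_sval (A : fseries 0) x n : all_bdd_op A -> genfun (sval A) x n = sc (A n (pw n x)).
Proof. by move=> bA; rewrite /genfun /sval (pext_mono (all_bdd_op_lin bA)). Qed.

Lemma genfun_vval omega (B : fseries 1) x n : all_bdd_op B ->
  genfun (vval omega B) x n = pairing omega (B n (pw n x)).
Proof. by move=> bB; rewrite /genfun /vval (pext_mono (all_bdd_op_lin bB)). Qed.

Lemma sc_sum (I : Type) (r : seq I) (P : pred I) (F : I -> Sym 0) :
  sc (\sum_(i <- r | P i) F i) = \sum_(i <- r | P i) sc (F i).
Proof. exact: pairing_sum. Qed.

Lemma genfun_ser_prod (A1 A2 : fseries 0) x : all_bdd_op A1 -> all_bdd_op A2 ->
  genfun (sval (ser_prod A1 A2)) x = genfun (sval A1) x * genfun (sval A2) x.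
Proof.
move=> b1 b2; apply/funext => n; rewrite genfun_sval; last exact: ser_prod_bdd_op.
rewrite /ser_prod sc_sum fpsM; apply: eq_bigr => l _.
rewrite recast_pw; last by have := ltn_ord l; lia.
by rewrite (genfun_sval _ _ b1) (genfun_sval _ _ b2); exact: (pairing_odot_pw _ _ (b1 _) (b2 _)).
Qed.

Lemma genfun_ser_one x : genfun (sval (@ser_one R Phi)) x = 1.
Proof.
apply/funext => -[|n]; rewrite genfun_sval ?fps1 //; try exact: ser_one_bdd_op.
by rewrite -[ser_one _]/(pw 0 x) /sc pairing_pw expr0.
Qed.

Lemma genfun_ser_pow (A : fseries 0) j x : all_bdd_op A ->
  genfun (sval (ser_pow A j)) x = genfun (sval A) x ^+ j.
Proof.
move=> bA; elim: j => [|j IH]; first exact: genfun_ser_one.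
by rewrite exprS -IH -genfun_ser_prod //; exact: ser_pow_bdd_op.
Qed.

Lemma genfun_ser_dual omega (B : fseries 1) x : all_bdd_op B ->
  genfun (sval (ser_dual omega B)) x = genfun (vval omega B) x.
Proof.
move=> bB; apply/funext => n; rewrite genfun_sval; last exact: ser_dual_bdd_op.
by rewrite genfun_vval.
Qed.

Lemma genfun_ser_geom (A : fseries 0) x n : all_bdd_op A ->
  genfun (sval (ser_geom A)) x n = \sum_(j < n.+1) (genfun (sval A) x ^+ j) n.
Proof.
move=> bA; rewrite genfun_sval; last exact: ser_geom_bdd_op.
rewrite /ser_geom sc_sum; apply: eq_bigr => j _.
by rewrite -genfun_ser_pow // genfun_sval //; exact: ser_pow_bdd_op.
Qed.

(** * Composition of series *)

Lemma odot_seq_bdd_op (B : fseries 1) s : all_bdd_op B -> bdd_op (@odot_seq R Phi B s).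
Proof.
by move=> bB; elim: s => [|i s IH]; [exact: bdd_op_id|exact: (odot_bdd_op (bB i) IH)].
Qed.

Lemma pairing_odot_seq omega (B : fseries 1) s x : all_bdd_op B ->
  pairing omega (odot_seq B (pw (sumn s) x)) =
  \prod_(i <- s) (pairing omega (B i (pw i x)) : C) :> C.
Proof.
move=> bB; elim: s => [|i s IH]; first by rewrite big_nil pairing_pw expr0.
by rewrite big_cons -IH; exact: (pairing_odot_pw _ _ (bB i) (odot_seq_bdd_op s bB)).
Qed.

(** The coefficient of degree k of B(xi)^{(x)i}. *)
Definition comp_block (B : fseries 1) i k (f : Sym k) : Sym i :=
  \sum_(s : i.-tuple 'I_k.+1 | is_composition s)
    recast i (odot_seq B (recast (sumn (map val s)) f)).

Lemma comp_block_bdd_op B i k : all_bdd_op B -> bdd_op (@comp_block B i k).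
Proof.
move=> bB; apply: sym_bdd_op_sum => s /andP[_ /eqP sk].
apply: (@recast_bdd_op _ _ _ _ _ (fun f => odot_seq B (recast (sumn (map val s)) f))).
  by rewrite size_map size_tuple.
by apply: bdd_op_recast => //; exact: odot_seq_bdd_op.
Qed.

Lemma pairing_recast omega m n (f : Sym m) : m = n -> pairing omega (recast n f) = pairing omega f.
Proof. by move=> e; subst n; rewrite recast_id. Qed.

Lemma pairing_comp_block omega (B : fseries 1) i k x : all_bdd_op B -> B 0%N = 0 ->
  pairing omega (comp_block B i (pw k x)) = (genfun (vval omega B) x ^+ i) k :> C.
Proof.
move=> bB B0; rewrite fps_exp_compositions; last by rewrite genfun_vval // B0 pairing0.
rewrite /comp_block pairing_sum; apply: eq_bigr => s /andP[_ /eqP sk].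
rewrite pairing_recast; last by rewrite size_map size_tuple.
rewrite recast_pw // pairing_odot_seq //.
by apply: eq_bigr => j _; rewrite genfun_vval.
Qed.

Lemma ser_comp_sum i (A : fseries i) (B : fseries 1) k x : all_bdd_op A -> all_bdd_op B -> B 0%N = 0 ->
  ser_comp A B (pw k x) = \sum_(l < k.+1) A l (comp_block B l (pw k x)).
Proof.
move=> bA bB B0; case: k => [|k] /=.
  rewrite big_ord1; congr (A 0%N _); apply: pairing_sep => omega.
  by rewrite pairing_comp_block // pairing_pw !expr0.
rewrite -(big_mkord xpredT (fun l => A l (comp_block B l (pw k.+1 x)))) [RHS]big_ltn //.
suff -> : comp_block B 0 (pw k.+1 x) = 0 by rewrite (lin0 (@all_bdd_op_lin _ _ _ _ bA 0)) add0r.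
by apply: pairing_sep => omega; rewrite pairing_comp_block // expr0 pairing0.
Qed.

Lemma ser_comp_bdd_op i (A : fseries i) (B : fseries 1) : all_bdd_op A -> all_bdd_op B -> all_bdd_op (ser_comp A B).
Proof.
move=> bA bB [|k]; first exact: bA.
apply: sym_bdd_op_sum => l _; exact: (bdd_op_comp (comp_block_bdd_op l k.+1 bB) (bA l)).
Qed.

(** * Riordan operators *)

(** The coefficient of degree k of A(xi) B(xi)^{(x)i}, which is the factor of
    omega^{(x)i} in A(xi) / (1 - <omega, B(xi)>). *)
Definition riordan_block (A : fseries 0) (B : fseries 1) i k (f : Sym k) : Sym i :=
  \sum_(l < k.+1) odot (A l) (comp_block B i (k := k - l)) (recast (l + (k - l)) f).

Definition riordan_op (A : fseries 0) (B : fseries 1) : polyfun -> polyfun :=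
  pext (fun k f => \sum_(i < k.+1) mono (riordan_block A B i f)).

Section RiordanOperator.
Unset Implicit Arguments.
Variables (A : fseries 0) (B : fseries 1).
Set Implicit Arguments.
Hypotheses (bA : all_bdd_op A) (bB : all_bdd_op B) (B0 : B 0%N = 0).

Lemma riordan_block_bdd_op i k : bdd_op (@riordan_block A B i k).
Proof.
apply: sym_bdd_op_sum => l _.
apply: (@bdd_op_recast _ _ _ _ _ (odot (A l) (comp_block B i (k := k - l)))).
  by have := ltn_ord l; lia.
by apply: odot_bdd_op => //; exact: comp_block_bdd_op.
Qed.

Lemma riordan_op_mono k (f : Sym k) : riordan_op A B (mono f) = \sum_(i < k.+1) mono (riordan_block A B i f).
Proof.
rewrite /riordan_op pext_mono // => n u x y.
rewrite scaler_sumr -big_split; apply: eq_bigr => i _.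
by rewrite (riordan_block_bdd_op i n).1 mono_lin.
Qed.

Lemma riordan_op_lin : linear (riordan_op A B).
Proof.
apply: pext_lin => n u x y.
rewrite scaler_sumr -big_split; apply: eq_bigr => i _.
by rewrite (riordan_block_bdd_op i n).1 mono_lin.
Qed.

Lemma pcoef_riordan_op i k (f : Sym k) : (i <= k)%N -> pcoef i (riordan_op A B (mono f)) = riordan_block A B i f.
Proof.
move=> ik; rewrite riordan_op_mono.
rewrite (@pcoef_unique _ _ _ (fun j => if (j <= k)%N then riordan_block A B j f else 0) k) ?ik //.
  by move=> j kj; rewrite leqNgt kj.
by apply: eq_bigr => j _; rewrite -ltnS ltn_ord.
Qed.

Lemma riordan_op_triang : triang (riordan_op A B).
Proof.
have z i k (f : Sym k) : (k < i)%N -> pcoef i (riordan_op A B (mono f)) = 0.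
  move=> ki; rewrite riordan_op_mono (lin_sum (@pcoef_lin _ _ i)) big1 // => j _.
  by rewrite pcoef_mono_neq //; have := ltn_ord j; lia.
split; [exact: riordan_op_lin|exact: z|].
move=> i k; have [ik|ki] := leqP i k.
  by under eq_fun do rewrite pcoef_riordan_op //; exact: riordan_block_bdd_op.
by under eq_fun do rewrite z //; exact: sym_bdd_op0.
Qed.

Lemma riordan_block_pw i k x : riordan_block A B i (pw k x) =
  \sum_(l < k.+1) sc (A l (pw l x)) *: comp_block B i (pw (k - l) x).
Proof.
apply: eq_bigr => l _; rewrite recast_pw; last by have := ltn_ord l; lia.
apply: pairing_sep => omega.
rewrite pairingZ -(pairing_sc omega).
exact: (pairing_odot_pw _ _ (bA _) (comp_block_bdd_op i _ bB)).
Qed.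

Lemma pairing_riordan_block omega i k x : pairing omega (riordan_block A B i (pw k x)) =
  (genfun (sval A) x * genfun (vval omega B) x ^+ i) k :> C.
Proof.
rewrite riordan_block_pw pairing_sum fpsM; apply: eq_bigr => l _.
by rewrite pairingZ pairing_comp_block // genfun_sval.
Qed.

Lemma riordan_op_genfun : riordan_genfun (riordan_op A B) (A, B).
Proof.
move=> omega k f /=.
have bg := ser_geom_bdd_op (ser_dual_bdd_op omega bB).
have bs := ser_prod_bdd_op bA bg k.
have E (g : Sym k) : peval (riordan_op A B (mono g)) omega = \sum_(i < k.+1) (pairing omega (riordan_block A B i g) : C) :> C.
  by rewrite riordan_op_mono peval_sum.
have b1 : bdd_form (fun g : Sym k => peval (riordan_op A B (mono g)) omega : C).
  under eq_fun do rewrite E; apply: bdd_form_sum => i _.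
  exact: (bdd_form_comp (riordan_block_bdd_op i k) (pairing_bdd_form omega i)).
apply: (sym_dense_eq b1 (bdd_form_comp bs (pairing_bdd_form omega 0))) => x.
rewrite /= E pairing_sc -genfun_sval; last exact: ser_prod_bdd_op.
rewrite genfun_ser_prod // fpsM.
have h0 : genfun (vval omega B) x 0%N = 0 by rewrite genfun_vval // B0 pairing0.
transitivity (\sum_(l < k.+1) \sum_(i < k.+1) genfun (sval A) x l * (genfun (vval omega B) x ^+ i) (k - l)%N).
  rewrite exchange_big; apply: eq_bigr => i _; rewrite pairing_riordan_block fpsM //.
apply: eq_bigr => l _; rewrite -mulr_sumr; congr (_ * _).
rewrite genfun_ser_geom ?genfun_ser_dual //; last exact: ser_dual_bdd_op.
apply: (big_ord_cut (F := fun j => (genfun (vval omega B) x ^+ j) (k - l)%N)) => [|i il].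
  by lia.
by rewrite fps_exp_low.
Qed.

(** Applying the coefficients of D to the Riordan operator of (A, B) yields
    A(xi) D(B(xi)). This turns products of operators into products in S. *)
Lemma pext_riordan_op i (D : fseries i) k x : all_bdd_op D ->
  pext D (riordan_op A B (mono (pw k x))) =
  \sum_(l < k.+1) sc (A l (pw l x)) *: ser_comp D B (pw (k - l) x).
Proof.
move=> bD; have lD := all_bdd_op_lin bD.
rewrite riordan_op_mono (lin_sum (pext_lin lD)).
under eq_bigr do rewrite (pext_mono lD) riordan_block_pw (lin_sum (@lD _)).
rewrite exchange_big; apply: eq_bigr => l _; rewrite ser_comp_sum // scaler_sumr.
under eq_bigr do rewrite (linZ (@lD _)).
apply: (big_ord_cut (F := fun j => sc (A l (pw l x)) *: D j (comp_block B j (pw (k - l) x)))) => [|j lj].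
  by lia.
suff -> : comp_block B j (pw (k - l) x) = 0 by rewrite (lin0 (@lD _)) scaler0.
apply: pairing_sep => omega; rewrite pairing_comp_block // fps_exp_low ?pairing0 //.
by rewrite genfun_vval // B0 pairing0.
Qed.

End RiordanOperator.

Lemma inSP (s : fseries 0 * fseries 1) : inS s -> [/\ all_bdd_op s.1, all_bdd_op s.2, s.1 0%N = id, s.2 0%N = 0 & s.2 1%N = id].
Proof. by move=> [c1 c2 ? ? ?]; split=> // k; apply/bdd_op_contlin. Qed.

Lemma riordan_block_diag (A : fseries 0) (B : fseries 1) k : all_bdd_op A -> all_bdd_op B -> A 0%N = id -> B 0%N = 0 -> B 1%N = id ->
  @riordan_block A B k k = id.
Proof.
move=> bA bB A0 B0 B1; apply: bdd_op_eq; [exact: riordan_block_bdd_op|exact: bdd_op_id|move=> x].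
apply: pairing_sep => omega; rewrite pairing_riordan_block // fpsM big_ord_recl subn0.
have h0 : genfun (vval omega B) x 0%N = 0 by rewrite genfun_vval // B0 pairing0.
rewrite big1 ?addr0; last first.
  by move=> i _; rewrite fps_exp_low ?mulr0 // lift0; have := ltn_ord i; lia.
rewrite fps_exp_diag // genfun_sval // A0 genfun_vval // B1 /sc !pairing_pw.
by rewrite expr0 expr1 mul1r.
Qed.

Lemma riordan_op_riordan (s : fseries 0 * fseries 1) : inS s -> riordan (riordan_op s.1 s.2) /\ riordan_genfun (riordan_op s.1 s.2) s.
Proof.
move=> hs; have [bA bB A0 B0 B1] := inSP hs.
have gf : riordan_genfun (riordan_op s.1 s.2) s by case: s {hs} bA bB A0 B0 B1 => a b *; exact: riordan_op_genfun.
split=> //; split; last by exists s.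
have tr := riordan_op_triang bA bB; have [lr zr br] := tr.
exists (fun i k => if (i <= k)%N then @riordan_block s.1 s.2 i k else 0); last first.
  by move=> k; rewrite leqnn riordan_block_diag.
split.
- exact: triang_contlin.
- move=> i k; case: ifP => _; apply/bdd_op_contlin; [exact: riordan_block_bdd_op|exact: sym_bdd_op0].
- by move=> i k ki; rewrite leqNgt ki.
- move=> k f; rewrite riordan_op_mono //; apply: eq_bigr => i _.
  by rewrite -ltnS ltn_ord.
Qed.

Theorem Itilde_riordan (s : fseries 0 * fseries 1) : inS s -> riordan (Itilde s) /\ riordan_genfun (Itilde s) s.
Proof.
move=> hs; apply: (@theP _ 0 [set P | riordan P /\ riordan_genfun P s] (riordan_op s.1 s.2)).
exact: riordan_op_riordan.
Qed.

(** A Riordan operator is determined by its generating function. *)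
Lemma Itilde_riordan_op (s : fseries 0 * fseries 1) : inS s -> Itilde s = riordan_op s.1 s.2.
Proof.
move=> hs; have [[[b [cI _ _ _] _] _] gI] := Itilde_riordan hs.
have [[[b' [cR _ _ _] _] _] gR] := riordan_op_riordan hs.
apply: poly_lin_ext; [exact: cI.1|exact: cR.1|move=> n f].
by apply: peval_inj => omega; rewrite gI gR.
Qed.

End Riordan.

(** * Exponentials of strictly triangular operators *)

Lemma pascal_sum (V : nmodType) (f : nat -> nat -> V) n :
  \sum_(i < n.+1) (f i.+1 (n - i)%N + f i (n - i).+1) *+ 'C(n, i) =
  \sum_(i < n.+2) f i (n.+1 - i)%N *+ 'C(n.+1, i).
Proof.
pose h i := f i (n.+1 - i)%N *+ 'C(n, i).
have hE : \sum_(i < n.+1) f i (n - i).+1 *+ 'C(n, i) = \sum_(i < n.+2) h i.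
  rewrite [RHS]big_ord_recr /= [h n.+1]/h bin_small // mulr0n addr0.
  by apply: eq_bigr => i _; rewrite /h subSn // -ltnS.
under eq_bigr do rewrite mulrnDl.
rewrite big_split /= hE [X in _ + X]big_ord_recl [RHS]big_ord_recl /h /= !bin0 addrCA; congr (_ + _).
rewrite -big_split; apply: eq_bigr => i _.
by rewrite /bump /= !add1n subSS binS mulrnDr addrC.
Qed.

Section Exponential.
Variables (R : realType) (Phi : LBspace R).
Local Notation C := R[i].
Local Notation Sym k := (SymPow Phi k).
Local Notation polyfun := (polyfun Phi).
Local Notation fseries := (fseries Phi).
Local Notation X := (Sym 1).
Local Notation fpsC := (fps R[i]).

Section Iterates.
Variable T : polyfun -> polyfun.
Hypothesis sT : striang T.

Let lT : linear T. Proof. by case: sT => -[]. Qed.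

Lemma iter_lin n : linear (iter n T).
Proof. by case: (triang_iter n sT.1). Qed.

Lemma deg_step (p : polyfun) K : (forall k, (K <= k)%N -> pcoef k p = 0) ->
  forall k, (K.-1 <= k)%N -> pcoef k (T p) = 0.
Proof.
move=> pK k Kk; have pK' j : (K < j)%N -> pcoef j p = 0 by move=> ?; apply: pK; lia.
rewrite (pcoef_sum pK') (lin_sum lT) (lin_sum (@pcoef_lin _ _ k)) big1 // => j _.
have [jK|Kj] := ltnP j K; first by rewrite sT.2 //; lia.
by rewrite (pK _ Kj) (lin0 (@mono_lin _ _ _)) (lin0 lT) (lin0 (@pcoef_lin _ _ k)).
Qed.

Lemma iter_deg n k (f : Sym k) i : (k < i + n)%N -> pcoef i (iter n T (mono f)) = 0.
Proof.
have h m : forall j, (k.+1 - m <= j)%N -> pcoef j (iter m T (mono f)) = 0.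
  elim: m => [|m IH] j hj; first by rewrite mono_deg //; lia.
  by rewrite iterS; apply: deg_step IH _ _; lia.
by move=> ki; apply: h; lia.
Qed.

Lemma iter_nilp n k (f : Sym k) : (k < n)%N -> iter n T (mono f) = 0.
Proof.
move=> kn; rewrite [LHS](@pcoef_sum _ _ _ 0%N) => [|i _].
  by rewrite big_ord1 iter_deg // (lin0 (@mono_lin _ _ _)).
by apply: iter_deg; lia.
Qed.

Definition exp_coef (t : C) n : C := t ^+ n / n`!%:R.

(** exp(tT); the sum stops at n = k since T lowers degrees. *)
Definition exp_op (t : C) : polyfun -> polyfun :=
  pext (fun k f => \sum_(n < k.+1) exp_coef t n *: iter n T (mono f)).

Let lF t k : linear (fun f : Sym k => \sum_(n < k.+1) exp_coef t n *: iter n T (mono f)).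
Proof.
move=> u x y; rewrite scaler_sumr -big_split; apply: eq_bigr => n _ /=.
by rewrite mono_lin iter_lin scalerDr !scalerA mulrC.
Qed.

Lemma exp_op_lin t : linear (exp_op t).
Proof. by apply: pext_lin => k; exact: lF. Qed.

Lemma exp_op_mono t k (f : Sym k) N : (k <= N)%N ->
  exp_op t (mono f) = \sum_(n < N.+1) exp_coef t n *: iter n T (mono f).
Proof.
move=> kN; rewrite /exp_op pext_mono; last by move=> j; exact: lF.
apply/esym/(big_ord_cut (F := fun n => exp_coef t n *: iter n T (mono f))) => // n kn.
by rewrite iter_nilp ?scaler0.
Qed.

Lemma exp_opE t (p : polyfun) K : (forall k, (K < k)%N -> pcoef k p = 0) ->
  exp_op t p = \sum_(n < K.+1) exp_coef t n *: iter n T p.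
Proof.
move=> pK; rewrite [in LHS](pcoef_sum pK) (lin_sum (exp_op_lin t)).
transitivity (\sum_(k < K.+1) \sum_(n < K.+1) exp_coef t n *: iter n T (mono (pcoef k p))).
  by apply: eq_bigr => k _; apply: exp_op_mono; rewrite -ltnS.
rewrite exchange_big; apply: eq_bigr => n _.
by rewrite -scaler_sumr -(lin_sum (iter_lin n)) -pcoef_sum.
Qed.

Lemma exp_op_triang t : triang (exp_op t).
Proof.
have E i k (f : Sym k) : pcoef i (exp_op t (mono f)) =
    \sum_(n < k.+1) exp_coef t n *: pcoef i (iter n T (mono f)).
  rewrite (@exp_op_mono _ k f k) // (lin_sum (@pcoef_lin _ _ i)).
  by apply: eq_bigr => n _; rewrite (linZ (@pcoef_lin _ _ i)).
split; first exact: exp_op_lin.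
  by move=> i k f ki; rewrite E big1 // => n _; rewrite iter_deg ?scaler0 //; lia.
move=> i k; under eq_fun do rewrite E; apply: sym_bdd_op_sum => n _; apply: sym_bdd_opZ.
by case: (triang_iter n sT.1).
Qed.

Lemma exp_coefD s t n : exp_coef (s + t) n = \sum_(i < n.+1) exp_coef s i * exp_coef t (n - i)%N.
Proof.
rewrite /exp_coef addrC exprDn mulr_suml; apply: eq_bigr => i _.
have f0 m : m`!%:R != 0 :> C by rewrite pnatr_eq0 -lt0n fact_gt0.
have ni : (i <= n)%N by rewrite -ltnS.
rewrite -mulr_natr -(bin_fact ni) !natrM; field.
by rewrite !f0 /= pnatr_eq0 -lt0n bin_gt0 ni.
Qed.

Lemma exp_op_add s t p : exp_op s (exp_op t p) = exp_op (s + t) p.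
Proof.
suff h : exp_op s \o exp_op t = exp_op (s + t) by rewrite -h.
apply: poly_lin_ext; [by move=> a x y /=; rewrite !exp_op_lin|exact: exp_op_lin|move=> k f].
have [_ up _] := exp_op_triang t.
rewrite /= (@exp_opE s _ k); last by move=> i ki; exact: up.
rewrite !(@exp_op_mono _ k f k) //.
transitivity (\sum_(i < k.+1) \sum_(j < k.+1) (exp_coef s i * exp_coef t j) *: iter (i + j) T (mono f)).
  apply: eq_bigr => i _; rewrite (lin_sum (iter_lin i)) scaler_sumr.
  by apply: eq_bigr => j _; rewrite (linZ (iter_lin i)) scalerA iterD.
rewrite (sum_antidiag (f := fun i j => (exp_coef s i * exp_coef t j) *: iter (i + j) T (mono f))).
  apply: eq_bigr => n _; rewrite exp_coefD scaler_suml; apply: eq_bigr => i _.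
  by rewrite subnKC // -ltnS.
by move=> i j kij; rewrite iter_nilp ?scaler0.
Qed.

Lemma genfun_exp_op t L x k N : linf L -> (k <= N)%N ->
  genfun (L \o exp_op t) x k = \sum_(n < N.+1) exp_coef t n * genfun (L \o iter n T) x k.
Proof.
move=> l kN; rewrite /genfun /= (exp_op_mono _ _ kN) (linf_sum l).
by apply: eq_bigr => n _; rewrite linfZ.
Qed.

Lemma genfun_iter_low n L x k : linf L -> (k < n)%N -> genfun (L \o iter n T) x k = 0.
Proof. by move=> l kn; rewrite /genfun /= iter_nilp // linf0. Qed.

End Iterates.

Section Leibniz.
Unset Implicit Arguments.
Variables (b : fseries 1).
Set Implicit Arguments.
Hypotheses (bb : all_bdd_op b) (b0 : b 0%N = 0) (b1 : b 1%N = 0).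
Local Notation D := (NM_nabla b).
Variables (T : polyfun -> polyfun) (al : X -> fpsC).
Hypothesis sT : striang T.
Hypothesis hT : forall L x, linf L -> genfun (L \o T) x = al x * genfun L x + genfun (L \o D) x.

Let sD : striang D := NM_nabla_striang bb.

Lemma deriv_along_sum (I : Type) (r : seq I) (m : I -> nat) (c c' : I -> X -> fpsC) :
  (forall i, deriv_along b (c i) (c' i)) ->
  deriv_along b (fun x => \sum_(i <- r) c i x *+ m i) (fun x => \sum_(i <- r) c' i x *+ m i).
Proof.
have nul : deriv_along b (fun=> 0) (fun=> 0).
  exists (fun _ _ => 0); last by apply/funext => x; apply/funext => n; rewrite /dir_sum big1.
  by split=> // x y n; exists 0 => [z|]; rewrite ?horner0 ?coef0.
move=> h; have mul i j : deriv_along b (fun x => c i x *+ j) (fun x => c' i x *+ j).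
  elim: j => [|j IH]; first exact: nul.
  have := deriv_along_add (h i) IH.
  rewrite (_ : (fun x => c i x + _) = fun x => c i x *+ j.+1).
    rewrite (_ : (fun x => c' i x + _) = fun x => c' i x *+ j.+1) //.
    by apply/funext => x; rewrite mulrS.
  by apply/funext => x; rewrite mulrS.
elim: r => [|i r IH].
  rewrite (_ : (fun x => _) = fun=> 0); last by apply/funext => x; rewrite big_nil.
  rewrite [X in deriv_along _ _ X](_ : _ = fun=> 0) //; by apply/funext => x; rewrite big_nil.
have := deriv_along_add (mul i (m i)) IH.
rewrite (_ : (fun x => _ + _) = fun x => \sum_(j <- i :: r) c j x *+ m j).
  rewrite [X in deriv_along _ _ X](_ : _ = fun x => \sum_(j <- i :: r) c' j x *+ m j) //.
  by apply/funext => x; rewrite big_cons.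
by apply/funext => x; rewrite big_cons.
Qed.

(** T acts as multiplication by al plus a derivation, so
    T (C0 E) = (T C0) E + C0 (D E), which is iterated. *)
Lemma leibniz_iter F C0 E : linf F -> linf C0 -> linf E ->
  (forall x, genfun F x = genfun C0 x * genfun E x) -> forall n x,
  genfun (F \o iter n T) x =
  \sum_(i < n.+1) genfun (C0 \o iter i T) x * genfun (E \o iter (n - i) D) x *+ 'C(n, i).
Proof.
move=> lF lC lE FCE; elim=> [|n IH] x; first by rewrite big_ord1 bin0 mulr1n FCE.
have it S L m : genfun (L \o iter m.+1 S) x = genfun ((L \o iter m S) \o S) x.
  by apply/funext => k; rewrite /genfun /= -iterSr.
have li m : linf (F \o iter m T) by apply: linf_comp => //; exact: iter_lin.
have lc m : linf (C0 \o iter m T) by apply: linf_comp => //; exact: iter_lin.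
have le m : linf (E \o iter m D) by apply: linf_comp => //; exact: (iter_lin sD).
rewrite it hT //.
have D1 := deriv_along_genfun bb b0 b1 (li n).
have D2 := deriv_along_sum (index_enum 'I_n.+1) (fun i : 'I_n.+1 => 'C(n, i))
  (fun i => deriv_along_mul (deriv_along_genfun bb b0 b1 (lc i)) (deriv_along_genfun bb b0 b1 (le (n - i)%N))).
rewrite [X in deriv_along _ X _](_ : _ = genfun (F \o iter n T)) in D2; last first.
  by apply/funext => y; rewrite IH.
rewrite (deriv_along_unique D1 D2) IH.
rewrite -(pascal_sum (fun i j => genfun (C0 \o iter i T) x * genfun (E \o iter j D) x)).
rewrite mulr_sumr -big_split; apply: eq_bigr => i _ /=.
rewrite mulrnAr -mulrnDl; congr (_ *+ _).
by rewrite !it hT //; ring.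
Qed.

(** Summed over n, the Leibniz formula becomes a product of exponentials. *)
Lemma genfun_exp_op_mul t F C0 E : linf F -> linf C0 -> linf E ->
  (forall x, genfun F x = genfun C0 x * genfun E x) -> forall x,
  genfun (F \o exp_op T t) x = genfun (C0 \o exp_op T t) x * genfun (E \o exp_op D t) x.
Proof.
move=> lF lC lE FCE x; apply/funext => k; rewrite (genfun_exp_op sT _ _ lF (leqnn k)).
pose U i := genfun (C0 \o iter i T) x; pose V j := genfun (E \o iter j D) x.
transitivity (\sum_(n < k.+1) \sum_(i < n.+1)
    (exp_coef t i * exp_coef t (n - i)%N * (U i * V (n - i)%N) k)).
  apply: eq_bigr => n _; rewrite (leibniz_iter lF lC lE FCE) fps_sum mulr_sumr.
  apply: eq_bigr => i _.
  have -> : (U i * V (n - i)%N *+ 'C(n, i)) k = (U i * V (n - i)%N) k * 'C(n, i)%:R.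
    by elim: 'C(n, i) => [|m IH]; rewrite ?mulr0 // mulrS fpsD IH -natr1; ring.
  have f0 m : m`!%:R != 0 :> C by rewrite pnatr_eq0 -lt0n fact_gt0.
  have ni : (i <= n)%N by rewrite -ltnS.
  have -> : exp_coef t n = exp_coef t i * exp_coef t (n - i)%N / 'C(n, i)%:R.
    rewrite /exp_coef -(bin_fact ni) !natrM -{1}(subnKC ni) exprD; field.
    by rewrite !f0 /= pnatr_eq0 -lt0n bin_gt0 ni.
  have b0' : 'C(n, i)%:R != 0 :> C by rewrite pnatr_eq0 -lt0n bin_gt0.
  by field.
rewrite -(sum_antidiag (f := fun i j => exp_coef t i * exp_coef t j * (U i * V j) k)); last first.
  move=> i j kij; rewrite fpsM big1 ?mulr0 // => l _.
  have [li|il] := ltnP l i; first by rewrite /U genfun_iter_low // mul0r.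
  by rewrite /V (genfun_iter_low sD) ?mulr0 //; have := ltn_ord l; lia.
rewrite fpsM.
transitivity (\sum_(l < k.+1) \sum_(i < k.+1) \sum_(j < k.+1)
   (exp_coef t i * U i l) * (exp_coef t j * V j (k - l)%N)).
  rewrite [RHS]exchange_big; apply: eq_bigr => i _; rewrite [RHS]exchange_big.
  apply: eq_bigr => j _; rewrite fpsM mulr_sumr; apply: eq_bigr => l _.
  by rewrite [LHS]mulrACA.
apply: eq_bigr => l _.
rewrite (@genfun_exp_op T sT t C0 x l k) // ?(@genfun_exp_op D sD t E x (k - l) k) //; last 2 first.
- by rewrite leq_subr.
- by rewrite -ltnS.
rewrite mulr_suml; apply: eq_bigr => i _; rewrite mulr_sumr //.
Qed.

End Leibniz.
End Exponential.

(** * Logarithms, and exponentials as Riordan operators *)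

Section LogExpPolynomials.
Variable F : numFieldType.

(** The truncated exponential series; tlog is the logarithm of it. *)
Definition texp K : {poly F} := \poly_(i < K.+1) (i`!%:R)^-1.

Definition tlog K : {poly F} := \sum_(1 <= n < K.+1) ((-1) ^+ n.+1 / n%:R) *: (texp K - 1) ^+ n.

Lemma coef_exp_low (p : {poly F}) n i : p`_0 = 0 -> (i < n)%N -> (p ^+ n)`_i = 0.
Proof.
move=> p0; elim: n i => [//|n IH] i ni.
rewrite exprS coefM big_ord_recl p0 mul0r add0r big1 // => j _.
by rewrite IH ?mulr0 // lift0; have := ltn_ord j; lia.
Qed.

Lemma texp0 K : (texp K - 1)`_0 = 0.
Proof. by rewrite coefB coef1 coef_poly /= fact0 invr1 subrr. Qed.

(** The derivative of the logarithm is exp' times a geometric sum in u = 1 - exp.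
    As exp' is exp up to degree K, this is 1 - u^K below degree K, where u^K has no
    coefficients. *)
Lemma tlog_coef K i : (i <= K)%N -> (tlog K)`_i = (i == 1%N)%:R.
Proof.
case: i => [_|i iK].
  rewrite /tlog coef_sum big_nat big1 // => n /andP[n1 _].
  by rewrite coefZ coef_exp_low ?texp0 ?mulr0.
have K0 : (0 < K)%N by lia.
set e := texp K; pose u := 1 - e; pose S := \sum_(m < K) u ^+ m.
have eu : e - 1 = - u by rewrite /u opprB.
have dE : deriv e = e - (K`!%:R)^-1 *: 'X^K.
  apply/polyP => j; rewrite coef_deriv coefB coefZ coefXn !coef_poly ltnS.
  have [jK|Kj|->] := ltngtP j K; rewrite ?mulr0 ?subr0.
  - rewrite ifT; last by lia.
    by rewrite factS natrM invfM -[_ *+ _]mulr_natr mulrAC mulVf ?mul1r // pnatr_eq0.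
  - by rewrite ifF ?mul0rn //; lia.
  by rewrite mulr1 ?ltnn ?ltnSn subrr mul0rn.
have dL : deriv (tlog K) = deriv e * S.
  rewrite /tlog raddf_sum /= /S mulr_sumr big_add1 big_mkord; apply: eq_bigr => m _.
  rewrite derivZ deriv_exp derivB derivC subr0 -/e eu /=.
  rewrite -[X in _ *: X]scaler_nat scalerA divfK ?pnatr_eq0 // !exprS !mulN1r opprK.
  rewrite [(- u) ^+ _]exprNn -signr_odd -[in (-1) ^+ m * u ^+ m]signr_odd.
  by case: (odd m); rewrite ?expr0 ?expr1 ?scale1r ?mul1r // scaleN1r mulN1r mulrN opprK.
have geo : e * S = 1 - u ^+ K.
  have -> : e = 1 - u by rewrite /u opprB addrC subrK.
  by rewrite /S -[LHS]opprK -mulNr opprB -subrX1 opprB.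
have u0 : u`_0 = 0 by rewrite /u -opprB coefN texp0 oppr0.
have : (deriv (tlog K))`_i = (i == 0%N)%:R.
  rewrite dL dE mulrBl geo -scalerAl !coefB coef1 coefZ coefXnM ifT // mulr0 subr0.
  by rewrite coef_exp_low // subr0.
rewrite coef_deriv -[_ *+ i.+1]mulr_natr => h.
have nz : i.+1%:R != 0 :> F by rewrite pnatr_eq0.
apply: (mulIf nz); rewrite h.
by case: i {iK h nz} => [|i]; rewrite ?mul0r // mul1r.
Qed.

Lemma texp_coef K i : (i <= K)%N -> (texp K)`_i = (i`!%:R)^-1.
Proof. by move=> iK; rewrite coef_poly ltnS iK. Qed.

End LogExpPolynomials.

Section PolynomialAction.
Variables (F : fieldType) (V : lmodType F) (T : V -> V).
Hypothesis lT : linear T.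

Definition poly_act (q : {poly F}) (v : V) : V := \sum_(i < size q) q`_i *: iter i T v.

Lemma iter_linear n : linear (iter n T).
Proof. by elim: n => [|n IH] a x y //=; rewrite IH lT. Qed.

Lemma poly_act_widen (q : {poly F}) N v : (size q <= N)%N -> poly_act q v = \sum_(i < N) q`_i *: iter i T v.
Proof.
move=> qN; apply/esym/(big_ord_cut (F := fun i => q`_i *: iter i T v)) => // i.
by move=> /(nth_default 0) ->; rewrite scale0r.
Qed.

Lemma poly_actP (c : F) (p q : {poly F}) v : poly_act (c *: p + q) v = c *: poly_act p v + poly_act q v.
Proof.
pose N := maxn (size p) (size q).
rewrite !(@poly_act_widen _ N) ?leq_maxl ?leq_maxr //; last first.
  by apply: leq_trans (size_polyD _ _) _; rewrite geq_max leq_maxr (leq_trans (size_scale_leq _ _)) ?leq_maxl.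
rewrite scaler_sumr -big_split; apply: eq_bigr => i _ /=.
by rewrite coefD coefZ scalerDl scalerA.
Qed.

Lemma poly_actD p q v : poly_act (p + q) v = poly_act p v + poly_act q v.
Proof. by rewrite -[p]scale1r poly_actP !scale1r. Qed.
Lemma poly_act0 v : poly_act 0 v = 0.
Proof. by rewrite /poly_act size_poly0 big_ord0. Qed.
Lemma poly_actZ (c : F) p v : poly_act (c *: p) v = c *: poly_act p v.
Proof. by rewrite -[c *: p]addr0 poly_actP poly_act0 addr0. Qed.
Lemma poly_actB p q v : poly_act (p - q) v = poly_act p v - poly_act q v.
Proof. by rewrite -[- q]scaleN1r poly_actD poly_actZ scaleN1r. Qed.
Lemma poly_act_sum (I : Type) (r : seq I) (P : pred I) (G : I -> {poly F}) v :
  poly_act (\sum_(i <- r | P i) G i) v = \sum_(i <- r | P i) poly_act (G i) v.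
Proof. by elim/big_rec2: _ => [|i y1 y2 _ <-]; rewrite ?poly_act0 ?poly_actD. Qed.

Lemma poly_act1 v : poly_act 1 v = v.
Proof. by rewrite /poly_act size_poly1 big_ord1 coef1 scale1r. Qed.

Lemma poly_act_Xmul q v : poly_act ('X * q) v = poly_act q (T v).
Proof.
rewrite (@poly_act_widen _ (size q).+1); last first.
  by apply: leq_trans (size_polyMleq _ _) _; rewrite size_polyX.
rewrite big_ord_recl coefXM /= scale0r add0r; apply: eq_bigr => i _.
by rewrite /bump /= ?add1n coefXM /= -iterSr.
Qed.

Lemma poly_actT q v : poly_act q (T v) = T (poly_act q v).
Proof.
rewrite /poly_act (lin_sum lT); apply: eq_bigr => i _.
by rewrite (linZ lT) -iterSr.
Qed.

Lemma poly_actM p q v : poly_act (p * q) v = poly_act p (poly_act q v).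
Proof.
elim/poly_ind: p q => [|p c IH] q; first by rewrite mul0r !poly_act0.
rewrite mulrDl -mulrA !poly_actD IH poly_act_Xmul poly_actT mul_polyC poly_actZ.
congr (_ + _); first by rewrite mulrC poly_act_Xmul.
by rewrite -[c%:P]mulr1 mul_polyC poly_actZ poly_act1.
Qed.

Lemma poly_act_nilp (q : {poly F}) v N : iter N T v = 0 -> (forall i, (i < N)%N -> q`_i = 0) -> poly_act q v = 0.
Proof.
move=> TN q0; rewrite /poly_act big1 // => i _.
have [iN|Ni] := ltnP i N; first by rewrite q0 // scale0r.
rewrite -(subnK Ni) iterD TN.
by rewrite (lin0 (@iter_linear _)) scaler0.
Qed.

End PolynomialAction.

Section Gamma.
Variables (R : realType) (Phi : LBspace R).
Local Notation C := R[i].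
Local Notation Sym k := (SymPow Phi k).
Local Notation polyfun := (polyfun Phi).
Local Notation fseries := (fseries Phi).
Local Notation X := (Sym 1).
Local Notation fpsC := (fps R[i]).

Lemma iter_deg_all (T : polyfun -> polyfun) n (p : polyfun) K : striang T ->
  (forall k, (K < k)%N -> pcoef k p = 0) ->
  forall k, (K < k + n)%N -> pcoef k (iter n T p) = 0.
Proof.
move=> sT pK k kn; rewrite (pcoef_sum pK) (lin_sum (iter_lin sT n)) (lin_sum (@pcoef_lin _ _ k)).
by rewrite big1 // => j _; rewrite iter_deg //; have := ltn_ord j; lia.
Qed.

(** On a polynomial of degree K everything is a polynomial in T modulo
    T^(K+1), and modulo X^(K+1) the logarithm of the exponential series is X. *)
Theorem op_log_exp_op (T : polyfun -> polyfun) : striang T -> op_log (exp_op T 1) = T.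
Proof.
move=> sT; have lT : linear T by case: sT => -[].
apply/funext => p; have [K pK] := pcoef_deg p.
have TK : iter K.+1 T p = 0.
  rewrite [LHS](@pcoef_sum _ _ _ 0%N) => [|i _].
    by rewrite big_ord1 (iter_deg_all sT pK) // (lin0 (@mono_lin _ _ _)).
  by apply: (iter_deg_all sT pK); lia.
have stepE q : (exp_op T 1 - id) (poly_act T q p) = poly_act T ((texp C K - 1) * q) p.
  rewrite fct_sub (exp_opE sT _ (K := K)); last first.
    move=> k Kk; rewrite /poly_act (lin_sum (@pcoef_lin _ _ k)) big1 // => i _.
    by rewrite (linZ (@pcoef_lin _ _ k)) (iter_deg_all sT pK) ?scaler0 //; lia.
  rewrite mulrBl mul1r poly_actB poly_actM //; congr (_ - _).
  rewrite (@poly_act_widen _ _ T (texp _ K) K.+1); last exact: size_poly.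
  apply: eq_bigr => i _; rewrite texp_coef; last by rewrite -ltnS.
  by rewrite /exp_coef expr1n mul1r.
have iterE n : iter n (exp_op T 1 - id) p = poly_act T ((texp C K - 1) ^+ n) p.
  elim: n => [|n IH]; first by rewrite expr0 poly_act1.
  by rewrite iterS IH stepE exprS.
rewrite /op_log (@fsum_from _ 1 K) => [|n Kn]; last first.
  rewrite iterE (poly_act_nilp lT TK) ?scaler0 // => i iK.
  by rewrite coef_exp_low ?texp0 //; lia.
rewrite (eq_bigr (fun n : 'I_K.+1 => poly_act T (((-1) ^+ n.+1 / n%:R) *: (texp C K - 1) ^+ n) p)); last first.
  by move=> n _; rewrite iterE poly_actZ.
rewrite -(@big_mkord _ _ _ K.+1 (leq 1) (fun n => poly_act T (((-1) ^+ n.+1 / n%:R) *: (texp C K - 1) ^+ n) p)).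
rewrite big_ltn_cond //=.
rewrite big_nat_cond (eq_bigl (fun n => (1 <= n < K.+1)%N)); last by move=> n /=; lia.
rewrite -big_nat -poly_act_sum -/(tlog C K).
have -> : poly_act T (tlog C K) p = poly_act T (tlog C K - 'X) p + poly_act T 'X p.
  by rewrite -poly_actD subrK.
rewrite (poly_act_nilp lT TK) ?add0r; last first.
  by move=> i iK; rewrite coefB tlog_coef // coefX subrr.
by rewrite -['X]mulr1 poly_act_Xmul poly_act1.
Qed.

Definition exp_scalar (T : polyfun -> polyfun) (t : C) : fseries 0 :=
  fun k f => pcoef 0 (exp_op T t (mono f)).
(** Applied to the operator D = N M(b). Having no scalar part, exp(tD) has a
    generating function 1 / (1 - <omega, B_t>), whose part of degree 1 in omega
    is B_t. *)
Definition exp_vector (T : polyfun -> polyfun) (t : C) : fseries 1 :=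
  fun k f => pcoef 1 (exp_op T t (mono f)).

Lemma exp_scalar_bdd_op T t : striang T -> all_bdd_op (exp_scalar T t).
Proof. by move=> sT k; case: (exp_op_triang sT t). Qed.
Lemma exp_vector_bdd_op T t : striang T -> all_bdd_op (exp_vector T t).
Proof. by move=> sT k; case: (exp_op_triang sT t). Qed.

Lemma exp_scalar0 T t : striang T -> @exp_scalar T t 0 = id.
Proof.
move=> sT; apply/funext => f; rewrite /exp_scalar (exp_op_mono sT _ _ (leqnn 0)) big_ord1.
by rewrite /exp_coef expr0 fact0 divr1 scale1r /= pcoef_mono.
Qed.

Lemma exp_vector0 T t : striang T -> @exp_vector T t 0 = 0.
Proof.
move=> sT; apply/funext => f; rewrite /exp_vector (exp_op_mono sT _ _ (leqnn 0)) big_ord1.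
by rewrite /exp_coef expr0 fact0 divr1 scale1r /= mono_deg.
Qed.

(** Evaluation at omega = 0. Its generating function is 1. *)
Definition const_part (p : polyfun) : C := sc (pcoef 0 p).

Lemma const_part_linf : linf const_part.
Proof. by move=> a p q; rewrite /const_part pcoef_lin scP. Qed.

Lemma genfun_const_part x : genfun const_part x = 1.
Proof.
apply/funext => -[|n]; rewrite /genfun /const_part fps1; first by rewrite pcoef_mono /sc pairing_pw expr0.
by rewrite pcoef_mono_neq // /sc pairing0.
Qed.

Lemma genfun_exp_scalar T t x : striang T -> genfun (sval (exp_scalar T t)) x = genfun (const_part \o exp_op T t) x.
Proof.
by move=> sT; apply/funext => n; rewrite genfun_sval //; exact: exp_scalar_bdd_op.
Qed.

Lemma vval_ser_xi omega (p : polyfun) : vval omega (@ser_xi R Phi) p = pairing omega (pcoef 1 p) :> C.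
Proof.
rewrite /vval; congr (pairing omega _ : C).
have lp := all_bdd_op_lin (@ser_xi_bdd_op R Phi).
suff -> : pext (@ser_xi R Phi) = pcoef 1 by [].
apply: poly_lin_ext; [exact: pext_lin|exact: pcoef_lin|move=> n f].
rewrite (pext_mono lp); case: n f => [|[|n]] f.
- by rewrite pcoef_mono_neq.
- by rewrite pcoef_mono.
- by rewrite pcoef_mono_neq.
Qed.

Lemma genfun_exp_vector T t omega x : striang T ->
  genfun (vval omega (exp_vector T t)) x = genfun (vval omega (@ser_xi R Phi) \o exp_op T t) x.
Proof.
move=> sT; apply/funext => n; rewrite genfun_vval; last exact: exp_vector_bdd_op.
by rewrite /genfun /= vval_ser_xi.
Qed.

Section Vector.
Unset Implicit Arguments.
Variables (b : fseries 1).
Set Implicit Arguments.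
Hypotheses (bb : all_bdd_op b) (b0 : b 0%N = 0) (b1 : b 1%N = 0).
Local Notation D := (NM_nabla b).

Let sD : striang D := NM_nabla_striang bb.

Lemma exp_vector1 t : @exp_vector D t 1 = id.
Proof.
apply/funext => f; rewrite /exp_vector (exp_op_mono sD _ _ (leqnn 1)) big_ord_recr big_ord1 /=.
rewrite NM_nabla_mono // big1; last by move=> j j2; have := ltn_ord j; lia.
by rewrite scaler0 addr0 /exp_coef expr0 fact0 divr1 scale1r pcoef_mono.
Qed.

Lemma const_part_NM p : const_part (D p) = 0.
Proof.
have lD : linear D by case: sD => -[].
have [K pK] := pcoef_deg p; rewrite (pcoef_sum pK) (lin_sum lD) (linf_sum const_part_linf).
rewrite big1 // => k _; rewrite NM_nabla_mono // (linf_sum const_part_linf) big1 // => j _.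
rewrite (linfZ const_part_linf) /const_part pcoef_mono_neq ?/sc ?pairing0 ?mulr0 //.
by rewrite addn1.
Qed.

Lemma genfun_const_part_expD t x : genfun (const_part \o exp_op D t) x = 1.
Proof.
rewrite -(genfun_const_part x); apply/funext => k; rewrite (genfun_exp_op sD _ _ const_part_linf (leqnn k)).
rewrite big_ord_recl big1 ?addr0; last by move=> i _; rewrite lift0 /genfun /= const_part_NM mulr0.
by rewrite /exp_coef expr0 fact0 divr1 mul1r.
Qed.

Lemma hD L x : linf L -> genfun (L \o D) x = 0 * genfun L x + genfun (L \o D) x.
Proof. by move=> _; rewrite mul0r add0r. Qed.

(** The flow of D fixes the constants and is multiplicative, so it turns
    1 / (1 - omega) into 1 / (1 - omega(B_t)). *)
Lemma genfun_ev_at_expD t omega x :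
  genfun (ev_at omega \o exp_op D t) x * (1 - genfun (vval omega (exp_vector D t)) x) = 1.
Proof.
pose E p := -1 * vval omega (@ser_xi R Phi) p + const_part p.
have lv := vval_linf omega (@ser_xi_bdd_op R Phi).
have lE : linf E by move=> a p q; rewrite /E lv const_part_linf; ring.
have FCE y : genfun const_part y = genfun (ev_at omega) y * genfun E y.
  rewrite genfun_const_part -(genfun_ev_at omega y); congr (_ * _); rewrite -(genfun_const_part y).
  by apply/funext => n; rewrite fpsD fpsN /genfun /E mulN1r addrC.
have H := genfun_exp_op_mul bb b0 b1 (al := fun=> 0) sD hD t const_part_linf (@ev_at_linf _ _ omega) lE FCE x.
have HE : genfun (E \o exp_op D t) x = 1 - genfun (vval omega (exp_vector D t)) x.
  apply/funext => n; rewrite fpsD fpsN genfun_exp_vector //.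
  have <- : genfun (const_part \o exp_op D t) x n = (1 : fpsC) n by rewrite genfun_const_part_expD.
  by rewrite /genfun /= /E mulN1r addrC.
by rewrite -HE -H genfun_const_part_expD.
Qed.

Section WithMultiplier.
Variables (T : polyfun -> polyfun) (al : X -> fpsC).
Hypothesis sT : striang T.
Hypothesis hT : forall L x, linf L -> genfun (L \o T) x = al x * genfun L x + genfun (L \o D) x.

(** The generating function 1 / (1 - omega) is the product of 1, that of
    const_part, and itself; exp(tT) maps the first factor to A_t, while the second
    one is mapped by exp(tD) to 1 / (1 - omega(B_t)). *)
Theorem riordan_op_gamma t : riordan_op (exp_scalar T t) (exp_vector D t) = exp_op T t.
Proof.
have bA := exp_scalar_bdd_op t sT; have bB := exp_vector_bdd_op t sD.
apply: triang_ext; [exact: riordan_op_triang|exact: exp_op_triang|move=> omega x].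
set h := genfun (vval omega (exp_vector D t)) x; set G := genfun (ev_at omega \o exp_op D t) x.
have h0 : h 0%N = 0 by rewrite /h genfun_vval // exp_vector0 // pairing0.
have -> : genfun (ev_at omega \o exp_op T t) x = genfun (sval (exp_scalar T t)) x * G.
  rewrite genfun_exp_scalar //; apply: (genfun_exp_op_mul bb b0 b1 sT hT t (@ev_at_linf _ _ omega) const_part_linf (@ev_at_linf _ _ omega)).
  by move=> y; rewrite genfun_const_part mul1r.
apply/funext => k.
have -> : genfun (ev_at omega \o riordan_op (exp_scalar T t) (exp_vector D t)) x k =
    (genfun (sval (exp_scalar T t)) x * \sum_(i < k.+1) h ^+ i) k.
  rewrite /genfun /= /ev_at riordan_op_mono // peval_sum mulr_sumr fps_sum; apply: eq_bigr => i _.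
  by rewrite peval_mono pairing_riordan_block // exp_vector0.
have -> : \sum_(i < k.+1) h ^+ i = G - G * h ^+ k.+1.
  have g1 : G * (1 - h) = 1 by exact: genfun_ev_at_expD.
  rewrite -[LHS]mul1r -g1 -mulrA -[1 - h]opprB mulNr -subrX1 opprB mulrBr mulr1 //.
rewrite mulrBr fpsD fpsN mulrA [_ * h ^+ _]mulrC.
rewrite (fpsM_congr (c := h ^+ k.+1) (c' := 0)) => [|m mk]; last by rewrite fps_exp_low // ltnS.
by rewrite mul0r subr0.
Qed.

End WithMultiplier.
End Vector.
End Gamma.

(** * Smoothness of the exponential curves *)

Section Smooth.
Variables (R : realType) (Phi : LBspace R).
Local Notation C := R[i].
Local Notation Sym k := (SymPow Phi k).

Lemma normC_real (x : R) : `|x%:C| = `|x|%:C :> C.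
Proof. by rewrite normc_def /= expr0n addr0 sqrtr_sqr. Qed.

Lemma expr_taylor (t : C) n : exists2 M : C, 0 <= M & forall h, `|h| <= 1 ->
  `|(t + h) ^+ n - t ^+ n - n%:R * t ^+ n.-1 * h| <= M * `|h| ^+ 2.
Proof.
elim: n => [|n [M M0 IH]].
  by exists 0 => // h _; rewrite !expr0 subrr !mul0r subr0 normr0.
exists ((`|t| + 1) * M + n%:R * `|t| ^+ n.-1).
  by rewrite addr_ge0 ?mulr_ge0 ?addr_ge0 ?exprn_ge0.
move=> h h1; have -> : (t + h) ^+ n.+1 - t ^+ n.+1 - n.+1%:R * t ^+ n.+1.-1 * h =
    (t + h) * ((t + h) ^+ n - t ^+ n - n%:R * t ^+ n.-1 * h) + n%:R * t ^+ n.-1 * h ^+ 2.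
  case: n {IH} => [|n] /=; rewrite ?expr0 ?expr1 ?exprS -?natr1; ring.
apply: le_trans (ler_normD _ _) _; rewrite [leRHS]mulrDl; apply: lerD.
  rewrite normrM -[leRHS]mulrA; apply: ler_pM => //; last exact: IH.
  by apply: le_trans (ler_normD _ _) _; rewrite lerD2l.
by rewrite !normrM !normrX normr_nat.
Qed.

Definition dexp_coef (t : C) n : C := if n is m.+1 then exp_coef t m else 0.

Lemma exp_coef_deriv (t : R) n (e : C) : 0 < e ->
  \forall h \near (0 : R)^',
    `|(h%:C)^-1 * (exp_coef (t + h)%:C n - exp_coef t%:C n) - dexp_coef t%:C n| <= e.
Proof.
move=> e0; have [M M0 hM] := expr_taylor t%:C n.
have M1 : 0 < M + 1 by rewrite ltr_wpDl.
have [d d0 dE] := gt0_real_complex (divr_gt0 e0 M1).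
near=> h.
have h0 : h%:C != 0 :> C.
  by rewrite (_ : 0 = 0%:C) // (inj_eq (@complexI R)); near: h; exact: nbhs_dnbhs_neq.
have hd : `|h%:C| <= e / (M + 1) :> C.
  by rewrite normC_real dE lecR; near: h; exact: dnbhs0_le.
have h1 : `|h%:C| <= 1 :> C.
  by rewrite normC_real -(rmorph1 (real_complex R)) lecR; near: h; exact: dnbhs0_le.
have f0 m : m`!%:R != 0 :> C by rewrite pnatr_eq0 -lt0n fact_gt0.
have -> : (h%:C)^-1 * (exp_coef (t + h)%:C n - exp_coef t%:C n) - dexp_coef t%:C n =
    (n`!%:R)^-1 * (h%:C)^-1 * ((t%:C + h%:C) ^+ n - t%:C ^+ n - n%:R * t%:C ^+ n.-1 * h%:C).
  have -> : (t + h)%:C = t%:C + h%:C :> C by exact: rmorphD.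
  rewrite /exp_coef /dexp_coef; move: (t%:C) (h%:C) h0 => u v v0.
  case: n {hM} => [|n] /=; first by rewrite !expr0; field; rewrite f0 v0.
  have n0 : n.+1%:R != 0 :> C by rewrite pnatr_eq0.
  rewrite /exp_coef factS natrM !exprS; move: (n.+1%:R : C) (n`!%:R : C) n0 (f0 n) => x y x0 y0.
  by field; rewrite x0 y0 v0.
rewrite normrM normrM; have := hM _ h1.
rewrite -(@ler_pM2l _ (`|(n`!%:R)^-1| * `|(h%:C)^-1|)); last first.
  by rewrite mulr_gt0 // normr_gt0 invr_eq0.
move=> h2; apply: le_trans h2 _.
have -> : `|(n`!%:R)^-1| * `|(h%:C)^-1| * (M * `|h%:C| ^+ 2) = `|(n`!%:R)^-1| * (M * `|h%:C|).
  have Hn : `|h%:C| != 0 :> C by rewrite normr_eq0.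
  rewrite [`|(h%:C)^-1|]normfV.
  by move: (`|h%:C|) (`|(n`!%:R)^-1|) Hn => H A Hn; field.
apply: le_trans (_ : 1 * (M * `|h%:C|) <= _).
  rewrite ler_wpM2r ?mulr_ge0 // normfV normr_nat invf_le1 ?ltr0n ?fact_gt0 //.
  by rewrite ler1n fact_gt0.
rewrite mul1r; apply: le_trans (ler_wpM2l M0 hd) _.
by rewrite mulrCA ler_piMr ?(ltW e0) // ler_pdivrMr // mul1r lerDl.
Unshelve. all: by end_near. Qed.

Variables k i : nat.
Implicit Types S : nat -> Sym k -> Sym i.

(** Neighbourhoods of 0 in the space of operators absorb bounded operators. *)
Lemma bdd_op_absorb (S : Sym k -> Sym i) n W : bdd_op S -> @op_nbhs0 R (sym_sys Phi k) (sym_sys Phi i) n W ->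
  exists2 e : R, 0 < e & forall a : C, `|a| <= e%:C -> W (fun x => a *: S (stage_incl x)).
Proof.
move=> [lS bS] [cW NW]; have [m [c [c0 h]]] := bS n; have [e e0 eW] := NW m.
have [r r0 er] := gt0_real_complex (divr_gt0 e0 c0).
exists r => // a ar; apply: eW.
  move=> u x y; have -> : stage_incl (u *: x + y) = u *: stage_incl x + stage_incl y.
    exact: subval_inj.
  by rewrite lS scalerDr !scalerA mulrC.
have xs (x : stage (sym_sys Phi k) n) : sub_set (stp (sym_sys Phi k) n) (subval (stage_incl x)).
  exact/asboolP/(subvalP x).
split=> x; first by rewrite subvalZ; apply: subspaceZ; exact: (h _ (xs x)).1.
move=> x1; rewrite subvalZ.
have [_ /(_ 1 ler01 x1)] := h (stage_incl x) (xs x).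
rewrite mulr1 => /(inj_norm_leZ a); apply: inj_norm_le_mono.
apply: le_trans (ler_wpM2r (ltW c0) ar) _.
by rewrite -er divfK // gt_eqF.
Qed.

(** A polynomial in t with operator coefficients. The blocks of exp(tT) have
    this form, with the blocks of the powers of T for S. *)
Definition exp_curve (N : nat) (S : nat -> Sym k -> Sym i) (t : R) : Sym k -> Sym i :=
  fun f => \sum_(n < N.+1) exp_coef t%:C n *: S n f.

Lemma exp_curve_deriv N S t : (forall n, bdd_op (S n)) -> (forall n, (N < n)%N -> S n = 0) ->
  @op_deriv_at R (sym_sys Phi k) (sym_sys Phi i) (exp_curve N S) t (exp_curve N (fun n => S n.+1) t).
Proof.
move=> bS S0 q W NW.
have /choice[e eP] : forall n, exists e : R, 0 < e /\ forall a : C, `|a| <= e%:C ->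
    W (fun x => a *: S n (stage_incl x)).
  by move=> n; have [e e0 h] := bdd_op_absorb (bS n) NW; exists e.
have N0 : 0 < N.+1%:R :> C by rewrite ltr0n.
have e0 n : 0 < (e n)%:C / N.+1%:R :> C by rewrite divr_gt0 // ltcR; case: (eP n).
have near_n : \forall h \near (0 : R)^', forall n : 'I_N.+1,
    `|(h%:C)^-1 * (exp_coef (t + h)%:C n - exp_coef t%:C n) - dexp_coef t%:C n| <= (e n)%:C / N.+1%:R.
  by apply: filter_forall => n; exact: exp_coef_deriv.
near=> h.
have hn : forall n : 'I_N.+1,
    `|(h%:C)^-1 * (exp_coef (t + h)%:C n - exp_coef t%:C n) - dexp_coef t%:C n| <= (e n)%:C / N.+1%:R.
  by near: h; exact: near_n.
(* The error is the mean of the N + 1 operators a n *: S n, each lying in W. *)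
pose a n := N.+1%:R * ((h%:C)^-1 * (exp_coef (t + h)%:C n - exp_coef t%:C n) - dexp_coef t%:C n).
rewrite [X in W X](_ : _ = \sum_(n < N.+1) (N.+1%:R)^-1 *: (fun x => a n *: S n (stage_incl x))).
  apply: abs_convex_sum => //; first exact: NW.1.
  - have := (eP 0%N).2 0; rewrite normr0 lecR ltW ?(eP 0%N).1 // => /(_ isT).
    by rewrite (_ : (fun x => 0 *: _) = 0) //; apply/funext => x; rewrite scale0r.
  - move=> n; apply: (eP n).2; rewrite /a normrM normr_nat.
    by rewrite mulrC -ler_pdivlMr //; exact: hn.
  rewrite sumr_const card_ord gtr0_norm ?invr_gt0 // -[_ *+ _]mulr_natl mulfV // gt_eqF //.
apply/funext => x; set f := stage_incl x.
have -> : (\sum_(n < N.+1) (N.+1%:R)^-1 *: (fun x => a n *: S n (stage_incl x))) x =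
    \sum_(n < N.+1) ((h%:C)^-1 * (exp_coef (t + h)%:C n - exp_coef t%:C n) - dexp_coef t%:C n) *: S n f.
  have sumE (r : seq 'I_N.+1) (G : 'I_N.+1 -> stage (sym_sys Phi k) q -> Sym i) :
      (\sum_(n <- r) G n) x = \sum_(n <- r) G n x.
    by elim: r => [|n r IH]; rewrite ?big_nil // !big_cons -IH.
  rewrite sumE; apply: eq_bigr => n _.
  transitivity ((N.+1%:R)^-1 *: (a n *: S n f)) => //.
  by rewrite scalerA /a mulKf // gt_eqF.
rewrite /exp_curve -/f.
have -> : \sum_(n < N.+1) exp_coef t%:C n *: S n.+1 f = \sum_(n < N.+1) dexp_coef t%:C n *: S n f.
  rewrite big_ord_recr /= S0 // [X in _ + X](_ : _ = 0) ?addr0; last exact: scaler0.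
  by rewrite [RHS]big_ord_recl /= scale0r add0r; apply: eq_bigr => n _; rewrite /bump /= add1n.
rewrite -sumrB scaler_sumr -sumrB; apply: eq_bigr => n _.
move: (S n f) (exp_coef (t + h)%:C n) (exp_coef t%:C n) (dexp_coef t%:C n) ((h%:C)^-1) => v p q' d u.
by rewrite scalerBl -scalerA scalerBl.
Unshelve. all: by end_near. Qed.

Lemma exp_curve_smooth N S : (forall n, bdd_op (S n)) -> (forall n, (N < n)%N -> S n = 0) ->
  @op_smooth R (sym_sys Phi k) (sym_sys Phi i) (exp_curve N S).
Proof.
move=> bS S0; exists (fun j => exp_curve N (fun n => S (n + j)%N)); split.
  apply/funext => t; apply/funext => f; apply: eq_bigr => n _.
  by rewrite addn0.
move=> j t; split.
  by apply: contlin_of_bdd_op; apply: sym_bdd_op_sum => n _; exact: sym_bdd_opZ.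
have := @exp_curve_deriv N (fun n => S (n + j)%N) t (fun n => bS _).
rewrite (_ : (fun n => S (n.+1 + j)%N) = (fun n => S (n + j.+1)%N)).
  by apply => n Nn; apply: S0; lia.
by apply/funext => n; rewrite addSnnS.
Qed.

End Smooth.

(** * The flow of a pair of series *)

Section Flow.
Variables (R : realType) (Phi : LBspace R).
Local Notation C := R[i].
Local Notation Sym k := (SymPow Phi k).
Local Notation polyfun := (polyfun Phi).
Local Notation fseries := (fseries Phi).

Lemma fseries_ext i (A B : fseries i) : (forall k, A k = B k) -> A = B.
Proof. exact: functional_extensionality_dep. Qed.

Section Explicit.
Unset Implicit Arguments.
Variables (w : fseries 0 * fseries 1).
Set Implicit Arguments.
Hypothesis hw : inW w.
Let T := first_order w.1 w.2.
Let D := NM_nabla w.2.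

Let ww : lie_pair w.1 w.2 := lie_pairP hw.
Let bb : all_bdd_op w.2. Proof. by case: ww. Qed.
Let b0 : w.2 0%N = 0. Proof. by case: ww. Qed.
Let b1 : w.2 1%N = 0. Proof. by case: ww. Qed.
Let sT : striang T := first_order_striang ww.
Let sD : striang D := NM_nabla_striang bb.

(** A pair (a, b) is integrated through the operators T and D that it defines. *)
Definition flow (t : R) : fseries 0 * fseries 1 := (exp_scalar T t%:C, exp_vector D t%:C).

Lemma flow_inS t : inS (flow t).
Proof.
split.
- by move=> k; apply/bdd_op_contlin; exact: exp_scalar_bdd_op.
- by move=> k; apply/bdd_op_contlin; exact: exp_vector_bdd_op.
- exact: exp_scalar0.
- exact: exp_vector0.
- exact: exp_vector1.
Qed.

Lemma riordan_op_flow t : riordan_op (flow t).1 (flow t).2 = exp_op T t%:C.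
Proof.
apply: (@riordan_op_gamma _ _ w.2 bb b0 b1 T (genfun (sval w.1)) sT) => L x lL.
exact: genfun_first_order.
Qed.

Lemma exp_scalar_NM t : exp_scalar D t%:C = @ser_one R Phi.
Proof.
apply: fseries_ext => k; apply: bdd_op_eq; [exact: exp_scalar_bdd_op|exact: ser_one_bdd_op|move=> x].
have e : sc (exp_scalar D t%:C (pw k x)) = sc (ser_one (pw k x)).
  rewrite -(genfun_sval x k (exp_scalar_bdd_op t%:C sD)) -(genfun_sval x k (@ser_one_bdd_op R Phi)).
  by rewrite genfun_exp_scalar // genfun_const_part_expD // genfun_ser_one.
by rewrite -[LHS]scal_sc e scal_sc.
Qed.

Lemma riordan_op_flow_NM t : riordan_op (@ser_one R Phi) (flow t).2 = exp_op D t%:C.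
Proof.
rewrite -(exp_scalar_NM t); apply: (@riordan_op_gamma _ _ w.2 bb b0 b1 D (fun=> 0) sD).
exact: hD.
Qed.

(** The scalar and vector parts of exp((s + t)T) = exp(sT) exp(tT) and of the
    same law for D, read through pext_riordan_op. *)
Lemma flow_add s t : flow (s + t) = S_mul (flow s) (flow t).
Proof.
have st : (s + t)%:C = s%:C + t%:C :> C by exact: rmorphD.
have [bAs bBs bAt bBt] : [/\ all_bdd_op (exp_scalar T s%:C), all_bdd_op (exp_vector D s%:C),
    all_bdd_op (exp_scalar T t%:C) & all_bdd_op (exp_vector D t%:C)].
  by split; [exact: exp_scalar_bdd_op|exact: exp_vector_bdd_op|exact: exp_scalar_bdd_op|exact: exp_vector_bdd_op].
have B0 : exp_vector D t%:C (k := 0) = 0 by exact: exp_vector0.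
have ext i (F : polyfun -> Sym i) (A : fseries i) p : linear F -> all_bdd_op A ->
    (forall k (f : Sym k), F (mono f) = A k f) -> F p = pext A p.
  move=> lF bA FA; have lA := all_bdd_op_lin bA.
  suff -> : F = pext A by [].
  by apply: poly_lin_ext => //; [exact: pext_lin|move=> n f; rewrite FA pext_mono].
rewrite /flow /S_mul /=; congr (_, _); apply: fseries_ext => k.
  have bc := ser_comp_bdd_op bAs bBt.
  apply: bdd_op_eq; [exact: exp_scalar_bdd_op|exact: ser_prod_bdd_op|move=> x].
  have -> : exp_scalar T (s + t)%:C (pw k x) = pext (exp_scalar T s%:C) (riordan_op (exp_scalar T t%:C) (exp_vector D t%:C) (mono (pw k x))).
    rewrite (riordan_op_flow t) /exp_scalar st -exp_op_add //.
    have lF : linear (fun p => pcoef 0 (exp_op T s%:C p)).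
      by move=> u p q; rewrite (exp_op_lin sT) (@pcoef_lin _ _ 0).
    exact: (ext 0 _ (exp_scalar T s%:C) _ lF bAs (fun k f => erefl)).
  rewrite pext_riordan_op //.
  rewrite -[LHS]scal_sc -[RHS]scal_sc; congr scal.
  rewrite -genfun_sval ?genfun_ser_prod //; last exact: ser_prod_bdd_op.
  rewrite mulrC fpsM sc_sum; apply: eq_bigr => l _.
  by rewrite !genfun_sval.
apply: bdd_op_eq; [exact: (exp_vector_bdd_op (s + t)%:C sD k)|exact: (ser_comp_bdd_op bBs bBt k)|move=> x].
have -> : exp_vector D (s + t)%:C (pw k x) = pext (exp_vector D s%:C) (riordan_op (@ser_one R Phi) (exp_vector D t%:C) (mono (pw k x))).
  rewrite (riordan_op_flow_NM t) /exp_vector st -exp_op_add //.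
  have lF : linear (fun p => pcoef 1 (exp_op D s%:C p)).
    by move=> u p q; rewrite (exp_op_lin sD) (@pcoef_lin _ _ 1).
  exact: (ext 1 _ (exp_vector D s%:C) _ lF bBs (fun k f => erefl)).
rewrite pext_riordan_op //; last exact: ser_one_bdd_op.
rewrite big_ord_recl subn0 big1 ?addr0.
  by rewrite -[X in sc X](_ : pw 0 x = _) // /sc pairing_pw expr0 scale1r.
move=> l _; rewrite (_ : @ser_one R Phi (lift ord0 l) (pw (lift ord0 l) x) = 0) //.
by rewrite /sc pairing0 scale0r.
Qed.

Lemma pcoef0_first_order k : (fun f : Sym k => pcoef 0 (T (mono f))) = w.1 k.
Proof.
have [ba _ a0 _ _] := ww.
apply: bdd_op_eq; [by case: sT => -[]|exact: ba|move=> x].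
rewrite -[LHS]scal_sc -[RHS]scal_sc; congr scal.
rewrite -[LHS]/(const_part (T (mono (pw k x)))) /T /first_order fct_add (linfD (@const_part_linf R Phi)).
rewrite const_part_NM // addr0 nabla_pw // (linf_sum (@const_part_linf R Phi)) big_ord_recr /=.
rewrite big1 ?add0r => [|j _]; rewrite (linfZ (@const_part_linf R Phi)) /const_part.
  by rewrite subnn pcoef_mono /sc pairing_pw expr0 mulr1.
rewrite pcoef_mono_neq ?/sc ?pairing0 ?mulr0 //.
by have := ltn_ord j; lia.
Qed.

Lemma pcoef1_NM k : (fun f : Sym k => pcoef 1 (D (mono f))) = w.2 k.
Proof.
apply: bdd_op_eq; [by case: sD => -[]|exact: bb|move=> x].
rewrite /D NM_nabla_pw // (lin_sum (@pcoef_lin _ _ 1)) big_ord_recr /=.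
rewrite big1 ?add0r => [|j _]; rewrite (linZ (@pcoef_lin _ _ 1)).
  rewrite subnn scale1r -[RHS]pcoef_mono; congr (pcoef 1 _).
  by apply: peval_inj => omega; rewrite peval_pwmul expr0 mul1r.
rewrite /pwmul pcoef_mono_neq ?scaler0 //.
by have := ltn_ord j; lia.
Qed.

Lemma gamma_curve (S : polyfun -> polyfun) i k : striang S ->
  (fun t : R => (fun f : Sym k => pcoef i (exp_op S t%:C (mono f)))) =
  exp_curve k (fun n f => pcoef i (iter n S (mono f))).
Proof.
move=> sS; apply/funext => t; apply/funext => f.
rewrite (exp_op_mono sS _ _ (leqnn k)) (lin_sum (@pcoef_lin _ _ i)).
by apply: eq_bigr => n _; rewrite (linZ (@pcoef_lin _ _ i)).
Qed.

Lemma curve_bdd_op (S : polyfun -> polyfun) i k n : striang S ->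
  bdd_op (fun f : Sym k => pcoef i (iter n S (mono f))).
Proof. by move=> sS; case: (triang_iter n sS.1). Qed.

Lemma curve_nilp (S : polyfun -> polyfun) i k n : striang S -> (k < n)%N ->
  (fun f : Sym k => pcoef i (iter n S (mono f))) = 0.
Proof.
by move=> sS kn; apply/funext => f; rewrite iter_nilp // (lin0 (@pcoef_lin _ _ i)).
Qed.

Lemma curve_deriv0 (S : polyfun -> polyfun) i k : striang S ->
  @op_deriv_at R (sym_sys Phi k) (sym_sys Phi i)
    (exp_curve k (fun n f => pcoef i (iter n S (mono f)))) 0 (fun f => pcoef i (S (mono f))).
Proof.
move=> sS.
have := @exp_curve_deriv R Phi k i k (fun n f => pcoef i (iter n S (mono f))) 0
  (fun n => curve_bdd_op i k n sS) (fun n => @curve_nilp S i k n sS).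
rewrite [X in op_deriv_at _ _ X](_ : _ = fun f : Sym k => pcoef i (S (mono f))) //.
apply/funext => f; rewrite /exp_curve big_ord_recl big1 ?addr0.
  by rewrite /exp_coef expr0 fact0 divr1 scale1r.
by move=> n _; rewrite /exp_coef lift0 expr0n /= mul0r scale0r.
Qed.

Theorem flow_one_param : one_param w flow.
Proof.
split.
- exact: flow_inS.
- exact: flow_add.
- move=> k; split.
    rewrite [X in op_smooth X](gamma_curve 0 k sT).
    by apply: exp_curve_smooth => n; [exact: curve_bdd_op|exact: curve_nilp].
  rewrite [X in op_smooth X](gamma_curve 1 k sD).
  by apply: exp_curve_smooth => n; [exact: curve_bdd_op|exact: curve_nilp].
move=> k; split.
  rewrite [X in op_deriv_at X](gamma_curve 0 k sT) -pcoef0_first_order.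
  exact: curve_deriv0.
rewrite [X in op_deriv_at X](gamma_curve 1 k sD) -pcoef1_NM.
exact: curve_deriv0.
Qed.

End Explicit.
End Flow.

(** * Weak derivatives of scalar curves *)

Section ScalarCurves.
Variable R : realType.
Local Notation C := R[i].
Implicit Types (u v : R -> C) (t : R) (a b : C).

(** Uniqueness only needs derivatives after pairing with a dual element, which
    makes a curve of operators a scalar curve. *)
Definition wderiv u t a : Prop := forall e : C, 0 < e ->
  \forall h \near (0 : R)^', `|(h%:C)^-1 * (u (t + h) - u t) - a| <= e.

Lemma wderiv_shift u t a : wderiv (fun h => u (h + t)) 0 a -> wderiv u t a.
Proof.
move=> h e e0; have := h e e0; apply: filterS => k.
by rewrite !add0r [k + t]addrC.
Qed.

Lemma wderiv_cst t (c : C) : wderiv (fun=> c) t 0.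
Proof.
by move=> e e0; apply: nearW => h; rewrite !subrr mulr0 subr0 normr0 ltW.
Qed.

Lemma wderiv_lin u v t a b (c : C) : wderiv u t a -> wderiv v t b ->
  wderiv (fun s => c * u s + v s) t (c * a + b).
Proof.
move=> hu hv e e0; have e2 : 0 < e / 2 by rewrite divr_gt0.
have c1 : 0 < `|c| + 1 by rewrite ltr_wpDl.
have := hv _ e2; apply: filterS2 (hu _ (divr_gt0 e2 c1)) => h hu' hv'.
have -> : (h%:C)^-1 * (c * u (t + h) + v (t + h) - (c * u t + v t)) - (c * a + b) =
  c * ((h%:C)^-1 * (u (t + h) - u t) - a) + ((h%:C)^-1 * (v (t + h) - v t) - b) by ring.
apply: le_trans (ler_normD _ _) _; rewrite [leRHS]splitr; apply: lerD => //.
rewrite normrM; apply: le_trans (ler_wpM2l (normr_ge0 _) hu') _.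
by rewrite mulrCA ler_piMr ?(ltW e2) // ler_pdivrMr // mul1r lerDl.
Qed.

Lemma wderiv_sum n (u : 'I_n -> R -> C) (a : 'I_n -> C) t : (forall i, wderiv (u i) t (a i)) ->
  wderiv (fun s => \sum_(i < n) u i s) t (\sum_(i < n) a i).
Proof.
move=> hu; elim: (index_enum _) => [|i r IH].
  rewrite big_nil; have := wderiv_cst t 0; congr wderiv.
  by apply/funext => s; rewrite big_nil.
rewrite big_cons; rewrite (_ : (fun s => _) = fun s => 1 * u i s + \sum_(j <- r) u j s).
  by rewrite -[X in X + _]mul1r; exact: wderiv_lin.
by apply/funext => s; rewrite big_cons mul1r.
Qed.

Lemma wderivM u t a (c : C) : wderiv u t a -> wderiv (fun s => u s * c) t (a * c).
Proof.
move=> hu; rewrite (_ : (fun s => _) = fun s => c * u s + 0).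
  by rewrite mulrC -[c * a]addr0; exact: wderiv_lin hu (wderiv_cst t 0).
by apply/funext => s; rewrite addr0 mulrC.
Qed.

Lemma wderiv0_cst u : (forall t, wderiv u t 0) -> forall s t, u s = u t.
Proof.
move=> hu.
have key (p : C -> R) : (forall a b, p (a - b) = p a - p b) ->
    (forall (h : R) z, p ((h%:C)^-1 * z) = h^-1 * p z) ->
    (forall z, `|p z|%:C <= `|z|) -> forall s t, p (u s) = p (u t).
  move=> pB pZ pn s t; apply: (@is_derive_0_is_cst R (p \o u) s t) => {s}{}t.
  have c : (fun h => h^-1 *: (((p \o u) \o shift t) (h *: 1) - (p \o u) t)) @ (0 : R)^' --> (0 : R).
    apply/cvgrPdist_le => e e0.
    have := hu t e%:C; rewrite ltcR => /(_ e0); apply: filterS => h.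
    rewrite subr0 sub0r normrN /= => he.
    have -> : h *: 1 + t = t + h :> R by rewrite scaler1 addrC.
    rewrite -pB -lecR; apply: le_trans he; rewrite -[X in `|X|%:C]/(h^-1 * _) -pZ; exact: pn.
  split; first by apply/cvg_ex; exists 0.
  exact: cvg_lim c.
move=> s t; apply/eqP; rewrite eq_complex; apply/andP; split; apply/eqP.
  apply: (key (@complex.Re R)) => [a b|h z|z]; rewrite ?ReP ?ReN //; last exact: normc_ge_Re.
  by rewrite -fmorphV; case: z => x y /=; rewrite mul0r subr0.
apply: (key (@complex.Im R)) => [a b|h z|z]; rewrite ?ImP ?ImN //; last exact: normc_ge_Im.
by rewrite -fmorphV; case: z => x y /=; rewrite mul0r addr0.
Qed.

Lemma wderiv_eq u v : u 0 = v 0 -> (forall t, exists2 a, wderiv u t a & wderiv v t a) -> u = v.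
Proof.
move=> e0 h; apply/funext => t; apply/eqP; rewrite -subr_eq0; apply/eqP.
pose d s := -1 * v s + u s.
have d0 s : wderiv d s 0.
  by have [a hu hv] := h s; have := wderiv_lin (-1) hv hu; rewrite mulN1r addNr.
have := wderiv0_cst d0 t 0; rewrite /d e0 !mulN1r addNr addrC => <- //.
Qed.
End ScalarCurves.

(** * Uniqueness of one-parameter groups *)

Section Uniqueness.
Variables (R : realType) (Phi : LBspace R).
Local Notation C := R[i].
Local Notation dual := (dual Phi).
Local Notation Sym k := (SymPow Phi k).
Local Notation fseries := (fseries Phi).

Lemma pairingB omega k (f g : Sym k) :
  pairing omega (f - g) = (pairing omega f : C) - (pairing omega g : C) :> C.
Proof. by rewrite pairingD -scaleN1r pairingZ mulN1r. Qed.

Lemma wderiv_pairing k i (c : R -> Sym k -> Sym i) (S : Sym k -> Sym i) (omega : dual) (f : Sym k) :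
  @op_deriv_at R (sym_sys Phi k) (sym_sys Phi i) c 0 S ->
  wderiv (fun h => pairing omega (c h f) : C) 0 (pairing omega (S f) : C).
Proof.
move=> dS e e0; have /asboolP[n _ fn] := subvalP f.
pose x0 : stage (sym_sys Phi k) n := SubspaceOf (asboolT fn).
have x0f : stage_incl x0 = f by exact: subval_inj.
have ft : tens_stp n (subval f) by case: (fn) => t tn <-; exact: tens_stp_symz.
have [c0 c0p c0P] : exists2 c0 : C, 0 < c0 & inj_norm_le n (subval f) c0.
  have [d d0 dP] := tens_stp_bounded ft; exists (d + 1); first by rewrite ltr_wpDl.
  by apply: inj_norm_le_mono dP; rewrite lerDl.
(* W tests an operator at one vector and one dual element only. *)
pose W : set (stage (sym_sys Phi k) n -> Sym i) :=
  [set Y | `|pairing omega (Y x0) : C| <= e].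
have NW : @op_nbhs0 R (sym_sys Phi k) (sym_sys Phi i) n W.
  split=> [a b X Y hX hY ab|m].
    suff H : `|a * (pairing omega (X x0) : C) + b * (pairing omega (Y x0) : C)| <= e by exact: H.
    apply: le_trans (ler_normD _ _) _; rewrite !normrM.
    apply: (@le_trans _ _ (`|a| * e + `|b| * e)).
      by apply: lerD; apply: ler_wpM2l.
    by rewrite -mulrDl; apply: ler_piMl ab; exact: ltW.
  have [r r0 rP] := inj_norm_le_ev m (fun _ : 'I_i => omega).
  have r1 : 0 < r + 1 by rewrite ltr_wpDl.
  exists (e / (c0 * (r + 1))) => [|A lA [_ hA]]; first by rewrite divr_gt0 // mulr_gt0.
  have cn : c0 != 0 by rewrite gt_eqF.
  have x1 : inj_norm_le n (subval (c0^-1 *: x0)) 1.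
    have := inj_norm_leZ c0^-1 c0P; rewrite gtr0_norm ?invr_gt0 // mulVf //.
  have := rP _ _ (hA _ x1); rewrite -[X in `|X| <= _]/(pairing omega (A (c0^-1 *: x0)) : C).
  rewrite (linZ lA) pairingZ normrM gtr0_norm ?invr_gt0 // => h.
  rewrite /W /=; move: h; rewrite ler_pdivrMl // => /le_trans; apply.
  rewrite [leLHS](_ : _ = e * (r / (r + 1))); first by rewrite ler_piMr ?(ltW e0) // ler_pdivrMr // mul1r lerDl.
  by field; rewrite cn gt_eqF.
have E (z : C) (u v q : Sym i) : pairing omega (z *: (u - v) - q) =
    z * ((pairing omega u : C) - (pairing omega v : C)) - (pairing omega q : C) :> C.
  by rewrite pairingB pairingZ pairingB.
have := dS n W NW; apply: filterS => h; rewrite /W /= x0f => H.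
by rewrite -E; exact: H.
Qed.

Lemma comp_block1 (B : fseries 1) k x : all_bdd_op B -> B 0%N = 0 ->
  comp_block B 1 (pw k x) = B k (pw k x).
Proof.
move=> bB B0; apply: pairing_sep => omega.
by rewrite pairing_comp_block // expr1 genfun_vval.
Qed.

Lemma comp_block_diag (B : fseries 1) k x : all_bdd_op B -> B 0%N = 0 -> B 1%N = id ->
  comp_block B k (pw k x) = pw k x.
Proof.
move=> bB B0 B1; apply: pairing_sep => omega; rewrite pairing_comp_block //.
by rewrite fps_exp_diag genfun_vval // ?B0 ?pairing0 // B1 !pairing_pw expr1.
Qed.

(** This makes the flow equation triangular: its terms l >= 2 do not involve the
    coefficient of degree k itself. *)
Lemma comp_block_congr (B B' : fseries 1) l k x : all_bdd_op B -> all_bdd_op B' ->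
  B 0%N = 0 -> B' 0%N = 0 -> (1 < l)%N ->
  (forall j, (j < k)%N -> B j (pw j x) = B' j (pw j x)) ->
  comp_block B l (pw k x) = comp_block B' l (pw k x).
Proof.
move=> bB bB' B0 B'0 l2 BB; apply: pairing_sep => omega; rewrite !pairing_comp_block //.
apply: (fps_exp_congr (k := k)); rewrite ?genfun_vval ?B0 ?B'0 ?pairing0 //; last by lia.
by move=> j jk; rewrite !genfun_vval // BB.
Qed.

Lemma sc_S_mul (s1 s2 : fseries 0 * fseries 1) k x : inS s1 -> inS s2 ->
  sc ((S_mul s1 s2).1 k (pw k x)) =
  \sum_(l < k.+1) (\sum_(j < l.+1) sc (s1.1 j (comp_block s2.2 j (pw l x)))) *
    sc (s2.1 (k - l)%N (pw (k - l) x)).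
Proof.
move=> /inSP[bA1 _ _ _ _] /inSP[bA2 bB2 _ B0 _]; rewrite /S_mul /=.
have bc := ser_comp_bdd_op bA1 bB2.
rewrite -genfun_sval ?genfun_ser_prod //; last exact: ser_prod_bdd_op.
rewrite fpsM; apply: eq_bigr => l _; rewrite !genfun_sval //; congr (_ * _).
by rewrite ser_comp_sum // sc_sum.
Qed.

Lemma pairing_S_mul (s1 s2 : fseries 0 * fseries 1) k x omega : inS s1 -> inS s2 ->
  pairing omega ((S_mul s1 s2).2 k (pw k x)) =
  \sum_(l < k.+1) (pairing omega (s1.2 l (comp_block s2.2 l (pw k x))) : C) :> C.
Proof.
move=> /inSP[_ bB1 _ _ _] /inSP[_ bB2 _ B0 _].
by rewrite /S_mul /= ser_comp_sum // pairing_sum.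
Qed.

(** Two idempotents of the group S coincide. In s = s * s the coefficient of
    degree k occurs once on the left and twice on the right, next to terms of
    lower degree, which therefore determine it. *)
Lemma idempotent_unique (s s' : fseries 0 * fseries 1) : inS s -> inS s' ->
  s = S_mul s s -> s' = S_mul s' s' -> s = s'.
Proof.
move=> hs hs' es es'; have [bA bB A0 B0 B1] := inSP hs; have [bA' bB' A0' B0' B1'] := inSP hs'.
have EB : forall k, s.2 k = s'.2 k.
  elim/ltn_ind => -[|[|n]] IH; first by rewrite B0 B0'.
    by rewrite B1 B1'.
  apply: bdd_op_eq; [exact: bB|exact: bB'|move=> x].
  apply: pairing_sep => omega; set k := n.+2 in IH *.
  (* The terms 1 < l < k; each of l = 1 and l = k is the coefficient itself. *)
  pose mid (r : fseries 0 * fseries 1) : C :=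
    \sum_(i < n) pairing omega (r.2 i.+2 (comp_block r.2 i.+2 (pw k x))).
  have H (r : fseries 0 * fseries 1) : inS r -> r = S_mul r r ->
      pairing omega (r.2 k (pw k x)) = - mid r :> C.
    move=> hr er; have [rA rB rA0 rB0 rB1] := inSP hr.
    have := pairing_S_mul k x omega hr hr; rewrite -er.
    rewrite big_ord_recl rB0 pairing0 add0r big_ord_recl lift0 rB1 comp_block1 //.
    rewrite big_ord_recr /= -/k comp_block_diag // -/(mid r).
    move: (mid r) (pairing omega (r.2 k (pw k x)) : C) => m p h.
    by apply/eqP; rewrite -addr_eq0; apply/eqP; apply: (addrI p); rewrite addr0 [p + m]addrC -h.
  rewrite !H //; congr (- _); apply: eq_bigr => i _.
  rewrite (comp_block_congr (B' := s'.2)) //; last by move=> j jk; rewrite IH.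
  by rewrite IH //; have := ltn_ord i; rewrite /k; lia.
have E2 : s.2 = s'.2 by exact: fseries_ext.
have EA : forall k, s.1 k = s'.1 k.
  elim/ltn_ind => -[|n] IH; first by rewrite A0 A0'.
  apply: bdd_op_eq; [exact: bA|exact: bA'|move=> x].
  set k := n.+1 in IH *; rewrite -[LHS]scal_sc -[RHS]scal_sc; congr scal.
  (* All terms but l = 0 and l = j = k, which both are the coefficient itself. *)
  pose mid (r : fseries 0 * fseries 1) : C :=
    \sum_(i < n) (\sum_(j < i.+2) sc (r.1 j (comp_block s.2 j (pw i.+1 x)))) *
      sc (r.1 (k - i.+1)%N (pw (k - i.+1) x)) +
    \sum_(j < k) sc (r.1 j (comp_block s.2 j (pw k x))).
  have pw0 : pwform x (fun _ : 'I_0 => dual0 Phi) = 1 :> C.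
    by rewrite -[LHS]/(sc (pw 0 x)) /sc pairing_pw expr0.
  have H (r : fseries 0 * fseries 1) : inS r -> r.2 = s.2 -> r = S_mul r r -> sc (r.1 k (pw k x)) = - mid r.
    move=> hr r2 er; have [rA rB rA0 rB0 rB1] := inSP hr.
    have := sc_S_mul k x hr hr; rewrite -er r2.
    rewrite big_ord_recl big_ord1 rA0 subn0 comp_block_diag //.
    rewrite big_ord_recr /= -/k subnn rA0 big_ord_recr /= comp_block_diag //.
    rewrite pw0 mul1r mulr1 => h.
    have {h} : sc (r.1 k (pw k x)) = sc (r.1 k (pw k x)) + (mid r + sc (r.1 k (pw k x))).
      by rewrite /mid -addrA; exact: h.
    move: (mid r) (sc (r.1 k (pw k x))) => m p h.
    by apply/eqP; rewrite -addr_eq0 addrC; apply/eqP; apply: (addrI p); rewrite addr0 -h.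
  rewrite !H //; congr (- _); rewrite /mid; congr (_ + _); last first.
    by apply: eq_bigr => j _; rewrite IH.
  apply: eq_bigr => i _; have iN := ltn_ord i; congr (_ * _); last by rewrite IH //; rewrite /k; lia.
  by apply: eq_bigr => j _; rewrite IH //; have := ltn_ord j; rewrite /k; lia.
by rewrite [s]surjective_pairing [s']surjective_pairing E2 (fseries_ext EA).
Qed.

(** The group law gives the derivative of a one-parameter group at t from the
    one at 0, and its k-th coefficient only involves the lower coefficients at t. *)
Lemma one_param_unique (w : fseries 0 * fseries 1) (g g' : R -> fseries 0 * fseries 1) : inW w -> one_param w g -> one_param w g' -> g = g'.
Proof.
move=> /lie_pairP[_ _ a0 b0 b1] [iS gD _ g0] [iS' gD' _ g0'].
have base : g 0 = g' 0.
  by apply: idempotent_unique => //; rewrite -?gD -?gD' addr0.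
have wderivB (h : R -> fseries 0 * fseries 1) : (forall t, inS (h t)) ->
    (forall s t, h (s + t) = S_mul (h s) (h t)) ->
    (forall k, op_deriv_at (fun t => (h t).2 k) 0 (w.2 k)) -> forall k x omega t,
    wderiv (fun t => pairing omega ((h t).2 k (pw k x)) : C) t
       (\sum_(l < k.+1) (pairing omega (w.2 l (comp_block (h t).2 l (pw k x))) : C)).
  move=> hS hD h0 k x omega t; apply: wderiv_shift.
  rewrite (_ : (fun s => _) = fun s => \sum_(l < k.+1)
      (pairing omega ((h s).2 l (comp_block (h t).2 l (pw k x))) : C)).
    by apply: wderiv_sum => l; exact: (wderiv_pairing omega _ (h0 l)).
  by apply/funext => s; rewrite hD pairing_S_mul.
have wderivA (h : R -> fseries 0 * fseries 1) : (forall t, inS (h t)) ->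
    (forall s t, h (s + t) = S_mul (h s) (h t)) ->
    (forall k, op_deriv_at (fun t => (h t).1 k) 0 (w.1 k)) -> forall k x t,
    wderiv (fun t => sc ((h t).1 k (pw k x))) t
       (\sum_(l < k.+1) (\sum_(j < l.+1) sc (w.1 j (comp_block (h t).2 j (pw l x)))) *
          sc ((h t).1 (k - l)%N (pw (k - l) x))).
  move=> hS hD h0 k x t; apply: wderiv_shift.
  rewrite (_ : (fun s => _) = fun s => \sum_(l < k.+1)
      (\sum_(j < l.+1) sc ((h s).1 j (comp_block (h t).2 j (pw l x)))) *
      sc ((h t).1 (k - l)%N (pw (k - l) x))).
    by apply: wderiv_sum => l; apply: wderivM; apply: wderiv_sum => j; exact: (wderiv_pairing (dual0 Phi) _ (h0 j)).
  by apply/funext => s; rewrite hD sc_S_mul.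
have EB : forall k t, (g t).2 k = (g' t).2 k.
  elim/ltn_ind => k IH.
  suff H x omega : (fun t => pairing omega ((g t).2 k (pw k x)) : C) =
      (fun t => pairing omega ((g' t).2 k (pw k x)) : C).
    move=> t; have [_ bB _ _ _] := inSP (iS t); have [_ bB' _ _ _] := inSP (iS' t).
    apply: bdd_op_eq; [exact: bB|exact: bB'|move=> x].
    by apply: pairing_sep => omega; exact: (congr1 (fun u => u t) (H x omega)).
  apply: wderiv_eq => [|t]; first by rewrite base.
  eexists; first exact: (wderivB g iS gD (fun k => (g0 k).2)).
  rewrite [X in wderiv _ _ X](_ : _ = \sum_(l < k.+1)
    (pairing omega (w.2 l (comp_block (g' t).2 l (pw k x))) : C)).
    exact: (wderivB g' iS' gD' (fun k => (g0' k).2)).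
  have [_ bB _ B0 _] := inSP (iS t); have [_ bB' _ B'0 _] := inSP (iS' t).
  apply: eq_bigr => -[[|[|l]] /= lk] _; rewrite ?b0 ?b1 //.
  by rewrite (comp_block_congr (B' := (g' t).2)) // => j jk; rewrite IH.
have E2 t : (g t).2 = (g' t).2 by apply: fseries_ext => k; exact: EB.
have EA : forall k t, (g t).1 k = (g' t).1 k.
  elim/ltn_ind => k IH.
  suff H x : (fun t => sc ((g t).1 k (pw k x))) = (fun t => sc ((g' t).1 k (pw k x))).
    move=> t; have [bA _ _ _ _] := inSP (iS t); have [bA' _ _ _ _] := inSP (iS' t).
    apply: bdd_op_eq; [exact: bA|exact: bA'|move=> x].
    by rewrite -[LHS]scal_sc -[RHS]scal_sc; congr scal; exact: (congr1 (fun u => u t) (H x)).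
  apply: wderiv_eq => [|t]; first by rewrite base.
  eexists; first exact: (wderivA g iS gD (fun k => (g0 k).1)).
  rewrite [X in wderiv _ _ X](_ : _ = \sum_(l < k.+1)
    (\sum_(j < l.+1) sc (w.1 j (comp_block (g' t).2 j (pw l x)))) *
          sc ((g' t).1 (k - l)%N (pw (k - l) x))).
    exact: (wderivA g' iS' gD' (fun k => (g0' k).1)).
  apply: eq_bigr => -[[|l] /= lk] _; rewrite E2.
    by rewrite !big_ord1 a0 /sc pairing0 !mul0r.
  by rewrite IH //; lia.
apply/funext => t; rewrite [g t]surjective_pairing [g' t]surjective_pairing E2.
by congr (_, _); apply: fseries_ext => k; exact: EA.
Qed.

Lemma EXP_flow (w : fseries 0 * fseries 1) : inW w -> EXP w = flow w 1.
Proof.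
move=> hw.
have [g hg <-] : [set s | exists2 gamma, one_param w gamma & gamma 1 = s] (EXP w).
  by apply: theP; exists (flow w) => //; exact: flow_one_param.
by rewrite (one_param_unique hw hg (flow_one_param hw)).
Qed.

Theorem Rtilde_first_order (w : fseries 0 * fseries 1) : inW w ->
  riordan_alg (Rtilde w) /\ Rtilde w = first_order w.1 w.2.
Proof.
move=> hw; have fS := flow_inS hw 1; rewrite /Rtilde EXP_flow //; split.
  by exists (Itilde (flow w 1)) => //; exact: (Itilde_riordan fS).1.
rewrite Itilde_riordan_op // riordan_op_flow // op_log_exp_op //.
exact: first_order_striang (lie_pairP hw).
Qed.

End Uniqueness.

Theorem theorem5p15 (R : realType) (Phi : LBspace R) :
  [/\ forall s : fseries Phi 0 * fseries Phi 1, inS s ->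
        riordan (Itilde s) /\ riordan_genfun (Itilde s) s,
      forall w : fseries Phi 0 * fseries Phi 1, inW w ->
        riordan_alg (Rtilde w) /\ Rtilde w = nabla w.1 + NM_nabla w.2 &
      forall w1 w2 : fseries Phi 0 * fseries Phi 1, inW w1 -> inW w2 ->
        op_comm (nabla w1.1 + NM_nabla w1.2) (nabla w2.1 + NM_nabla w2.2)
        = nabla (ser_deriv w2.2 w1.1) - nabla (ser_deriv w1.2 w2.1)
          + NM_nabla (ser_sub (ser_deriv w2.2 w1.2) (ser_deriv w1.2 w2.2))].
Proof.
split; [exact: Itilde_riordan|exact: Rtilde_first_order|move=> w1 w2 h1 h2].
exact: first_order_comm (lie_pairP h1) (lie_pairP h2).
Qed.
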